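(* For $s\ge0$ the following hold. (1) $X^s(\mathbb{R})=H^s(\mathbb{R})$, and $\|\cdot\|_{X^s}$ and $\|\cdot\|_{H^s}$ are equivalent norms. (2) If $d\ge2$, then we have the strict inclusion $H^s(\mathbb{R}^d)\subset X^s(\mathbb{R}^d)$ and $\|f\|_{X^s}\le2\|f\|_{H^s}$ for all $f\in H^s(\mathbb{R}^d)$. (3) If $d\ge2$, then $X^s(\mathbb{R}^d)$ is not closed under rotation in the sense that for every $Q\in O(d)$ such that $|Qe_1\cdot e_1|<1$ there exists $f\in X^s(\mathbb{R}^d)\cap C_0^\infty(\mathbb{R}^d)$ such that $f(Q\,\cdot)\notin X^s(\mathbb{R}^d)$.
   Context: $\hat f(\xi)=\int_{\mathbb{R}^d}f(x)e^{-2\pi ix\cdot\xi}dx$. $H^s(\mathbb{R}^d)$ is the real-valued Sobolev space with norm $\|f\|_{H^s}^2=\int(1+|\xi|^2)^s|\hat f(\xi)|^2d\xi$. For $s\ge0$ let $\omega_s(\xi)=\frac{\xi_1^2+|\xi|^4}{|\xi|^2}$ for $|\xi|<1$ and $\omega_s(\xi)=(1+|\xi|^2)^s$ for $|\xi|\ge1$. $X^s(\mathbb{R}^d)$ is the space of real-valued tempered distributions $f$ with $\hat f\in L^1_{loc}(\mathbb{R}^d)$ and $\|f\|_{X^s}^2=\int_{\mathbb{R}^d}\omega_s(\xi)|\hat f(\xi)|^2d\xi<\infty$. $C_0^\infty(\mathbb{R}^d)=\bigcap_kC_0^k(\mathbb{R}^d)$ is the space of smooth functions all of whose derivatives (including order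 $0$) tend to $0$ at infinity. $O(d)$ is the orthogonal group. *)

(* Defs.v *)
From HB Require Import structures.
From mathcomp Require Import all_boot all_order all_algebra.
From mathcomp Require Import all_classical all_reals all_analysis.
From mathcomp Require Import complex.
Set Implicit Arguments.
Unset Strict Implicit.
Unset Printing Implicit Defensive.
Import Order.TTheory GRing.Theory Num.Theory.
Import numFieldNormedType.Exports.
Local Open Scope classical_set_scope.
Local Open Scope ring_scope.
Local Open Scope complex_scope.

(* Points of R^d are row vectors; the library norm `|x| on them is the sup
   norm, so the Euclidean structure is introduced separately. *)
Definition dotv (R : realType) (d : nat) (x y : 'rV[R]_d) : R :=
  \sum_(i < d) x ord0 i * y ord0 i.

Definition enorm (R : realType) (d : nat) (x : 'rV[R]_d) : R :=
  Num.sqrt (dotv x x).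

Definition basis_vec (R : realType) (d : nat) (i : 'I_d) : 'rV[R]_d :=
  delta_mx ord0 i.

(* Lebesgue measure on R^d, built as an iterated product on d-tuples (which
   carry the product sigma-algebra) and read on row vectors through vec. *)
Section lebesgue_measure_Rd.
Variable R : realType.

Definition cons_pair (n : nat)
    (p : n.-tuple (measurableTypeR R) * measurableTypeR R) :
    n.+1.-tuple (measurableTypeR R) := [tuple of p.2 :: p.1].

Lemma measurable_cons_pair n : measurable_fun setT (@cons_pair n).
Proof. exact: (measurable_cons measurable_snd measurable_fst). Qed.

Section lebesgue_cons.
Variables (n : nat) (m : {measure set (n.-tuple (measurableTypeR R)) -> \bar R}).

Definition lebesgue_cons : set (n.+1.-tuple (measurableTypeR R)) -> \bar R :=
  pushforward (m \x (@lebesgue_measure R))%E (@cons_pair n).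

HB.instance Definition _ := Measure.copy lebesgue_cons
  (measure_function_pushforward__canonical__measure_function_Measure
    (m \x (@lebesgue_measure R))%E (@measurable_cons_pair n)).

End lebesgue_cons.

Fixpoint lebesgue_Rd (d : nat) :
    {measure set (d.-tuple (measurableTypeR R)) -> \bar R} :=
  match d with
  | 0 => \d_[tuple]
  | n.+1 => lebesgue_cons (lebesgue_Rd n)
  end.

Definition vec (d : nat) (t : d.-tuple (measurableTypeR R)) : 'rV[R]_d :=
  \row_(i < d) tnth t i.

End lebesgue_measure_Rd.

Definition cintegrable (R : realType) (d : nat) (A : set 'rV[R]_d)
    (f : 'rV[R]_d -> R[i]) : Prop :=
  (lebesgue_Rd R d).-integrable (@vec R d @^-1` A)
    (fun t => (complex.Re (f (vec t)))%:E) /\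
  (lebesgue_Rd R d).-integrable (@vec R d @^-1` A)
    (fun t => (complex.Im (f (vec t)))%:E).

Definition cintegral (R : realType) (d : nat) (f : 'rV[R]_d -> R[i]) : R[i] :=
  (\int[lebesgue_Rd R d]_t complex.Re (f (vec t))) +i*
  (\int[lebesgue_Rd R d]_t complex.Im (f (vec t))).

Definition L1loc (R : realType) (d : nat) (f : 'rV[R]_d -> R[i]) : Prop :=
  [/\ measurable_fun setT (fun t => complex.Re (f (@vec R d t))),
      measurable_fun setT (fun t => complex.Im (f (@vec R d t))) &
      forall K : set 'rV[R]_d, compact K -> cintegrable K f].

(* The word w = [:: i1; ...; ik] encodes the derivative d_i1 ... d_ik. *)
Definition partials (R : realType) (d : nat) (w : seq 'I_d)
    (f : 'rV[R]_d -> R) : 'rV[R]_d -> R :=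
  foldr (fun i g => 'D_(basis_vec R i) g) f w.

Definition smooth (R : realType) (d : nat) (f : 'rV[R]_d -> R) : Prop :=
  forall w : seq 'I_d, continuous (partials w f) /\
    forall x i, derivable (partials w f) x (basis_vec R i).

Definition csmooth (R : realType) (d : nat) (f : 'rV[R]_d -> R[i]) : Prop :=
  smooth (fun x => complex.Re (f x)) /\ smooth (fun x => complex.Im (f x)).

Definition cpartials (R : realType) (d : nat) (w : seq 'I_d)
    (f : 'rV[R]_d -> R[i]) (x : 'rV[R]_d) : R[i] :=
  partials w (fun y => complex.Re (f y)) x +i*
  partials w (fun y => complex.Im (f y)) x.

Definition C0infty (R : realType) (d : nat) (f : 'rV[R]_d -> R) : Prop :=
  smooth f /\
  forall (w : seq 'I_d) (e : R), 0 < e ->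
    exists M : R, forall x, M < enorm x -> `|partials w f x| < e.

Definition Ccinfty (R : realType) (d : nat) (phi : 'rV[R]_d -> R[i]) : Prop :=
  csmooth phi /\
  exists2 K : set 'rV[R]_d, compact K & forall x, ~ K x -> phi x = 0.

(* Increasing family of seminorms defining the Frechet topology of the
   Schwartz space. *)
Definition schwartz_seminorm (R : realType) (d : nat) (N : nat)
    (phi : 'rV[R]_d -> R[i]) : \bar R :=
  ereal_sup [set y : \bar R | exists (w : seq 'I_d) (x : 'rV[R]_d),
    (size w <= N)%N /\
    y = ((1 + enorm x) ^+ N * Normc.normc (cpartials w phi x))%:E].

Definition schwartz (R : realType) (d : nat) (phi : 'rV[R]_d -> R[i]) : Prop :=
  csmooth phi /\ forall N, (schwartz_seminorm N phi < +oo)%E.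

Definition fourier (R : realType) (d : nat) (phi : 'rV[R]_d -> R[i])
    (xi : 'rV[R]_d) : R[i] :=
  cintegral (fun x => phi x *
    (cos (2 * pi * dotv x xi) -i* sin (2 * pi * dotv x xi))).

(* A functional on Schwartz functions is encoded as a functional on all
   functions that vanishes off the Schwartz space, so that distinct
   functionals below are distinct distributions. *)
Definition functional (R : realType) (d : nat) : Type :=
  ('rV[R]_d -> R[i]) -> R[i].

Definition tempered (R : realType) (d : nat) (T : functional R d) : Prop :=
  [/\ forall phi, ~ schwartz phi -> T phi = 0,
      forall (a : R[i]) phi psi, schwartz phi -> schwartz psi ->
        T (fun x => a * phi x + psi x) = a * T phi + T psi &
      forall phi, schwartz phi -> forall e : R, 0 < e ->
        exists (N : nat) (delta : R), 0 < delta /\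
          forall psi, schwartz psi ->
            (schwartz_seminorm N (fun x => psi x - phi x)%R < delta%:E)%E ->
            Normc.normc (T psi - T phi) < e].

Definition real_valued (R : realType) (d : nat) (T : functional R d) : Prop :=
  forall phi, schwartz phi -> (forall x, complex.Im (phi x) = 0) ->
    complex.Im (T phi) = 0.

Definition of_function (R : realType) (d : nat) (f : 'rV[R]_d -> R) :
    functional R d :=
  fun phi => if `[< schwartz phi >] then cintegral (fun x => (f x)%:C * phi x)
             else 0.

(* T^ is the locally integrable function g.  The identity <T, phi^> = <g, phi>
   is tested on compactly supported phi only: for a merely locally integrable g
   the product g * phi need not be integrable for all Schwartz phi. *)
Definition has_fourier (R : realType) (d : nat) (T : functional R d)
    (g : 'rV[R]_d -> R[i]) : Prop :=
  L1loc g /\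
  forall phi, Ccinfty phi -> T (fourier phi) = cintegral (fun x => g x * phi x).

(* A representative of T^, which is determined almost everywhere. *)
Definition fhat (R : realType) (d : nat) (T : functional R d) :
    'rV[R]_d -> R[i] :=
  xget (fun=> 0) [set g | has_fourier T g].

Definition weighted_normsq (R : realType) (d : nat) (w : 'rV[R]_d -> R)
    (T : functional R d) : \bar R :=
  (\int[lebesgue_Rd R d]_t
     (w (vec t) * Normc.normc (fhat T (vec t)) ^+ 2)%:E)%E.

Definition weighted_norm (R : realType) (d : nat) (w : 'rV[R]_d -> R)
    (T : functional R d) : R :=
  Num.sqrt (fine (weighted_normsq w T)).

Definition weighted_space (R : realType) (d : nat) (w : 'rV[R]_d -> R) :
    set (functional R d) :=
  [set T | [/\ tempered T, real_valued T, exists g, has_fourier T g &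
               (weighted_normsq w T < +oo)%E]].

Definition bessel_weight (R : realType) (d : nat) (s : R) (xi : 'rV[R]_d) : R :=
  (1 + enorm xi ^+ 2) `^ s.

(* xi_1 is the coordinate of index ord0, hence the ambient dimension d.+1. *)
Definition omega (R : realType) (d : nat) (s : R) (xi : 'rV[R]_d.+1) : R :=
  if enorm xi < 1
  then (xi ord0 ord0 ^+ 2 + enorm xi ^+ 4) / enorm xi ^+ 2
  else (1 + enorm xi ^+ 2) `^ s.

Definition Hspace (R : realType) (d : nat) (s : R) : set (functional R d) :=
  weighted_space (bessel_weight s).
Definition Hnorm (R : realType) (d : nat) (s : R) (T : functional R d) : R :=
  weighted_norm (bessel_weight s) T.

Definition Xspace (R : realType) (d : nat) (s : R) :
    set (functional R d.+1) :=
  weighted_space (omega s).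
Definition Xnorm (R : realType) (d : nat) (s : R)
    (T : functional R d.+1) : R :=
  weighted_norm (omega s) T.

Definition equivalent_norms (R : realType) (V : Type) (E : set V)
    (N1 N2 : V -> R) : Prop :=
  exists c C : R, [/\ 0 < c, 0 < C &
    forall v, E v -> c * N2 v <= N1 v /\ N1 v <= C * N2 v].

(* The matrix Q acts on row vectors by x |-> (Q x^T)^T. *)
Definition mxact (R : realType) (d : nat) (Q : 'M[R]_d) (x : 'rV[R]_d) :
    'rV[R]_d := x *m Q^T.

Definition orthogonal_mx (R : realType) (d : nat) (Q : 'M[R]_d) : Prop :=
  Q^T *m Q = 1%:M.

(* Main.v *)
(* Fix j <> 0 with Q_j0 <> 0.  For a unit vector u let f_u be the superposition
   of the modes

     4^(-nd) exp (- pi 16^(-2n) |x|^2) cos (2 pi 4^(-n) x.u),   n >= 1,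

   with weights 2^(-n) (the ambient dimension being d + 1).  The Fourier
   transform of the n-th mode consists of two Gaussian bumps of width 16^(-n)
   centred at +- 4^(-n) u.  If u_0 = 0, then omega is O(16^(-n)) on these bumps,
   and the amplitudes are such that each mode has bounded X^s-norm; if
   u_0 <> 0, then omega is bounded below near them and the squared norm of the
   n-th weighted mode grows like 4^n.  Since f_u (Q .) = f_(Q^T u) and the
   coordinate 0 of Q^T e_j is Q_j0, the function f_(e_j) gives (3).  It also
   gives the strictness in (2), because the Bessel weight is bounded below
   everywhere.  The norm inequalities are pointwise comparisons of the weights,
   which in dimension 1 fail only at the origin. *)
Require Import Defs.
From HB Require Import structures.
From mathcomp Require Import all_boot all_order all_algebra.
From mathcomp Require Import all_classical all_reals all_analysis.
From mathcomp Require Import measurable_realfun complex ring lra.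
Set Implicit Arguments.
Unset Strict Implicit.
Unset Printing Implicit Defensive.
Import Order.TTheory GRing.Theory Num.Theory.
Import numFieldNormedType.Exports.
Local Open Scope classical_set_scope.
Local Open Scope ring_scope.

(** * Integration on R^d *)

(** The representative [fhat] is an arbitrary choice, so the transform of f_u has to be exhibited
    and then identified almost everywhere. Gaussian modes have explicit transforms: a differential
    equation along rays and Fubini's theorem take the place of an inversion formula, and the series
    follows by dominated convergence. No orthogonality of the modes is used. Above, the weights
    2^(-n) sum to 1 and Jensen's inequality reduces the norm of the series to those of the modes;
    below, the transforms are nonnegative, nothing cancels, and each single mode is a lower bound.
    The width is the square of the frequency r = 4^(-n): at distance r^2 from r u with u_0 = 0, both
    parts of omega, xi_1^2 / |xi|^2 and |xi|^2, are of order r^2. A bump of width r^2 and mass A has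
    squared L^2 norm of order A^2 r^(-2(d+1)), so A = r^d balances the weight r^2. Against a weight
    of order 1 a factor r^(-2) = 16^n is left over, which beats the loss 4^(-n) due to the squared
    weights. *)

Section lebesgue_Rd_theory.
Variable R : realType.
Local Notation leb d := (lebesgue_Rd R d).
Local Notation T d := (d.-tuple (measurableTypeR R)).

(** Tonelli's theorem asks this of the lower-dimensional factor. The product is covered by the
    rectangles over pairs of covering sets. *)
Let lebesgue_Rd_sigma_finite d : sigma_finite setT (leb d).
Proof.
elim: d => [|d IH].
  exists (fun=> setT); first by rewrite bigcup_const.
  by move=> i; split=> //=; rewrite diracE; case: (_ \in _); rewrite /= ?ltry//.
have [F FT Fm] := IH.
have [G GT Gm] := @sigma_finiteT _ _ _ (@lebesgue_measure R).
pose tl (t : T d.+1) : T d := [tuple of behead t]; pose E (n : nat) (k : nat) : set (T d.+1) :=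
  [set t : T d.+1 | F n (tl t) /\ G k (thead t)].
(* Numbers that code no pair repeat the rectangle of index (0, 0), which does no harm to the
   cover. *)
pose pr (m : nat) := odflt (0%N, 0%N) (unpickle m : option (nat * nat)).
exists (fun m => E (pr m).1 (pr m).2).
  apply/esym/seteqP; split=> // t _.
  have [n _ Fn] : (\bigcup_n F n) (tl t) by rewrite -FT.
  have [k _ Gk] : (\bigcup_n G n) (thead t : measurableTypeR R) by rewrite -GT.
  by exists (pickle (n, k)) => //; rewrite /pr pickleK.
move=> m; set n := (pr m).1; set k := (pr m).2.
have mE : measurable (E n k).
  apply: measurableI.
    by rewrite -[X in measurable X]setTI; apply: measurable_behead => //; exact: (Fm n).1.
  by rewrite -[X in measurable X]setTI; apply: measurable_tnth => //; exact: (Gm k).1.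
split=> //=.
rewrite /lebesgue_cons /pushforward.
rewrite (_ : _ @^-1` _ = F n `*` G k); last first.
  apply/seteqP; split => -[x y] /=; rewrite /E /cons_pair /= theadE.
    rewrite (_ : tl _ = x)//; exact: val_inj.
  rewrite (_ : tl _ = x)//; exact: val_inj.
rewrite product_measure1E; [|exact: (Fm n).1|exact: (Gm k).1].
by apply: lte_mul_pinfty => //; [rewrite ge0_fin_numE//; exact: (Fm n).2|exact: (Gm k).2].
Qed.

(* Alias of [leb] carrying a sigma-finite structure. *)
Definition sleb d : set (T d) -> \bar R := leb d.
HB.instance Definition _ d := Measure.on (sleb (d := d)).
HB.instance Definition _ d := Measure_isSigmaFinite.Build _ _ _
  (sleb (d := d)) (lebesgue_Rd_sigma_finite d).

Local Open Scope ereal_scope.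

Lemma ge0_integral_lebesgue_cons n (F : T n.+1 -> \bar R) :
  measurable_fun setT F -> (forall t, 0 <= F t) ->
  \int[leb n.+1]_t F t =
  \int[leb n]_x \int[@lebesgue_measure R]_y F (cons_pair (x, y)).
Proof.
move=> mF F0.
have -> : \int[leb n.+1]_t F t =
    \int[(sleb (d := n) \x @lebesgue_measure R)]_z (F \o @cons_pair R n) z.
  have := @ge0_integral_pushforward _ _ _ _ R (@cons_pair R n)
    (@measurable_cons_pair R n) (sleb (d := n) \x @lebesgue_measure R)
    setT F measurableT mF (fun y _ => F0 y).
  by rewrite preimage_setT.
rewrite (@fubini_tonelli1 _ _ _ _ R (sleb (d := n)) (@lebesgue_measure R)
  (F \o @cons_pair R n)) //; last by move=> z; exact: F0.
by apply: measurableT_comp => //; exact: measurable_cons_pair.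
Qed.

Lemma ge0_integral_lebesgue_consC n (F : T n.+1 -> \bar R) :
  measurable_fun setT F -> (forall t, 0 <= F t) ->
  \int[leb n.+1]_t F t =
  \int[@lebesgue_measure R]_y \int[leb n]_x F (cons_pair (x, y)).
Proof.
move=> mF F0; rewrite ge0_integral_lebesgue_cons//.
rewrite (@fubini_tonelli _ _ _ _ R (sleb (d := n)) (@lebesgue_measure R)
  (F \o @cons_pair R n)) //; last by move=> z; exact: F0.
by apply: measurableT_comp => //; exact: measurable_cons_pair.
Qed.

Lemma integral_lebesgue_Rd0 (F : T 0 -> \bar R) : measurable_fun setT F ->
  \int[leb 0]_t F t = F [tuple].
Proof. by move=> mF; rewrite /= integral_dirac// diracT mul1e. Qed.

Lemma measurable_coord d (i : 'I_d) d' (Y : measurableType d') (h : R -> Y) :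
  measurable_fun setT h -> measurable_fun setT (fun t : T d => h (tnth t i)).
Proof. by move=> mh; apply: (measurableT_comp mh); exact: measurable_tnth. Qed.

Lemma ge0_integral_prod d (h : 'I_d -> R -> R) :
  (forall i, measurable_fun setT (h i)) -> (forall i x, 0 <= h i x)%R ->
  \int[leb d]_t (\prod_(i < d) h i (tnth t i))%:E =
  \prod_(i < d) \int[@lebesgue_measure R]_x (h i x)%:E.
Proof.
elim: d h => [|d IH] h mh h0.
  rewrite integral_lebesgue_Rd0 ?big_ord0//.
  by under eq_fun do rewrite big_ord0; exact: measurable_cst.
have mp : measurable_fun setT
    (fun t : T d => \prod_(i < d) h (lift ord0 i) (tnth t i))%R.
  by apply: measurable_prod => i _; exact: measurable_coord.
rewrite ge0_integral_lebesgue_cons; last 2 first.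
- apply/measurable_EFinP; apply: measurable_prod => i _.
  exact: measurable_coord.
- by move=> t; rewrite lee_fin prodr_ge0.
rewrite big_ord_recl -IH//.
transitivity (\int[leb d]_x ((\int[@lebesgue_measure R]_y (h ord0 y)%:E) *
    (\prod_(i < d) h (lift ord0 i) (tnth x i))%:E)).
  apply: eq_integral => x _; rewrite muleC -ge0_integralZl//; last 3 first.
  - by apply/measurable_EFinP; exact: mh.
  - by move=> y _; rewrite lee_fin.
  - by rewrite lee_fin prodr_ge0.
  apply: eq_integral => y _; rewrite big_ord_recl muleC -EFinM.
  congr ((h _ _ * _)%:E); apply: eq_bigr => i _.
  by rewrite /cons_pair tnthS.
rewrite ge0_integralZl//.
- by apply/measurable_EFinP.
- by move=> x _; rewrite lee_fin prodr_ge0.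
- by apply: integral_ge0 => x _; rewrite lee_fin.
Qed.

(** Lebesgue measure is determined by its values on half-open intervals, and translation preserves
    their lengths. *)
Lemma lebesgue_measure_shift (a : R) (A : set R) : measurable A ->
  pushforward (@lebesgue_measure R) ((fun x => x + a)%R : R -> measurableTypeR R) A
  = lebesgue_measure A.
Proof.
move=> mA; apply/esym.
have ms : measurable_fun setT ((fun x => x + a)%R : R -> measurableTypeR R).
  exact: measurable_funD.
apply: (@lebesgue_measure_unique R
  (measure_function_pushforward__canonical__measure_function_Measure
    (@lebesgue_measure R) ms)) => //= _ [[x y]] _ <-.
rewrite /pushforward.
rewrite (_ : _ @^-1` _ = `](x - a)%R, (y - a)%R]%classic); last first.
  by apply/seteqP; split => z /=; rewrite !in_itv/= ltrBlDr lerBrDr.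
rewrite !lebesgue_measure_itv/= !lte_fin ltrD2r; case: ifP => // _.
by rewrite -!EFinB; congr EFin; lra.
Qed.

Lemma ge0_integral_shift1 (F : R -> \bar R) (a : R) :
  measurable_fun setT F -> (forall x, 0 <= F x) ->
  \int[@lebesgue_measure R]_x F (x + a)%R = \int[@lebesgue_measure R]_x F x.
Proof.
move=> mF F0.
pose sh : measurableTypeR R -> measurableTypeR R := fun x => (x + a)%R.
have ms : measurable_fun setT sh by exact: measurable_funD.
have := @ge0_integral_pushforward _ _ (measurableTypeR R) (measurableTypeR R) R
  sh ms (@lebesgue_measure R) setT F measurableT mF (fun y _ => F0 y).
rewrite preimage_setT => <-.
by apply: eq_measure_integral => /= A mA _; rewrite -(lebesgue_measure_shift a).
Qed.

Definition shift_tuple d (j : 'I_d) (a : R) (t : T d) : T d :=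
  [tuple if i == j then (tnth t i + a)%R else tnth t i | i < d].

Lemma measurable_shift_tuple d (j : 'I_d) (a : R) :
  measurable_fun setT (shift_tuple j a).
Proof.
apply/measurable_fun_tnthP => i.
rewrite (_ : _ \o _ = fun t : T d => if i == j then (tnth t i + a)%R else tnth t i).
  by case: (i == j); [apply: measurable_funD => //|]; exact: measurable_tnth.
by apply/funext => t /=; rewrite tnth_mktuple.
Qed.

Lemma ge0_integral_shift d (j : 'I_d) (a : R) (F : T d -> \bar R) :
  measurable_fun setT F -> (forall x, 0 <= F x) ->
  \int[leb d]_t F (shift_tuple j a t) = \int[leb d]_t F t.
Proof.
elim: d j F => [[]//|d IH] j F mF F0.
have mFs : measurable_fun setT (fun t => F (shift_tuple j a t)).
  by apply: measurableT_comp => //; exact: measurable_shift_tuple.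
have mc : measurable_fun setT (F \o @cons_pair R d).
  by apply: measurableT_comp => //; exact: measurable_cons_pair.
(* The order of integration is chosen to put the shifted coordinate in the inner integral: in the
   tail the induction applies, at the head the one-dimensional case. *)
have [j' jE|jE] := unliftP ord0 j.
- rewrite ge0_integral_lebesgue_consC// [in RHS]ge0_integral_lebesgue_consC//.
  apply: eq_integral => y _.
  rewrite -(IH j' (fun x => F (cons_pair (x, y))))//; last first.
    by apply: (measurableT_comp mc); apply: measurable_fun_pair.
  apply: eq_integral => x _; congr F; apply: eq_from_tnth => i.
  rewrite tnth_mktuple jE /cons_pair/=; have [i' ->|->] := unliftP ord0 i.
    by rewrite !tnthS tnth_mktuple (inj_eq lift_inj).
  by rewrite -(negbK (_ == _)) neq_lift.
- rewrite ge0_integral_lebesgue_cons// [in RHS]ge0_integral_lebesgue_cons//.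
  apply: eq_integral => x _.
  rewrite -(@ge0_integral_shift1 (fun y => F (cons_pair (x, y))) a)//; last first.
    by apply: (measurableT_comp mc); apply: measurable_fun_pair.
  apply: eq_integral => y _; congr F; apply: eq_from_tnth => i.
  rewrite tnth_mktuple jE /cons_pair/=; have [i' ->|->] := unliftP ord0 i.
    by rewrite !tnthS eq_sym -(negbK (_ == _)) neq_lift.
  by rewrite eqxx.
Qed.

End lebesgue_Rd_theory.

(** The sets over which f has integral 0 form a Dynkin system, complements being covered by the
    vanishing of the total integral, so Dynkin's theorem reaches all measurable sets. This is the
    measure-theoretic core of the uniqueness of the Fourier transform. *)
Lemma integrable_pi_system_ae0 d (T : measurableType d) (R : realType)
    (mu : {measure set T -> \bar R}) (G : set (set T)) (f : T -> \bar R) :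
  measurable = <<s G >> -> setI_closed G -> mu.-integrable setT f ->
  (\int[mu]_x f x = 0)%E ->
  (forall A, G A -> \int[mu]_(x in A) f x = 0)%E ->
  ae_eq mu setT f (cst 0%E).
Proof.
move=> mG GI fi f0 fG.
pose H := [set A : set T | measurable A /\ (\int[mu]_(x in A) f x = 0)%E].
have mf := measurable_int _ fi.
have HD : dynkin H.
  split; first by split.
  - move=> A [mA A0]; split; first exact: measurableC.
    have := f0; rewrite -(setvU A) integral_setU//; last 3 first.
    + exact: measurableC.
    + by rewrite setvU.
    + by apply/disj_setPS; rewrite setICl.
    by rewrite A0 adde0.
  - move=> F tF HF; have mF i : measurable (F i) by case: (HF i).
    split; first exact: bigcup_measurable.
    rewrite integral_bigcup//; last first.
      by apply: integrableS fi => //; exact: bigcup_measurable.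
    by rewrite eseries0// => i _ _; case: (HF i).
have GH A : measurable A -> H A.
  rewrite mG -setI_closed_g_dynkin_g_sigma_algebra//; apply: smallest_sub => //.
  move=> B GB; split; last exact: fG.
  by rewrite mG; exact: sub_sigma_algebra.
apply: integral_ae_eq => //.
by move=> E _ mE; rewrite (GH _ mE).2 integral0.
Qed.

(** * Measurability and integration for functions of row vectors *)

Section vector_integral.
Variable R : realType.
Local Notation leb d := (lebesgue_Rd R d).
Local Notation T d := (d.-tuple (measurableTypeR R)).

Lemma vecE d (t : T d) i j : vec t i j = tnth t j.
Proof. by rewrite mxE. Qed.

(** Half-open sides make the family stable under intersection and match the intervals that generate
    the Borel sets of the line. *)
Definition box d (a b : 'I_d -> R) : set (T d) :=
  [set t | forall i, a i < tnth t i <= b i].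

Lemma measurable_box d (a b : 'I_d -> R) : measurable (box a b).
Proof.
rewrite (_ : box a b =
    \bigcap_(i in [set: 'I_d]) ((@tnth d _)^~ i @^-1` `]a i, b i])); last first.
  apply/seteqP; split => t /= h i; first by move=> _; rewrite /= in_itv/=.
  by have /= := h i I; rewrite in_itv.
apply: fin_bigcap_measurable; first exact: finite_finset.
move=> i _; rewrite -[X in measurable X]setTI; apply: measurable_tnth => //.
Qed.

Definition boxes d : set (set (T d)) := [set A | exists a b, A = box a b].

Lemma boxesI d : setI_closed (@boxes d).
Proof.
move=> _ _ [a [b ->]] [a' [b' ->]].
exists (fun i => Num.max (a i) (a' i)), (fun i => Num.min (b i) (b' i)).
apply/seteqP; split => t /=.
  by case=> h h' i; rewrite gt_max le_min; move: (h i) (h' i) => /andP[-> ->] /andP[-> ->].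
move=> h; split => i; have := h i; rewrite gt_max le_min.
  by move=> /andP[/andP[-> _] /andP[-> _]].
by move=> /andP[/andP[_ ->] /andP[_ ->]].
Qed.

Lemma measurable_tupleE d : @measurable _ (T d) = <<s @boxes d >>.
Proof.
apply/seteqP; split.
  apply: smallest_sub; first exact: smallest_sigma_algebra.
  rewrite -bigcup_seq; apply: bigcup_sub => i _ _ [B mB <-].
  suff : measurable_fun [set: g_sigma_algebraType (@boxes d)]
    ((fun t => tnth t i) : g_sigma_algebraType (@boxes d) -> measurableTypeR R).
    by move=> /(_ measurableT _ mB).
  apply: (@measurability _ _ _ _ _ _ (@ocitv R)) => //.
  move=> _ [_ [[x y] _ <-] <-].
  (* A condition on one coordinate is a countable union of boxes, the other sides ]-n, n] exhausting
     the line. *)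
  rewrite (_ : _ `&` _ = \bigcup_n box (fun j => if j == i then x else - n%:R)
      (fun j => if j == i then y else n%:R)).
    by apply: bigcup_measurable => n _; apply: sub_sigma_algebra; eexists; eexists.
  apply/seteqP; split => t /=.
    rewrite in_itv/= => -[_ xy].
    have [M tM] : exists M : nat, forall j, `|tnth t j| < M%:R.
      exists (Num.truncn (\sum_(j < d) `|tnth t j|)).+1 => j.
      apply: le_lt_trans (truncnS_gt _).
      by rewrite (bigD1 j)//= lerDl sumr_ge0.
    exists M => // j; case: eqP => [->//|_].
    by have := tM j; rewrite ltr_norml => /andP[-> /ltW].
  move=> [n _ /(_ i)]; by rewrite eqxx => xy; split => //.
apply: smallest_sub; first exact: sigma_algebra_measurable.
by move=> _ [a [b ->]]; exact: measurable_box.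
Qed.

(** The topology comes from the sup norm and the sigma-algebra is the product one. They agree here
    because an open set is a countable union of balls with rational centres and radii 1/(k+1), and
    such balls are products of intervals. *)
Lemma measurable_vec_open d (U : set 'rV[R]_d) : open U -> measurable (@vec R d @^-1` U).
Proof.
move=> oU.
pose qv (q : 'rV[rat]_d) : 'rV[R]_d := map_mx ratr q.
pose F (p : ('rV[rat]_d * nat)%type) : set (T d) :=
  if `[< ball (qv p.1) (p.2.+1%:R^-1) `<=` U >]
  then @vec R d @^-1` ball (qv p.1) (p.2.+1%:R^-1) else set0.
rewrite (_ : _ @^-1` _ = \bigcup_p F p).
  apply: countable_bigcupT_measurable; first exact: countableP.
  move=> [q k]; rewrite /F; case: ifP => // _.
  rewrite (_ : _ @^-1` _ = \bigcap_(i in [set: 'I_d]) ((@tnth d _)^~ i @^-1`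
     ball (qv q ord0 i) (k.+1%:R^-1))); last first.
    apply/seteqP; split => t /=.
      by move=> [_ h] i _; have := h ord0 i; rewrite vecE.
    move=> h; split; first by rewrite invr_gt0 ltr0n.
    by move=> i j; rewrite ord1 vecE; exact: h.
  apply: fin_bigcap_measurable; first exact: finite_finset.
  move=> i _; rewrite -[X in measurable X]setTI; apply: measurable_tnth => //.
  by rewrite ball_itv; exact: measurable_itv.
apply/seteqP; split => t /=; last first.
  by move=> [p _]; rewrite /F; case: ifPn => // /asboolP h; exact: h.
move=> Ut; have /nbhs_ballP[e /= e0 eU] := open_nbhs_nbhs (conj oU Ut).
(* Half of e, since both t and the points of the ball lie within 1/(k+1) of its rational centre. *)
have [k kE] : exists k : nat, k.+1%:R^-1 < e / 2.
  exists (Num.truncn (e / 2)^-1); rewrite invf_plt ?posrE ?divr_gt0 ?ltr0n//.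
  exact: truncnS_gt.
have k0 : 0 < k.+1%:R^-1 :> R by rewrite invr_gt0 ltr0n.
have /choice[q qE] : forall i, exists q, `|ratr q - tnth t i| < k.+1%:R^-1.
  move=> i; have : tnth t i - k.+1%:R^-1 < tnth t i + k.+1%:R^-1.
    by rewrite ltrD2l gtrN.
  move=> /rat_in_itvoo[q]; rewrite in_itv/= => /andP[q1 q2].
  by exists q; rewrite ltr_distl q1 q2.
exists (\row_i q i, k) => //; rewrite /F/= ifT.
  by split=> // i j; rewrite ord1 vecE !mxE; exact: qE.
apply/asboolP => y [_ yq]; apply: eU; split => // i j.
have := yq i j; rewrite ord1 !mxE => yq'.
rewrite /ball/= in yq' *.
have := qE j; rewrite distrC => qE'.
rewrite -(subrK (ratr (q j)) (tnth t j)) -addrA.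
apply: le_lt_trans (ler_normD _ _) _.
by rewrite (splitr e) ltrD// ?(lt_trans _ kE)//.
Qed.

Lemma measurable_vec_closed d (K : set 'rV[R]_d) : closed K ->
  measurable (@vec R d @^-1` K).
Proof.
move=> cK; rewrite -(setCK K) preimage_setC; apply: measurableC.
exact: (measurable_vec_open (closed_openC cK)).
Qed.

Lemma measurable_vec_compact d (K : set 'rV[R]_d) : compact K ->
  measurable (@vec R d @^-1` K).
Proof.
move=> cK; apply: measurable_vec_closed; apply: compact_closed => //.
Qed.

Lemma continuous_measurable_vec d (f : 'rV[R]_d -> R) : continuous f ->
  measurable_fun setT (f \o @vec R d).
Proof.
move=> /continuousP cf; apply: (measurability _ (RGenOpens.measurableE R)).
move=> _ [_ [a [b ->] <-]]; rewrite setTI comp_preimage.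
have o : open (`]a, b[%classic : set R) by exact: interval_open.
exact: (measurable_vec_open (cf _ o)).
Qed.

Definition mvec d (f : 'rV[R]_d -> R) := measurable_fun setT (f \o @vec R d).
Definition ivec d (f : 'rV[R]_d -> R) :=
  (leb d).-integrable setT (EFin \o (f \o @vec R d)).
Definition Ivec d (f : 'rV[R]_d -> R) : R := \int[leb d]_t f (vec t).

Lemma ivec_mvec d (f : 'rV[R]_d -> R) : ivec f -> mvec f.
Proof. by move=> /measurable_int/measurable_EFinP. Qed.

Lemma ivec_le d (f g : 'rV[R]_d -> R) : mvec f -> ivec g ->
  (forall x, `|f x| <= `|g x|) -> ivec f.
Proof.
move=> mf ig fg; apply: le_integrable ig => //; first exact/measurable_EFinP.
by move=> t _; rewrite lee_fin; exact: fg.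
Qed.

Lemma ivecD d (f g : 'rV[R]_d -> R) : ivec f -> ivec g -> ivec (fun x => f x + g x).
Proof. by move=> hf hg; exact: (integrableD _ hf hg). Qed.

Lemma ivecZ d (a : R) (f : 'rV[R]_d -> R) : ivec f -> ivec (fun x => a * f x).
Proof. by move=> hf; apply: (integrableZl _ a hf). Qed.

Lemma ivecB d (f g : 'rV[R]_d -> R) : ivec f -> ivec g -> ivec (fun x => f x - g x).
Proof. by move=> hf hg; exact: (integrableB _ hf hg). Qed.

Lemma ivec_norm d (f : 'rV[R]_d -> R) : ivec f -> ivec (fun x => `|f x|).
Proof. by move=> hf; exact: (integrable_norm hf). Qed.

Lemma IvecD d (f g : 'rV[R]_d -> R) : ivec f -> ivec g ->
  Ivec (fun x => f x + g x) = Ivec f + Ivec g.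
Proof. by move=> hf hg; rewrite /Ivec RintegralD. Qed.

Lemma IvecB d (f g : 'rV[R]_d -> R) : ivec f -> ivec g ->
  Ivec (fun x => f x - g x) = Ivec f - Ivec g.
Proof. by move=> hf hg; rewrite /Ivec RintegralB. Qed.

Lemma IvecZ d (a : R) (f : 'rV[R]_d -> R) : ivec f ->
  Ivec (fun x => a * f x) = a * Ivec f.
Proof. by move=> hf; rewrite /Ivec RintegralZl. Qed.

Lemma IvecN d (f : 'rV[R]_d -> R) : ivec f -> Ivec (fun x => - f x) = - Ivec f.
Proof.
move=> hf; rewrite -mulN1r -IvecZ//; congr Ivec; apply/funext => x.
by rewrite mulN1r.
Qed.

Lemma le_Ivec d (f g : 'rV[R]_d -> R) : ivec f -> ivec g ->
  (forall x, f x <= g x) -> Ivec f <= Ivec g.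
Proof. by move=> hf hg fg; apply: le_Rintegral => // t _; exact: fg. Qed.

Lemma Ivec_ge0 d (f : 'rV[R]_d -> R) : (forall x, 0 <= f x) -> 0 <= Ivec f.
Proof. by move=> f0; apply: Rintegral_ge0 => t _; exact: f0. Qed.

Lemma norm_Ivec_le d (f g : 'rV[R]_d -> R) : ivec f -> ivec g ->
  (forall x, `|f x| <= g x) -> `|Ivec f| <= Ivec g.
Proof.
move=> hf hg fg; apply: (le_trans (le_normr_Rintegral _ hf)) => //.
exact: (le_Ivec (ivec_norm hf)).
Qed.

Lemma IvecE d (f : 'rV[R]_d -> R) : ivec f ->
  ((Ivec f)%:E = \int[leb d]_t (f (vec t))%:E)%E.
Proof. by move=> hf; rewrite /Ivec /Rintegral fineK//; exact: integrable_fin_num. Qed.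

Lemma ivec_ge0P d (f : 'rV[R]_d -> R) : mvec f -> (forall x, 0 <= f x) ->
  (\int[leb d]_t (f (vec t))%:E < +oo)%E -> ivec f.
Proof.
move=> mf f0 h; apply/integrableP; split; first exact/measurable_EFinP.
under eq_integral do rewrite /= ger0_norm//.
exact: h.
Qed.

Lemma mvecM d (f g : 'rV[R]_d -> R) : mvec f -> mvec g -> mvec (fun x => f x * g x).
Proof. by move=> hf hg; exact: measurable_funM. Qed.

Lemma mvec_cont d (f : 'rV[R]_d -> R) : continuous f -> mvec f.
Proof. exact: continuous_measurable_vec. Qed.

Lemma ivecMb d (f g : 'rV[R]_d -> R) (M : R) : ivec f -> mvec g ->
  (forall x, `|g x| <= M) -> ivec (fun x => f x * g x).
Proof.
move=> hf mg gM; apply: (@ivec_le _ _ (fun x => M * `|f x|)).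
- exact: mvecM (ivec_mvec hf) mg.
- exact: ivecZ (ivec_norm hf).
- move=> x; rewrite normrM mulrC [leRHS]ger0_norm ?ler_wpM2r//.
  by rewrite mulr_ge0// (le_trans _ (gM x)).
Qed.

(** The majorant F(x) G(y) bounds the iterated integral of the absolute value by the product of the
    integrals of |F| and |G|, which gives integrability on the product space. *)
Lemma Ivec_Fubini d (H : 'rV[R]_d -> 'rV[R]_d -> R) (F G : 'rV[R]_d -> R) :
  measurable_fun setT (fun z : T d * T d => H (vec z.1) (vec z.2)) ->
  ivec F -> ivec G -> (forall x y, `|H x y| <= F x * G y) ->
  Ivec (fun x => Ivec (fun y => H x y)) = Ivec (fun y => Ivec (fun x => H x y)).
Proof.
move=> mH iF iG HFG.
have mHx x : mvec (H (vec x)).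
  exact: (measurableT_comp mH (@pair1_measurable _ _ (T d) (T d) x)).
have mHy y : mvec (fun x => H x (vec y)).
  exact: (measurableT_comp mH (@pair2_measurable _ _ (T d) (T d) y)).
have iHx x : ivec (H (vec x)).
  apply: (ivec_le (mHx x) (ivecZ (F (vec x)) iG)) => y.
  by rewrite (le_trans (HFG _ _))// ler_norm.
have iHy y : ivec (fun x => H x (vec y)).
  apply: (ivec_le (mHy y) (ivecZ (G (vec y)) iF)) => x.
  by rewrite (le_trans (HFG _ _))// mulrC ler_norm.
rewrite /Ivec; congr fine.
transitivity (\int[leb d]_x \int[leb d]_y (H (vec x) (vec y))%:E)%E.
  by apply: eq_integral => x _; rewrite (IvecE (iHx x)).
transitivity (\int[leb d]_y \int[leb d]_x (H (vec x) (vec y))%:E)%E; last first.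
  by apply: eq_integral => x _; rewrite (IvecE (iHy x)).
apply: (@Fubini _ _ _ _ R (sleb (d := d)) (sleb (d := d))
  (fun z => (H (vec z.1) (vec z.2))%:E)).
apply/integrable12ltyP; first exact/measurable_EFinP.
have iF' := ivec_norm iF; have iG' := ivec_norm iG.
apply: (@le_lt_trans _ _
  (\int[leb d]_x ((Ivec (fun y => `|G y|))%:E * (`|F (vec x)|)%:E)%E)%E).
  apply: ge0_le_integral => //.
  - by move=> x _; exact: integral_ge0.
  - apply: (@measurable_fun_fubini_tonelli_F _ _ _ _ R (sleb (d := d))
      (fun z => `|(H (vec z.1) (vec z.2))%:E|)%E) => //.
    exact/measurableT_comp/measurable_EFinP.
  - exact: measurable_funeM (measurable_int _ iF').
  - move=> x _; rewrite muleC IvecE// -ge0_integralZl//; last first.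
      exact: (measurable_int _ iG').
    apply: ge0_le_integral => //.
    + by apply: measurableT_comp => //; apply/measurable_EFinP; exact: mHx.
    + exact: measurable_funeM (measurable_int _ iG').
    + move=> y _; rewrite -EFinM lee_fin -normrM.
      by rewrite (le_trans (HFG _ _))// ler_norm.
exact: (integrable_lty measurableT (ivecZ (Ivec (fun y => `|G y|)) iF')).
Qed.

End vector_integral.

(** * Smooth functions *)

Section directional_calculus.
Variable R : realType.

Lemma is_derive_continuous (g dg : R -> R) :
  (forall x : R, is_derive x 1 g (dg x)) -> continuous g.
Proof.
move=> h x; apply: differentiable_continuous; apply/derivable1_diffP.
exact: (@ex_derive _ _ _ _ _ _ _ (h x)).
Qed.

Lemma norm_increment_le (g dg : R -> R) (M h : R) :
  (forall x : R, is_derive x 1 g (dg x)) ->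
  (forall t, `|t| <= `|h| -> `|dg t| <= M) -> `|g h - g 0| <= M * `|h|.
Proof.
move=> gd gM; have cg := is_derive_continuous gd.
have wc a b : {within `[a, b], continuous g} by exact: continuous_subspaceT.
have [h0|h0] := leP 0 h.
  have [c /[!in_itv]/= /andP[c0 ch] ->] :=
    MVT_segment h0 (fun x _ => gd x) (wc _ _).
  by rewrite subr0 normrM ler_wpM2r// gM// !ger0_norm.
have [c /[!in_itv]/= /andP[c0 ch] E] :=
  MVT_segment (ltW h0) (fun x _ => gd x) (wc _ _).
rewrite distrC E sub0r normrM normrN ler_wpM2r// gM//.
by rewrite !ler0_norm ?lerN2// ltW.
Qed.

(** The mean value inequality is applied to [dg] and then to g minus its linear part. This yields M
    in place of M / 2; only the order h^2 of the remainder matters below. *)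
Lemma taylor2_le (g dg d2g : R -> R) (M h : R) :
  (forall x : R, is_derive x 1 g (dg x)) -> (forall x : R, is_derive x 1 dg (d2g x)) ->
  (forall t, `|t| <= `|h| -> `|d2g t| <= M) ->
  `|g h - g 0 - h * dg 0| <= M * h ^+ 2.
Proof.
move=> gd dgd gM.
pose k t := g t - t * dg 0.
have kd (x : R) : is_derive x 1 k (dg x - dg 0).
  have := gd x => ?; apply: is_derive_eq.
  by rewrite scaler0 add0r /GRing.scale/= mulr1.
have M0 : 0 <= M by rewrite (le_trans _ (gM 0 _))// normr0.
have := @norm_increment_le k (fun x => dg x - dg 0) (M * `|h|) h kd.
rewrite /k mul0r subr0 -mulrA -normrM -expr2 ger0_norm ?sqr_ge0//.
rewrite (_ : g h - h * dg 0 - g 0 = g h - g 0 - h * dg 0); last by ring.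
apply=> t th; apply: (@le_trans _ _ (M * `|t|)); last by rewrite ler_wpM2l.
apply: norm_increment_le dgd _ => u ut; apply: gM; exact: le_trans th.
Qed.

(** A quadratic remainder with a fixed constant survives integration and summation. Differentiation
    under the integral and term by term both go through this criterion. *)
Lemma is_derive_quadratic (V : normedModType R) (f : V -> R) (x v : V) (L C : R) :
  (forall h : R, `|h| <= 1 -> `|f (h *: v + x) - f x - h * L| <= C * h ^+ 2) ->
  is_derive x v f L.
Proof.
move=> H.
have cv : h^-1 *: ((f \o shift x) (h *: v) - f x) @[h --> (0 : R)^'] --> L.
  apply/cvgrPdist_le => e e0.
  have C1 : 0 < `|C| + 1 by rewrite ltr_wpDl.
  near=> h.
  have hn0 : h != 0 by near: h; exact: nbhs_dnbhs_neq.
  have h1 : `|h| <= 1.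
    near: h; apply: dnbhs0_le => //.
  have h2 : `|h| <= e / (`|C| + 1).
    near: h; apply: dnbhs0_le; exact: divr_gt0.
  rewrite /= /GRing.scale/= distrC.
  have -> : h^-1 * (f (h *: v + x) - f x) - L =
      h^-1 * (f (h *: v + x) - f x - h * L) by field.
  rewrite normrM normfV ler_pdivrMl ?normr_gt0//.
  apply: (le_trans (H h h1)).
  rewrite -(ger0_norm (sqr_ge0 h)) normrX expr2 mulrA mulrC ler_wpM2l//.
  apply: (@le_trans _ _ ((`|C| + 1) * `|h|)).
    by rewrite ler_wpM2r// (le_trans (ler_norm C))// lerDl.
  by rewrite mulrC -ler_pdivlMr.
apply: DeriveDef; last exact/cvg_lim.
by apply/cvg_ex; exists L.
Unshelve. all: by end_near. Qed.

Lemma is_derive_line (V : normedModType R) (f : V -> R) (x v : V) (t L : R) :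
  is_derive (t *: v + x) v f L -> is_derive t 1 (fun s => f (s *: v + x)) L.
Proof.
have E : (fun h : R => h^-1 *: (((fun s => f (s *: v + x)) \o shift t)
    (h *: (1 : R)) - f (t *: v + x)))
  = (fun h => h^-1 *: ((f \o shift (t *: v + x)) (h *: v) - f (t *: v + x))).
  by apply/funext => h /=; rewrite [h%:A]mulr1 scalerDl addrA.
case=> df Lf; apply: DeriveDef.
  by rewrite /derivable E.
by rewrite -Lf /derive E.
Qed.

Section coordinates.
Variable d : nat.
Local Notation e_ := (@basis_vec R d).
Implicit Types (f g : 'rV[R]_d -> R) (x : 'rV[R]_d).

Lemma basis_vecE i j : e_ i ord0 j = (i == j)%:R.
Proof. by rewrite mxE eqxx /= eq_sym. Qed.

Lemma is_derive_coord (h dh : R -> R) (i j : 'I_d) x :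
  is_derive (x ord0 i) 1 h (dh (x ord0 i)) ->
  is_derive x (e_ j) (fun y => h (y ord0 i)) (if j == i then dh (x ord0 i) else 0).
Proof.
case=> hd hL.
have E : (fun k : R => k^-1 *: (((fun y : 'rV[R]_d => h (y ord0 i)) \o shift x)
    (k *: e_ j) - h (x ord0 i)))
  = if j == i then
     (fun k => k^-1 *: ((h \o shift (x ord0 i)) (k *: (1 : R)) - h (x ord0 i)))
    else cst 0.
  apply/funext => k /=; rewrite !mxE /=; case: eqP => [->|/eqP ji].
    by rewrite eqxx.
  by rewrite eq_sym (negbTE ji) mulr0 add0r subrr scaler0.
case: eqP E => [->|ji] E; apply: DeriveDef; rewrite ?/derivable ?/derive E//.
- exact: is_cvg_cst.
- exact: lim_cst.
Qed.

(** A coinduction principle: since [smooth] speaks of all words of derivatives, it is enough to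
    place f in a class of continuous functions closed under partial derivatives. The smoothness and
    decay proofs below consist in finding that class. *)
Lemma smooth_coind (P : ('rV[R]_d -> R) -> Prop) :
  (forall f, P f -> continuous f /\ forall i,
     (forall x, derivable f x (e_ i)) /\ P ('D_(e_ i) f)) ->
  forall f, P f -> smooth f.
Proof.
move=> HP f Pf w; have Pw : P (partials w f).
  by elim: w => //= i w IH; exact: ((HP _ IH).2 i).2.
by have [cf df] := HP _ Pw; split=> // x i; exact: (df i).1.
Qed.

Lemma partials_rcons w i f : partials (rcons w i) f = partials w ('D_(e_ i) f).
Proof. by rewrite /partials foldr_rcons. Qed.

Lemma smooth_derive i f : smooth f -> smooth ('D_(e_ i) f).
Proof. by move=> sf w; rewrite -partials_rcons; exact: sf. Qed.

Lemma smooth_continuous f : smooth f -> continuous f.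
Proof. by move=> /(_ [::])[]. Qed.

Lemma smooth_derivable f x i : smooth f -> derivable f x (e_ i).
Proof. by move=> /(_ [::])[_]; exact. Qed.

Lemma smooth_is_derive f x i : smooth f -> is_derive x (e_ i) f ('D_(e_ i) f x).
Proof. by move=> sf; apply: DeriveDef => //; exact: smooth_derivable. Qed.

Lemma eq_derive_fun i f g : (forall x, is_derive x (e_ i) f (g x)) -> 'D_(e_ i) f = g.
Proof. by move=> h; apply/funext => x; exact: (@derive_val _ _ _ _ _ _ _ (h x)). Qed.

(** Products alone are not closed under derivation; by the Leibniz rule, sums of products are. *)
Inductive algebraic_combination : ('rV[R]_d -> R) -> Prop :=
| algebraic_mul f g : smooth f -> smooth g ->
    algebraic_combination (fun x => f x * g x)
| algebraic_add f g : algebraic_combination f -> algebraic_combination g ->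
    algebraic_combination (fun x => f x + g x).

Lemma smooth_algebraic f : algebraic_combination f -> smooth f.
Proof.
apply: smooth_coind => {}f; elim => {f} [f g sf sg|f g _ [cf IHf] _ [cg IHg]].
  split=> [x|i]; first by apply: continuousM; apply: smooth_continuous.
  have h x : is_derive x (e_ i) (fun x => f x * g x)
      (f x * 'D_(e_ i) g x + 'D_(e_ i) f x * g x).
    have := smooth_is_derive x i sf => ?; have := smooth_is_derive x i sg => ?.
    by apply: is_derive_eq; rewrite /GRing.scale/= [g x * _]mulrC.
  split=> [x|]; first exact: (@ex_derive _ _ _ _ _ _ _ (h x)).
  rewrite (eq_derive_fun h); apply: algebraic_add; apply: algebraic_mul => //;
    exact: smooth_derive.
split=> [x|i]; first by apply: continuousD; [exact: cf|exact: cg].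
have [df af] := IHf i; have [dg ag] := IHg i.
have h x : is_derive x (e_ i) (fun x => f x + g x) ('D_(e_ i) f x + 'D_(e_ i) g x).
  have := derivableP (df x) => ?; have := derivableP (dg x) => ?.
  exact: is_deriveD.
split=> [x|]; first exact: (@ex_derive _ _ _ _ _ _ _ (h x)).
by rewrite (eq_derive_fun h); exact: algebraic_add.
Qed.

Lemma smooth_cst (c : R) : smooth (fun _ : 'rV[R]_d => c).
Proof.
apply: (@smooth_coind (fun f => exists c, f = fun=> c)); last by exists c.
move=> _ [a ->]; split=> [x|i]; first exact: cst_continuous.
split=> [x|]; first exact: (@derivable_cst _ _ _ _ x).
by exists 0; apply/funext => x; rewrite derive_cst.
Qed.

Lemma smoothM f g : smooth f -> smooth g -> smooth (fun x => f x * g x).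
Proof. by move=> sf sg; exact/smooth_algebraic/algebraic_mul. Qed.

(** The whole sequence of derivatives is the witness, so that it can be handed over explicitly, for
    instance after an affine change of variable. *)
Definition smooth1 (h : R -> R) := exists H : nat -> R -> R,
  H 0%N = h /\ forall k (x : R), is_derive x 1 (H k) (H k.+1 x).

Lemma smooth_coord (h : R -> R) (i : 'I_d) : smooth1 h ->
  smooth (fun x : 'rV[R]_d => h (x ord0 i)).
Proof.
move=> [H [<- dH]].
(* The zero function belongs to the class because the derivatives in the other directions vanish. *)
apply: (@smooth_coind (fun f => (exists k, f = fun x => H k (x ord0 i)) \/
   f = fun=> 0)); last by left; exists 0%N.
move=> _ [[k ->]|->]; last first.
  split=> [x|j]; first exact: cst_continuous.
  split=> [x|]; first exact: (@derivable_cst _ _ _ _ x).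
  by right; apply/funext => x; rewrite derive_cst.
split=> [x|j].
  apply: (@continuous_comp _ _ _ (fun y : 'rV[R]_d => y ord0 i) (H k)).
    exact: coord_continuous.
  exact: is_derive_continuous (dH k) _.
have h' x : is_derive x (e_ j) (fun y : 'rV[R]_d => H k (y ord0 i))
    (if j == i then H k.+1 (x ord0 i) else 0).
  exact: is_derive_coord.
split=> [x|]; first exact: (@ex_derive _ _ _ _ _ _ _ (h' x)).
rewrite (eq_derive_fun h'); case: eqP => _; last by right.
by left; exists k.+1.
Qed.

Lemma smooth_prod (I : Type) (s : seq I) (F : I -> 'rV[R]_d -> R) :
  (forall i, smooth (F i)) -> smooth (fun x => \prod_(i <- s) F i x).
Proof.
move=> sF; elim: s => [|i s IH].
  by under eq_fun do rewrite big_nil; exact: smooth_cst.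
by under eq_fun do rewrite big_cons; exact: smoothM.
Qed.

End coordinates.
End directional_calculus.

(** * Rapidly decreasing functions *)

Section rapid_decay.
Variables (R : realType) (d : nat).
Local Notation V := 'rV[R]_d.
Local Notation e_ := (@basis_vec R d).
Implicit Types (f g p q : V -> R) (x y v : V).

Lemma contD f g : continuous f -> continuous g -> continuous (fun x => f x + g x).
Proof. by move=> cf cg x; apply: continuousD; [exact: cf|exact: cg]. Qed.

Lemma contM f g : continuous f -> continuous g -> continuous (fun x => f x * g x).
Proof. by move=> cf cg x; apply: continuousM; [exact: cf|exact: cg]. Qed.

Lemma dotvC x y : dotv x y = dotv y x.
Proof. by apply: eq_bigr => i _; rewrite mulrC. Qed.

Lemma dotvDl x y v : dotv (x + y) v = dotv x v + dotv y v.
Proof. by rewrite -big_split; apply: eq_bigr => i _; rewrite mxE mulrDl. Qed.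

Lemma dotvZl (a : R) x v : dotv (a *: x) v = a * dotv x v.
Proof. by rewrite mulr_sumr; apply: eq_bigr => i _; rewrite mxE mulrA. Qed.

Lemma dotvDr x y v : dotv v (x + y) = dotv v x + dotv v y.
Proof. by rewrite dotvC dotvDl !(dotvC v). Qed.

Lemma dotvZr (a : R) x v : dotv v (a *: x) = a * dotv v x.
Proof. by rewrite dotvC dotvZl (dotvC v). Qed.

Lemma dotv0l v : dotv (0 : V) v = 0.
Proof. by rewrite -(scale0r (0 : V)) dotvZl mul0r. Qed.

Lemma dotv_basis x i : dotv x (e_ i) = x ord0 i.
Proof.
rewrite /dotv (bigD1 i)//= basis_vecE eqxx mulr1 big1 ?addr0// => j ji.
by rewrite basis_vecE eq_sym (negbTE ji) mulr0.
Qed.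

Lemma dotvv_ge0 x : 0 <= dotv x x.
Proof. by apply: sumr_ge0 => i _; rewrite -expr2 sqr_ge0. Qed.

Lemma sqr_coord_le x i : x ord0 i ^+ 2 <= dotv x x.
Proof.
rewrite /dotv (bigD1 i)//= expr2 lerDl; apply: sumr_ge0 => j _.
by rewrite -expr2 sqr_ge0.
Qed.

(** Decay is measured in this norm because its estimates are made coordinate by coordinate, and
    because multiplication by it is a sum of multiplications by the |x_i|. It is compared with the
    Euclidean norm only where the Schwartz seminorms enter. *)
Definition l1norm x : R := \sum_(i < d) `|x ord0 i|.

Lemma l1norm_ge0 x : 0 <= l1norm x. Proof. exact: sumr_ge0. Qed.

Lemma coord_le_l1norm x i : `|x ord0 i| <= l1norm x.
Proof. by rewrite /l1norm (bigD1 i)//= lerDl sumr_ge0. Qed.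

Lemma l1normD x y : l1norm (x + y) <= l1norm x + l1norm y.
Proof. by rewrite -big_split; apply: ler_sum => i _; rewrite mxE ler_normD. Qed.

Lemma l1normZ (a : R) x : l1norm (a *: x) = `|a| * l1norm x.
Proof. by rewrite mulr_sumr; apply: eq_bigr => i _; rewrite mxE normrM. Qed.

Lemma l1norm_basis i : l1norm (e_ i) = 1.
Proof.
rewrite /l1norm (bigD1 i)//= basis_vecE eqxx normr1 big1 ?addr0// => j ji.
by rewrite basis_vecE eq_sym (negbTE ji) normr0.
Qed.

Lemma enorm_le_l1norm x : enorm x <= l1norm x.
Proof.
rewrite -[leRHS]ger0_norm ?l1norm_ge0// -sqrtr_sqr ler_wsqrtr//.
rewrite expr2 {1}/l1norm mulr_suml; apply: ler_sum => i _.
apply: le_trans (ler_norm _) _; rewrite normrM ler_wpM2l//.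
exact: coord_le_l1norm.
Qed.

Lemma sqr_enorm x : enorm x ^+ 2 = dotv x x.
Proof. by rewrite sqr_sqrtr// dotvv_ge0. Qed.

Lemma coord_le_enorm x i : `|x ord0 i| <= enorm x.
Proof. by rewrite -sqrtr_sqr ler_wsqrtr// sqr_coord_le. Qed.

Lemma dotv_le_l1norm x y : `|dotv x y| <= l1norm x * l1norm y.
Proof.
apply: (le_trans (ler_norm_sum _ _ _)); rewrite mulr_suml.
apply: ler_sum => i _; rewrite normrM ler_wpM2l//; exact: coord_le_l1norm.
Qed.

Lemma l1norm_le_norm v : l1norm v <= d%:R * `|v|.
Proof.
rewrite -[d in d%:R]card_ord mulr_natl -sumr_const; apply: ler_sum => i _.
rewrite [leRHS]/Num.Def.normr /= mx_normrE; apply/bigmax_geP; right.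
by exists (ord0, i).
Qed.

Lemma l1_weight_ge1 x : 1 <= 1 + l1norm x.
Proof. by rewrite lerDl l1norm_ge0. Qed.

Lemma integral_oneDsqrV :
  (\int[@lebesgue_measure R]_t ((1 + t ^+ 2)^-1)%:E = pi%:E)%E.
Proof.
rewrite (@ge0_symfun_integralT _ (fun t : R => (1 + t ^+ 2)^-1))//=.
- rewrite (_ : [set x | _] = `[0, +oo[%classic); last first.
    by apply/seteqP; split => x/=; rewrite in_itv/= andbT.
  by rewrite integral0y_oneDsqr -EFinM mulrCA divff// mulr1.
- by move=> x; rewrite invr_ge0 addr_ge0// sqr_ge0.
- exact: continuous_oneDsqrV.
- by move=> x/=; rewrite sqrrN.
Qed.

(** A universal integrable majorant: it factors over the coordinates, so its integral reduces to the
    one-dimensional integral of 1 / (1 + t^2). *)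
Definition cauchy_weight x : R := \prod_(i < d) (1 + x ord0 i ^+ 2)^-1.

Lemma cauchy_weight_gt0 x : 0 < cauchy_weight x.
Proof.
by apply: prodr_gt0 => i _; rewrite invr_gt0 ltr_pwDl// sqr_ge0.
Qed.

Lemma ivec_cauchy_weight : ivec cauchy_weight.
Proof.
have E t : cauchy_weight (vec t) = \prod_(i < d) (1 + tnth t i ^+ 2)^-1.
  by apply: eq_bigr => i _; rewrite vecE.
have mh : measurable_fun setT (fun t : R => (1 + t ^+ 2)^-1).
  exact: continuous_measurable_fun (@continuous_oneDsqrV R).
apply: ivec_ge0P.
- rewrite /mvec (_ : _ \o _ = fun t => \prod_(i < d) (1 + tnth t i ^+ 2)^-1).
    by apply: measurable_prod => i _; exact: (measurable_coord i mh).
  by apply/funext => t; rewrite /= E.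
- by move=> x; rewrite ltW// cauchy_weight_gt0.
under eq_integral do rewrite E.
rewrite (@ge0_integral_prod R d (fun=> fun t => (1 + t ^+ 2)^-1))//; last first.
  by move=> i x; rewrite invr_ge0 addr_ge0// sqr_ge0.
under eq_bigr do rewrite integral_oneDsqrV.
by rewrite prodEFin ltry.
Qed.

(** Each of the d factors satisfies 1 + x_i^2 <= (1 + w)^2. The bound w is left free so as to serve
    for both the l1 norm and the Euclidean one. *)
Lemma cauchy_weight_ge (w : R) x : (forall i, `|x ord0 i| <= w) ->
  1 <= (1 + w) ^+ (2 * d) * cauchy_weight x.
Proof.
move=> xw; rewrite exprM.
rewrite -[X in (_ ^+ 2) ^+ X]card_ord -prodr_const -big_split/=.
elim/big_ind : _ => // [a b|i _]; first exact: mulr_ege1.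
rewrite ler_pdivlMr ?ltr_pwDl ?sqr_ge0// mul1r -[x ord0 i ^+ 2]real_normK ?num_real//.
have := xw i; have := normr_ge0 (x ord0 i); set a := `|_|.
by move=> a0 aw; nra.
Qed.

Lemma bounded_ivec f (C : R) : mvec f ->
  (forall x, (1 + l1norm x) ^+ (2 * d) * `|f x| <= C) ->
  ivec f /\ forall x, `|f x| <= C * cauchy_weight x.
Proof.
move=> mf fC.
have h x : `|f x| <= C * cauchy_weight x.
  have w1 := cauchy_weight_ge (coord_le_l1norm x).
  apply: (@le_trans _ _ (((1 + l1norm x) ^+ (2 * d) * cauchy_weight x) * `|f x|)).
    by rewrite ler_peMl.
  by rewrite mulrAC ler_wpM2r// ltW// cauchy_weight_gt0.
split=> //; apply: (ivec_le mf (ivecZ C ivec_cauchy_weight)) => x.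
exact: le_trans (h x) (ler_norm _).
Qed.

(** The real Schwartz space. A complex Schwartz function is a pair of such functions, by
    [schwartz_rapid] and [rapid_schwartz]. *)
Definition rapid f := smooth f /\
  forall w N, exists C, forall x, (1 + l1norm x) ^+ N * `|partials w f x| <= C.

Lemma rapid_coind (P : (V -> R) -> Prop) :
  (forall f, P f -> [/\ continuous f,
     (forall i x, derivable f x (e_ i)), (forall i, P ('D_(e_ i) f)) &
     forall N, exists C, forall x, (1 + l1norm x) ^+ N * `|f x| <= C]) ->
  forall f, P f -> rapid f.
Proof.
move=> HP f Pf; have Pw w : P (partials w f).
  by elim: w => //= i w IH; have [_ _ h _] := HP _ IH; exact: h.
split; last by move=> w; have [_ _ _] := HP _ (Pw w).
apply: (@smooth_coind _ _ P) => // g Pg; have [cg dg Dg _] := HP _ Pg.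
by split=> // i; split=> // x; exact: dg.
Qed.

Lemma rapid_derive i f : rapid f -> rapid ('D_(e_ i) f).
Proof.
move=> [sf bf]; split; first exact: smooth_derive.
by move=> w N; rewrite -partials_rcons; exact: bf.
Qed.

Lemma rapid_bound f N : rapid f ->
  exists C, forall x, (1 + l1norm x) ^+ N * `|f x| <= C.
Proof. by move=> [_ /(_ [::] N)]. Qed.

Lemma rapid_cont f : rapid f -> continuous f.
Proof. by move=> [/smooth_continuous]. Qed.

Lemma rapid_ivec f : rapid f -> ivec f.
Proof.
move=> rf; have [C fC] := rapid_bound (2 * d) rf.
by have [] := bounded_ivec (mvec_cont (rapid_cont rf)) fC.
Qed.

Lemma rapid_is_derive f i x : rapid f -> is_derive x (e_ i) f ('D_(e_ i) f x).
Proof. by move=> [sf _]; exact: smooth_is_derive. Qed.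

Lemma rapid_lin (a b : R) f g : rapid f -> rapid g ->
  rapid (fun x => a * f x + b * g x).
Proof.
move=> rf rg; apply: (@rapid_coind (fun h => exists f g, [/\ rapid f, rapid g &
   h = fun x => a * f x + b * g x])); last by exists f, g.
move=> _ [{rf}f [{rg}g [rf rg ->]]].
have h i x : is_derive x (e_ i) (fun x => a * f x + b * g x)
    (a * 'D_(e_ i) f x + b * 'D_(e_ i) g x).
  have := rapid_is_derive i x rf => ?; have := rapid_is_derive i x rg => ?.
  exact: is_deriveD (is_deriveZ _ _) (is_deriveZ _ _).
split.
- apply: (contD (f := fun x => a * f x) (g := fun x => b * g x)).
    by apply: contM; [exact: cst_continuous|exact: rapid_cont].
  by apply: contM; [exact: cst_continuous|exact: rapid_cont].
- by move=> i x; exact: (@ex_derive _ _ _ _ _ _ _ (h i x)).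
- move=> i; rewrite (eq_derive_fun (h i)); exists ('D_(e_ i) f), ('D_(e_ i) g).
  by split=> //; exact: rapid_derive.
- move=> N; have [C fC] := rapid_bound N rf; have [C' gC] := rapid_bound N rg.
  exists (`|a| * C + `|b| * C') => x.
  have w0 : 0 <= (1 + l1norm x) ^+ N.
    by rewrite exprn_ge0// (le_trans ler01)// l1_weight_ge1.
  apply: (@le_trans _ _ (`|a| * ((1 + l1norm x) ^+ N * `|f x|)
    + `|b| * ((1 + l1norm x) ^+ N * `|g x|))).
    rewrite (mulrCA `|a|) (mulrCA `|b|) -mulrDr ler_wpM2l//.
    by rewrite -!normrM ler_normD.
  by rewrite lerD// ler_wpM2l.
Qed.

Lemma rapidZ (a : R) f : rapid f -> rapid (fun x => a * f x).
Proof.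
move=> rf; have := rapid_lin a 0 rf rf.
by congr rapid; apply/funext => x; rewrite mul0r addr0.
Qed.

Lemma rapidN f : rapid f -> rapid (fun x => - f x).
Proof.
move=> rf; have := rapidZ (-1) rf.
by congr rapid; apply/funext => x; rewrite mulN1r.
Qed.

Lemma rapidD f g : rapid f -> rapid g -> rapid (fun x => f x + g x).
Proof.
move=> rf rg; have := rapid_lin 1 1 rf rg.
by congr rapid; apply/funext => x; rewrite !mul1r.
Qed.

Lemma rapid_coordM j f : rapid f -> rapid (fun x => x ord0 j * f x).
Proof.
(* Differentiating x_j f produces a term without the factor x_j, which the summand g collects. *)
move=> rf; apply: (@rapid_coind (fun h => exists f g, [/\ rapid f, rapid g &
   h = fun x => x ord0 j * f x + g x])); last first.
  exists f, (fun x => 0 * f x); split=> //; first exact: rapidZ.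
  by apply/funext => x; rewrite mul0r addr0.
move=> _ [{rf}f [g [rf rg ->]]].
have h i x : is_derive x (e_ i) (fun x => x ord0 j * f x + g x)
    (x ord0 j * 'D_(e_ i) f x + ((i == j)%:R * f x + 1 * 'D_(e_ i) g x)).
  have := rapid_is_derive i x rf => ?; have := rapid_is_derive i x rg => ?.
  have := @is_derive_coord R d (fun t => t) (fun=> 1) j i x (is_derive_id _ _) => ?.
  apply: is_derive_eq; rewrite /GRing.scale/= mul1r -addrA; congr (_ + (_ + _)).
  by rewrite mulrC; case: eqP.
split.
- apply: (contD (f := fun x => x ord0 j * f x)); last exact: rapid_cont.
  by apply: contM; [exact: coord_continuous|exact: rapid_cont].
- by move=> i x; exact: (@ex_derive _ _ _ _ _ _ _ (h i x)).
- move=> i; rewrite (eq_derive_fun (h i)); eexists; eexists.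
  split; [exact: rapid_derive rf| |reflexivity].
  by apply: rapid_lin => //; exact: rapid_derive.
- move=> N; have [C fC] := rapid_bound N.+1 rf; have [C' gC] := rapid_bound N rg.
  exists (C + C') => x.
  have w0 : 0 <= (1 + l1norm x) ^+ N.
    by rewrite exprn_ge0// (le_trans ler01)// l1_weight_ge1.
  apply: le_trans (lerD (fC x) (gC x)).
  rewrite exprSr -mulrA -mulrDr ler_wpM2l// (le_trans (ler_normD _ _))//.
  rewrite lerD2r normrM ler_wpM2r//.
  by rewrite (le_trans (coord_le_l1norm x j))// lerDr.
Qed.

(** The extra function f supplies the empty sum, as 0 * f. *)
Lemma rapid_sum (I : Type) (s : seq I) (F : I -> V -> R) f :
  rapid f -> (forall i, rapid (F i)) -> rapid (fun x => \sum_(i <- s) F i x).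
Proof.
move=> rf rF; elim: s => [|i s IH].
  by have := rapidZ 0 rf; congr rapid; apply/funext => x; rewrite big_nil mul0r.
by under eq_fun do rewrite big_cons; exact: rapidD.
Qed.

Lemma rapid_dotM v f : rapid f -> rapid (fun x => dotv x v * f x).
Proof.
move=> rf.
have := @rapid_sum _ (index_enum 'I_d) (fun i x => v ord0 i * (x ord0 i * f x)) f rf
  (fun i => rapidZ _ (rapid_coordM i rf)).
congr rapid; apply/funext => x; rewrite mulr_suml; apply: eq_bigr => i _; ring.
Qed.

End rapid_decay.

(** * Gaussians and plane waves *)

Section gaussian_and_trig.
Variables (R : realType) (d : nat).
Local Notation V := 'rV[R]_d.
Local Notation e_ := (@basis_vec R d).
Implicit Types (f g p q : V -> R) (x y v xi : V).

Lemma is_derive_from_line f x v (L : R) :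
  is_derive (0 : R) 1 (fun s : R => f (s *: v + x)) L -> is_derive x v f L.
Proof.
have E : (fun h : R => h^-1 *: ((f \o shift x) (h *: v) - f x)) =
    (fun h : R => h^-1 *: (((fun s : R => f (s *: v + x)) \o shift 0)
    (h *: (1 : R)) - f (0 *: v + x))).
  by apply/funext => h /=; rewrite [h%:A]mulr1 addr0 scale0r add0r.
case=> df Lf; apply: DeriveDef.
  by rewrite /derivable E.
by rewrite -Lf /derive E.
Qed.

Definition gauss (a : R) x : R := expR (- (a * dotv x x)).

Lemma continuous_sum (I : Type) (s : seq I) (F : I -> V -> R) :
  (forall i, continuous (F i)) -> continuous (fun x => \sum_(i <- s) F i x).
Proof.
move=> cF; elim: s => [|i s IH].
  by under eq_fun do rewrite big_nil; exact: cst_continuous.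
by under eq_fun do rewrite big_cons; exact: contD.
Qed.

Lemma continuous_dotv v : continuous (fun x => dotv x v).
Proof.
apply: continuous_sum => i; apply: contM; last exact: cst_continuous.
exact: coord_continuous.
Qed.

Lemma continuous_dotvv : continuous (fun x => dotv x x).
Proof. by apply: continuous_sum => i; apply: contM; exact: coord_continuous. Qed.

Lemma continuous_gauss a : continuous (gauss a).
Proof.
move=> x; rewrite /gauss.
apply: (@continuous_comp _ _ _ (fun y => - (a * dotv y y)) expR); last exact: continuous_expR.
apply: continuousN; apply: (contM (f := fun=> a)); first exact: cst_continuous.
exact: continuous_dotvv.
Qed.

Lemma is_derive_gauss a v x : is_derive x v (gauss a) (- (2 * a) * dotv x v * gauss a x).
Proof.
apply: is_derive_from_line.
pose k (s : R) := - (a * (dotv x x + s * (2 * dotv x v) + s ^+ 2 * dotv v v)).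
have k0 : k 0 = - (a * dotv x x) by rewrite /k mul0r expr0n/= mul0r !addr0.
have dk : is_derive (0 : R) 1 k (- (2 * a) * dotv x v).
  by apply: is_derive_eq; rewrite /GRing.scale/= expr0n/=; ring.
have := is_derive1_comp (is_derive_expR (k 0)) dk.
rewrite k0 mulrC; congr is_derive; apply/funext => s; congr expR.
by rewrite /k dotvDl !dotvDr !dotvZl !dotvZr (dotvC v x); ring.
Qed.

(** For N > 0 put t = a y / N. Then exp(a y) = exp(t)^N >= (1 + t)^N, while c + y <= (c + N / a) (1
    + t); hence the constant (c + N / a)^N. *)
Lemma expR_poly_bound (c a : R) (N : nat) : 0 <= c -> 0 < a ->
  exists C : R, forall y : R, 0 <= y -> (c + y) ^+ N * expR (- (a * y)) <= C.
Proof.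
move=> c0 a0; case: N => [|N].
  exists 1 => y y0; rewrite expr0 mul1r -expR0 ler_expR oppr_le0.
  by rewrite mulr_ge0// ltW.
have N0 : 0 < N.+1%:R :> R by rewrite ltr0n.
exists ((c + N.+1%:R / a) ^+ N.+1) => y y0.
rewrite expRN ler_pdivrMr ?expR_gt0//.
have -> : a * y = N.+1%:R * (a * y / N.+1%:R).
  by rewrite [RHS]mulrC divfK// gt_eqF.
rewrite expRM_natl -exprMn lerXn2r ?nnegrE ?addr_ge0//.
  by rewrite mulr_ge0 ?expR_ge0// addr_ge0// divr_ge0// ltW.
apply: (@le_trans _ _ ((c + N.+1%:R / a) * (1 + a * y / N.+1%:R))); last first.
  by rewrite ler_wpM2l ?expR_ge1Dx// addr_ge0// divr_ge0// ltW.
have -> : (c + N.+1%:R / a) * (1 + a * y / N.+1%:R) =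
  c + y + (N.+1%:R / a + c * (a * y / N.+1%:R)).
  by field; rewrite !gt_eqF//= gt_eqF.
rewrite lerDl addr_ge0 ?divr_ge0 ?mulr_ge0 ?divr_ge0 ?mulr_ge0//; exact: ltW.
Qed.

Lemma l1norm_le_dotvv x : l1norm x <= d%:R + dotv x x.
Proof.
rewrite -[d in d%:R]card_ord -sumr_const -big_split; apply: ler_sum => i _ /=.
rewrite -expr2 -[_ ^+ 2]real_normK ?num_real//.
have := normr_ge0 (x ord0 i); set a := `|_| => a0; nra.
Qed.

(** Polynomials times the Gaussian, generated by the operations that its derivatives require. *)
Inductive gauss_poly a : (V -> R) -> Prop :=
| gauss_poly1 : gauss_poly a (gauss a)
| gauss_polyM j f : gauss_poly a f -> gauss_poly a (fun x => x ord0 j * f x)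
| gauss_polyD f g c : gauss_poly a f -> gauss_poly a g ->
    gauss_poly a (fun x => f x + c * g x).

Lemma rapid_gauss a : 0 < a -> rapid (gauss a).
Proof.
move=> a0; apply: (@rapid_coind _ _ (gauss_poly a)); last exact: gauss_poly1.
move=> f; elim => {f} [|j f gf [cf df Df bf]|f g c gf [cf df Df bf] gg [cg dg Dg bg]].
- have h i x : is_derive x (e_ i) (gauss a) (- (2 * a) * (x ord0 i * gauss a x)).
    by have := is_derive_gauss a (e_ i) x; rewrite dotv_basis mulrA.
  split.
  + exact: continuous_gauss.
  + by move=> i x; exact: (@ex_derive _ _ _ _ _ _ _ (h i x)).
  + move=> i; rewrite (eq_derive_fun (h i)).
    (* A multiple c h is only available in the form h + (c - 1) h, here with c = - 2 a. *)
    have := gauss_polyD (- (2 * a) - 1) (gauss_polyM i (gauss_poly1 a))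
      (gauss_polyM i (gauss_poly1 a)).
    by congr gauss_poly; apply/funext => x; ring.
  + move=> N; have [C hC] := @expR_poly_bound (1 + d%:R) a N (addr_ge0 ler01 (ler0n _ _)) a0.
    exists C => x; apply: le_trans (hC _ (dotvv_ge0 x)).
    rewrite ger0_norm ?expR_ge0// ler_wpM2r ?expR_ge0//.
    rewrite lerXn2r ?nnegrE ?addr_ge0 ?l1norm_ge0 ?dotvv_ge0//.
    by rewrite -addrA lerD2l l1norm_le_dotvv.
- have h i x : is_derive x (e_ i) (fun x => x ord0 j * f x)
    (x ord0 j * 'D_(e_ i) f x + (i == j)%:R * f x).
    have := derivableP (df i x) => ?.
    have := @is_derive_coord R d (fun t => t) (fun=> 1) j i x (is_derive_id _ _) => ?.
    by apply: is_derive_eq; congr (_ + _); rewrite /GRing.scale/= mulrC;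
      case: eqP.
  split.
  + by apply: contM => //; exact: coord_continuous.
  + by move=> i x; exact: (@ex_derive _ _ _ _ _ _ _ (h i x)).
  + move=> i; rewrite (eq_derive_fun (h i)).
    by apply: gauss_polyD => //; exact: gauss_polyM.
  + move=> N; have [C fC] := bf N.+1; exists C => x; apply: le_trans (fC x).
    have w0 : 0 <= (1 + l1norm x) ^+ N.
      by rewrite exprn_ge0// (le_trans ler01)// l1_weight_ge1.
    rewrite exprSr -mulrA ler_wpM2l// normrM ler_wpM2r//.
    by rewrite (le_trans (coord_le_l1norm x j))// lerDr.
- have h i x : is_derive x (e_ i) (fun x => f x + c * g x)
    ('D_(e_ i) f x + c * 'D_(e_ i) g x).
    have := derivableP (df i x) => ?; have := derivableP (dg i x) => ?.
    exact: is_deriveD _ (is_deriveZ _ _).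
  split.
  + apply: (contD (g := fun x => c * g x)) => //.
    by apply: contM => //; exact: cst_continuous.
  + by move=> i x; exact: (@ex_derive _ _ _ _ _ _ _ (h i x)).
  + by move=> i; rewrite (eq_derive_fun (h i)); exact: gauss_polyD.
  + move=> N; have [C fC] := bf N; have [C' gC] := bg N.
    exists (C + `|c| * C') => x.
    have w0 : 0 <= (1 + l1norm x) ^+ N.
      by rewrite exprn_ge0// (le_trans ler01)// l1_weight_ge1.
    apply: le_trans (lerD (fC x) (ler_wpM2l (normr_ge0 c) (gC x))).
    by rewrite mulrCA -mulrDr ler_wpM2l// -normrM ler_normD.
Qed.

(** The complement of K is open, so all derivatives vanish there too, and on K the weighted
    derivatives are continuous and hence bounded. *)
Lemma rapid_compact f (K : set V) : smooth f -> compact K ->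
  (forall x, ~ K x -> f x = 0) -> rapid f.
Proof.
move=> sf cK fK; split=> // w N.
have cw : continuous (partials w f) by exact: (sf w).1.
have wK x : ~ K x -> partials w f x = 0.
  elim: w x {cw} => //= i w IH x Kx.
  rewrite (@near_eq_derive _ _ _ _ (cst 0)) ?derive_cst//.
  have oK : open (~` K).
    apply: closed_openC; apply: compact_closed => //; exact: norm_hausdorff.
  by apply: filterS (open_nbhs_nbhs (conj oK Kx)) => y Ky; exact: IH.
pose h x := (1 + l1norm x) ^+ N * `|partials w f x|.
have ch : continuous h.
  apply: contM; last by move=> x; apply: continuous_comp; [exact: cw|exact: norm_continuous].
  move=> x; apply: (@continuous_comp _ _ _ (fun x => 1 + l1norm x) (fun t : R => t ^+ N));
    last exact: exprn_continuous.
  apply: (contD (f := fun=> 1)); first exact: cst_continuous.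
  apply: continuous_sum => i y.
  apply: continuous_comp; [exact: coord_continuous|exact: norm_continuous].
have [M [Mr hM]] := compact_bounded (continuous_compact (continuous_subspaceT ch) cK).
(* The bound on K holds for any number above M; the 0 takes care of the points outside K. *)
exists (Num.max (M + 1) 0) => x; rewrite le_max.
have [Kx|/wK ->] := pselect (K x); last by rewrite normr0 mulr0 lexx orbT.
apply/orP; left; apply: (le_trans (ler_norm _)).
by apply: (hM (M + 1)); [rewrite ltrDl|exists x].
Qed.

Lemma cosB_le (a b : R) : `|cos (a + b) - cos a - b * - sin a| <= b ^+ 2.
Proof.
pose g t := cos (a + t); pose dg t := - sin (a + t); pose d2g t := - cos (a + t).
have d1 (x : R) : is_derive x 1 g (dg x).
  by apply: is_derive_eq; rewrite /GRing.scale/= add0r mulr1.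
have d2 (x : R) : is_derive x 1 dg (d2g x).
  by apply: is_derive_eq; rewrite /GRing.scale/= add0r mulr1.
have := @taylor2_le _ g dg d2g 1 b d1 d2.
rewrite mul1r /g /dg addr0; apply => t _.
by rewrite normrN ler_norml cos_geN1 cos_le1.
Qed.

Lemma sinB_le (a b : R) : `|sin (a + b) - sin a - b * cos a| <= b ^+ 2.
Proof.
pose g t := sin (a + t); pose dg t := cos (a + t); pose d2g t := - sin (a + t).
have d1 (x : R) : is_derive x 1 g (dg x).
  by apply: is_derive_eq; rewrite /GRing.scale/= add0r mulr1.
have d2 (x : R) : is_derive x 1 dg (d2g x).
  by apply: is_derive_eq; rewrite /GRing.scale/= add0r mulr1.
have := @taylor2_le _ g dg d2g 1 b d1 d2.
rewrite mul1r /g /dg addr0; apply => t _.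
by rewrite normrN ler_norml sin_geN1 sin_le1.
Qed.

Lemma normr_cos_le1 (a : R) : `|cos a| <= 1.
Proof. by rewrite ler_norml cos_geN1 cos_le1. Qed.

Lemma normr_sin_le1 (a : R) : `|sin a| <= 1.
Proof. by rewrite ler_norml sin_geN1 sin_le1. Qed.

Definition phase x xi : R := 2 * pi * dotv x xi.

(** The real part of (p + i q) e^(-2 pi i x.xi). The imaginary part is the same expression for the
    pair (q, - p), so the whole Fourier analysis can be done with real functions. *)
Definition trig p q xi x : R := p x * cos (phase x xi) + q x * sin (phase x xi).

Lemma is_derive_cos_phase xi x v :
  is_derive x v (fun x => cos (phase x xi)) (- (2 * pi * dotv v xi) * sin (phase x xi)).
Proof.
apply: is_derive_from_line.
rewrite (_ : (fun s => _) = cos \o (fun s => s * (2 * pi * dotv v xi) + phase x xi)).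
  have -> : - (2 * pi * dotv v xi) * sin (phase x xi) =
    - sin (0 * (2 * pi * dotv v xi) + phase x xi) * (2 * pi * dotv v xi).
    by rewrite mul0r add0r mulNr mulrC mulNr.
  by apply: is_derive1_comp; apply: is_derive_eq; rewrite /GRing.scale/=; ring.
by apply/funext => s; rewrite /= /phase dotvDl dotvZl; congr cos; ring.
Qed.

Lemma is_derive_sin_phase xi x v :
  is_derive x v (fun x => sin (phase x xi)) ((2 * pi * dotv v xi) * cos (phase x xi)).
Proof.
apply: is_derive_from_line.
rewrite (_ : (fun s => _) = sin \o (fun s => s * (2 * pi * dotv v xi) + phase x xi)).
  have -> : (2 * pi * dotv v xi) * cos (phase x xi) =
    cos (0 * (2 * pi * dotv v xi) + phase x xi) * (2 * pi * dotv v xi).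
    by rewrite mul0r add0r mulrC.
  by apply: is_derive1_comp; apply: is_derive_eq; rewrite /GRing.scale/=; ring.
by apply/funext => s; rewrite /= /phase dotvDl dotvZl; congr sin; ring.
Qed.

Lemma continuous_phase xi : continuous (fun x => phase x xi).
Proof.
apply: contM; last exact: continuous_dotv.
exact: cst_continuous.
Qed.

Lemma continuous_trig p q xi : continuous p -> continuous q -> continuous (trig p q xi).
Proof.
move=> cp cq; apply: (contD (f := fun x => p x * cos (phase x xi))); apply: contM => //.
  by move=> x; apply: continuous_comp; [exact: continuous_phase|exact: continuous_cos].
by move=> x; apply: continuous_comp; [exact: continuous_phase|exact: continuous_sin].
Qed.

Lemma trig_le p q xi x : `|trig p q xi x| <= `|p x| + `|q x|.
Proof.
apply: le_trans (ler_normD _ _) _; rewrite !normrM lerD// ler_piMr//.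
  exact: normr_cos_le1.
exact: normr_sin_le1.
Qed.

(** The exponential contributes multiplication by - 2 pi i xi_i, which sends the pair (p, q) to 2 pi
    xi_i (q, - p). The result is again of the form [trig], which closes the class used in
    [rapid_trig]. *)
Lemma rapid_is_derive_trig p q xi i x : rapid p -> rapid q ->
  is_derive x (e_ i) (trig p q xi)
    (trig (fun x => 1 * 'D_(e_ i) p x + (2 * pi * xi ord0 i) * q x)
      (fun x => 1 * 'D_(e_ i) q x + - (2 * pi * xi ord0 i) * p x) xi x).
Proof.
move=> rp rq.
have := rapid_is_derive i x rp => ?; have := rapid_is_derive i x rq => ?.
have := is_derive_cos_phase xi x (e_ i) => ?.
have := is_derive_sin_phase xi x (e_ i) => ?.
apply: is_derive_eq; rewrite /GRing.scale/= dotvC dotv_basis /trig; ring.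
Qed.

Lemma rapid_trig p q xi : rapid p -> rapid q -> rapid (trig p q xi).
Proof.
move=> rp rq; apply: (@rapid_coind _ _ (fun f => exists p q,
  [/\ rapid p, rapid q & f = trig p q xi])); last by exists p, q.
move=> _ [{rp}p [{rq}q [rp rq ->]]].
have h i x := rapid_is_derive_trig xi i x rp rq.
split.
- by apply: continuous_trig; exact: rapid_cont.
- by move=> i x; exact: (@ex_derive _ _ _ _ _ _ _ (h i x)).
- move=> i; rewrite (eq_derive_fun (h i)); eexists; eexists.
  by split; [| |reflexivity]; apply: rapid_lin => //; exact: rapid_derive.
- move=> N; have [C pC] := rapid_bound N rp; have [C' qC] := rapid_bound N rq.
  exists (C + C') => x; apply: le_trans (lerD (pC x) (qC x)).
  rewrite -mulrDr ler_wpM2l ?trig_le// exprn_ge0// (le_trans ler01)//.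
  exact: l1_weight_ge1.
Qed.

End gaussian_and_trig.

(** * Fourier transform *)

Section fourier_pair.
Variables (R : realType) (d : nat).
Local Notation leb := (lebesgue_Rd R d).
Local Notation V := 'rV[R]_d.
Local Notation e_ := (@basis_vec R d).
Implicit Types (f g p q u : V -> R) (x y v xi : V).

Lemma vec_shift_tuple (j : 'I_d) (h : R) t :
  vec (shift_tuple j h t) = h *: e_ j + vec t :> V.
Proof.
apply/rowP => i; rewrite vecE tnth_mktuple !mxE eqxx/= addrC.
by case: eqP => _; rewrite ?mulr1 ?mulr0 ?addr0.
Qed.

Lemma ge0_Ivec_shift (j : 'I_d) (h : R) (F : V -> \bar R) :
  measurable_fun setT (F \o @vec R d) -> (forall x, 0 <= F x)%E ->
  (\int[leb]_t F (h *: e_ j + vec t)%R = \int[leb]_t F (vec t))%E.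
Proof.
move=> mF F0; under eq_integral do rewrite -vec_shift_tuple.
by apply: (@ge0_integral_shift R d j h (F \o @vec R d)) => // t; exact: F0.
Qed.

Lemma ivec_shift (j : 'I_d) (h : R) f : ivec f -> ivec (fun x => f (h *: e_ j + x)).
Proof.
move=> /integrableP[mf foo]; apply/integrableP; split.
  rewrite (_ : _ \o _ = (EFin \o (f \o @vec R d)) \o shift_tuple j h).
    by apply: measurableT_comp => //; exact: measurable_shift_tuple.
  by apply/funext => t /=; rewrite vec_shift_tuple.
rewrite (@ge0_Ivec_shift j h (fun x => `|(f x)%:E|)%E)//.
exact: measurableT_comp.
Qed.

Lemma Ivec_shift (j : 'I_d) (h : R) f : ivec f ->
  Ivec (fun x => f (h *: e_ j + x)) = Ivec f.
Proof.
move=> hf; have mf := measurable_int _ hf.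
rewrite /Ivec /Rintegral; congr fine; rewrite integralE [in RHS]integralE.
have F0 (y : \bar R) : (0 <= maxe y 0)%E by rewrite le_max lexx orbT.
congr (_ - _)%E.
  rewrite funepos.unlock.
  apply: (@ge0_Ivec_shift j h (fun x => maxe (f x)%:E 0%E)) => //.
  exact: measurable_maxe mf (measurable_cst _).
rewrite funeneg.unlock.
apply: (@ge0_Ivec_shift j h (fun x => maxe (- (f x)%:E)%E 0%E)) => //.
apply: measurable_maxe; last exact: measurable_cst.
exact: measurableT_comp mf.
Qed.

(** Shifts of length at most 1 cost a factor 2, so a single majorant serves all the difference
    quotients of a rapidly decreasing function. *)
Lemma l1_weight_shift (j : 'I_d) (t : R) x : `|t| <= 1 ->
  1 + l1norm x <= 2 * (1 + l1norm (t *: e_ j + x)).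
Proof.
move=> t1; set y := _ + x.
have -> : x = y + (- t) *: e_ j by rewrite /y scaleNr addrAC subrr add0r.
have := l1normD y (- t *: e_ j); rewrite l1normZ l1norm_basis mulr1 normrN.
have := l1norm_ge0 y; lra.
Qed.

(** Arithmetic of a decay estimate: A and E are the weights at two nearby points, D is the quantity
    that decays at the second one, and c is the integrable majorant at the first. *)
Lemma weighted_le (A B c C D E : R) : 1 <= A * c -> A <= B * E -> E * D <= C ->
  0 <= D -> 0 <= c -> 0 <= B -> D <= B * C * c.
Proof.
move=> h1 h2 h3 D0 c0 B0; apply: (@le_trans _ _ (A * c * D)).
  by rewrite ler_peMl.
rewrite mulrAC ler_wpM2r//; apply: (@le_trans _ _ (B * E * D)).
  by rewrite ler_wpM2r.
by rewrite -mulrA ler_wpM2l.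
Qed.

(** By translation invariance, the integral of u(x + h e_j) - u(x) - h D_j u(x) is - h L, and
    Taylor's formula bounds it by K h^2. Hence |L| <= K h for all small h. This is the integration
    by parts behind [ftr_coordM]. *)
Lemma Ivec_derive_eq0 (j : 'I_d) u : rapid u -> Ivec ('D_(e_ j) u) = 0.
Proof.
move=> ru; have rdu := rapid_derive j ru; have rddu := rapid_derive j rdu.
have [C hC] := rapid_bound (2 * d) rddu.
set L := Ivec _; pose K := 2 ^+ (2 * d) * C * Ivec (@cauchy_weight R d).
have key h : `|h| <= 1 -> `|h| * `|L| <= K * h ^+ 2.
  move=> h1; have iu := rapid_ivec ru; have ius := ivec_shift j h iu.
  have idu := rapid_ivec rdu.
  have E : Ivec (fun x => u (h *: e_ j + x) - u x - h * 'D_(e_ j) u x) = - (h * L).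
    rewrite IvecB ?IvecB ?IvecZ ?Ivec_shift//; first by rewrite subrr sub0r.
      exact: ivecB.
    exact: ivecZ.
  rewrite -normrM -normrN -E.
  rewrite (_ : K * h ^+ 2 =
     Ivec (fun x => (2 ^+ (2 * d) * C * h ^+ 2) * cauchy_weight x)); last first.
    by rewrite IvecZ /K; [ring|exact: ivec_cauchy_weight].
  apply: norm_Ivec_le.
  - by apply: ivecB; [exact: ivecB|exact: ivecZ].
  - exact: ivecZ (ivec_cauchy_weight _ _).
  move=> x; pose g s := u (s *: e_ j + x).
  have d1 (s : R) : is_derive s 1 g ('D_(e_ j) u (s *: e_ j + x)).
    exact: (is_derive_line (rapid_is_derive j _ ru)).
  have d2 (s : R) : is_derive s 1 (fun s => 'D_(e_ j) u (s *: e_ j + x))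
     ('D_(e_ j) ('D_(e_ j) u) (s *: e_ j + x)).
    exact: (is_derive_line (rapid_is_derive j _ rdu)).
  have := @taylor2_le _ _ _ _ (2 ^+ (2 * d) * C * cauchy_weight x) h d1 d2.
  rewrite /g scale0r add0r => H; rewrite [leRHS]mulrAC; apply: H => t th.
  have t1 := le_trans th h1.
  have w1 := cauchy_weight_ge (coord_le_l1norm x).
  have w2 : (1 + l1norm x) ^+ (2 * d) <=
      2 ^+ (2 * d) * (1 + l1norm (t *: e_ j + x)) ^+ (2 * d).
    rewrite -exprMn lerXn2r ?nnegrE ?mulr_ge0 ?addr_ge0 ?l1norm_ge0//.
    exact: l1_weight_shift.
  have D0 := normr_ge0 ('D_(e_ j) ('D_(e_ j) u) (t *: e_ j + x)).
  have DC := hC (t *: e_ j + x); move: D0 DC; set D := `|_| => D0 DC.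
  apply: (weighted_le w1 w2 DC D0); last exact: exprn_ge0.
  exact/ltW/cauchy_weight_gt0.
apply/normr0_eq0/eqP; rewrite eq_le normr_ge0 andbT.
apply/ler_addgt0Pl => e e0; rewrite addr0.
have K1 : 0 < `|K| + 1 by rewrite ltr_wpDl.
pose h := Num.min 1 (e / (`|K| + 1)).
have h0 : 0 < h by rewrite lt_min ltr01 divr_gt0.
have h1 : `|h| <= 1 by rewrite ger0_norm ?(ltW h0)// ge_min lexx.
have := key h h1; rewrite ger0_norm ?(ltW h0)// expr2 mulrA mulrC ler_pM2r// => LK.
apply: (le_trans LK); apply: (@le_trans _ _ ((`|K| + 1) * h)).
  by rewrite ler_wpM2r ?(ltW h0)// (le_trans (ler_norm K))// lerDl.
by rewrite mulrC -ler_pdivlMr// ge_min lexx orbT.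
Qed.

(* The real part of the Fourier transform of [p + i q]. *)
Definition ftr p q xi : R := Ivec (trig p q xi).

Lemma ivec_trig p q xi : rapid p -> rapid q -> ivec (trig p q xi).
Proof. by move=> rp rq; apply/rapid_ivec/rapid_trig. Qed.

Lemma ftr_le p q xi : rapid p -> rapid q ->
  `|ftr p q xi| <= Ivec (fun x => `|p x| + `|q x|).
Proof.
move=> rp rq; apply: norm_Ivec_le; first exact: ivec_trig.
  by apply: ivecD; apply/ivec_norm/rapid_ivec.
exact: trig_le.
Qed.

Lemma phaseD x xi v (h : R) : phase x (h *: v + xi) = phase x xi + h * phase x v.
Proof. by rewrite /phase dotvDr dotvZr; ring. Qed.

(** The second-order remainders of cos and sin are at most the square of the increment of the phase,
    so the remainder of the integral is h^2 times the integral of |phase|^2 (|p| + |q|), finite by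
    rapid decay. *)
Lemma is_derive_ftr p q xi v : rapid p -> rapid q ->
  is_derive xi v (ftr p q) (ftr (fun x => dotv x v * (2 * pi * q x))
     (fun x => dotv x v * (- (2 * pi) * p x)) xi).
Proof.
move=> rp rq.
have rp' := rapid_dotM v (rapidZ (- (2 * pi)) rp).
have rq' := rapid_dotM v (rapidZ (2 * pi) rq).
pose W x := `|phase x v ^+ 2 * p x| + `|phase x v ^+ 2 * q x|.
have rph f : rapid f -> rapid (fun x => phase x v ^+ 2 * f x).
  move=> rf; have := rapidZ ((2 * pi) ^+ 2) (rapid_dotM v (rapid_dotM v rf)).
  by congr rapid; apply/funext => x; rewrite /phase; ring.
have iW : ivec W by apply: ivecD; apply/ivec_norm/rapid_ivec/rph.
apply: (@is_derive_quadratic _ _ _ _ _ _ (Ivec W)) => h _.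
rewrite /ftr -IvecB; [|exact: ivec_trig..].
rewrite -IvecZ; last exact: ivec_trig.
rewrite -IvecB; last 2 first.
- by apply: ivecB; exact: ivec_trig.
- by apply: ivecZ; exact: ivec_trig.
rewrite [leRHS]mulrC -IvecZ//; apply: norm_Ivec_le.
- by apply: ivecB; [apply: ivecB|apply: ivecZ]; exact: ivec_trig.
- exact: ivecZ.
move=> x; rewrite /trig phaseD; set a := phase x xi; set b := phase x v.
have -> : dotv x v * (2 * pi * q x) = b * q x by rewrite /b /phase; ring.
have -> : dotv x v * (- (2 * pi) * p x) = - (b * p x) by rewrite /b /phase; ring.
have -> : p x * cos (a + h * b) + q x * sin (a + h * b) -
    (p x * cos a + q x * sin a) - h * (b * q x * cos a + - (b * p x) * sin a) =
  p x * (cos (a + h * b) - cos a - (h * b) * - sin a) +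
  q x * (sin (a + h * b) - sin a - (h * b) * cos a) by ring.
apply: le_trans (ler_normD _ _) _.
rewrite /W -/b (normrM (p x)) (normrM (q x)) (normrM (b ^+ 2) (p x)).
rewrite (normrM (b ^+ 2) (q x)) (ger0_norm (sqr_ge0 b)).
rewrite (_ : h ^+ 2 * _ = `|p x| * (h * b) ^+ 2 + `|q x| * (h * b) ^+ 2); last by ring.
apply: lerD; apply: ler_wpM2l => //; [exact: cosB_le|exact: sinB_le].
Qed.

Lemma norm_sinB_le (a b : R) : `|sin (a + b) - sin a| <= `|b|.
Proof.
have d1 (x : R) : is_derive x 1 (fun t => sin (a + t)) (cos (a + x)).
  by apply: is_derive_eq; rewrite /GRing.scale/= add0r mulr1.
have := @norm_increment_le _ _ _ 1 b d1; rewrite addr0 mul1r; apply=> t _.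
exact: normr_cos_le1.
Qed.

Lemma norm_cosB_le (a b : R) : `|cos (a + b) - cos a| <= `|b|.
Proof.
have d1 (x : R) : is_derive x 1 (fun t => cos (a + t)) (- sin (a + x)).
  by apply: is_derive_eq; rewrite /GRing.scale/= add0r mulr1.
have := @norm_increment_le _ _ _ 1 b d1; rewrite addr0 mul1r; apply=> t _.
by rewrite normrN normr_sin_le1.
Qed.

Lemma rapid_l1M p : rapid p -> ivec (fun x => l1norm x * p x).
Proof.
move=> rp; under eq_fun do rewrite mulr_suml.
have H i : ivec (fun x => `|x ord0 i| * p x).
  have := rapid_ivec (rapid_coordM i rp); move/ivec_le; apply; last first.
    by move=> x; rewrite !normrM normr_id.
  apply: mvecM; apply: mvec_cont; last exact: rapid_cont.
  by move=> x; apply: continuous_comp; [exact: coord_continuous|exact: norm_continuous].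
elim: (index_enum _) => [|i s IH].
  under eq_fun do rewrite big_nil.
  by have := ivecZ 0 (rapid_ivec rp); congr ivec; apply/funext => x; rewrite mul0r.
by under eq_fun do rewrite big_cons; exact: ivecD.
Qed.

(** Directional derivatives do not imply continuity, so a Lipschitz bound is proved directly: cos
    and sin are 1-Lipschitz and |x| (|p| + |q|) is integrable. *)
Lemma continuous_ftr p q : rapid p -> rapid q -> continuous (ftr p q).
Proof.
move=> rp rq xi.
pose W x := l1norm x * p x; pose W' x := l1norm x * q x.
pose K := d%:R * (2 * pi) * Ivec (fun x => `|W x| + `|W' x|).
have iW : ivec (fun x => `|W x| + `|W' x|).
  by apply: ivecD; apply/ivec_norm/rapid_l1M.
have key v : `|ftr p q (v + xi) - ftr p q xi| <= K * `|v|.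
  rewrite -[v in v + xi]scale1r /ftr -IvecB; [|exact: ivec_trig..].
  rewrite /K -mulrAC [leRHS](mulrC _ (Ivec _)) [leRHS]mulrC -IvecZ//.
  apply: norm_Ivec_le; [by apply: ivecB; exact: ivec_trig|exact: ivecZ|].
  move=> x; rewrite /trig phaseD mul1r; set a := phase x xi; set b := phase x v.
  have bE : `|b| <= d%:R * (2 * pi) * `|v| * l1norm x.
    have pi0 : 0 <= 2 * pi :> R by rewrite mulr_ge0// pi_ge0.
    rewrite /b /phase normrM [X in X * _]ger0_norm//.
    apply: (@le_trans _ _ (2 * pi * (l1norm x * (d%:R * `|v|)))).
      rewrite ler_wpM2l// (le_trans (dotv_le_l1norm _ _))// ler_wpM2l ?l1norm_ge0//.
      exact: l1norm_le_norm.
    by rewrite le_eqVlt; apply/orP; left; apply/eqP; ring.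
  have -> : p x * cos (a + b) + q x * sin (a + b) - (p x * cos a + q x * sin a) =
    p x * (cos (a + b) - cos a) + q x * (sin (a + b) - sin a) by ring.
  apply: le_trans (ler_normD _ _) _.
  rewrite /W /W' (normrM (p x)) (normrM (q x)) (normrM _ (p x)) (normrM _ (q x)).
  rewrite (ger0_norm (l1norm_ge0 x)).
  rewrite (_ : _ * (_ + _) = `|p x| * (d%:R * (2 * pi) * `|v| * l1norm x) +
    `|q x| * (d%:R * (2 * pi) * `|v| * l1norm x)); last by ring.
  apply: lerD; apply: ler_wpM2l => //; apply: le_trans bE.
    exact: norm_cosB_le.
  exact: norm_sinB_le.
have FF : Filter (nbhs (xi : V)) := nbhs_filter (xi : V).
apply: (proj2 (@cvgrPdist_le _ _ _ (nbhs (xi : V)) FF (ftr p q) (ftr p q xi))) => e e0.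
have K1 : 0 < `|K| + 1 by rewrite ltr_wpDl.
near=> y.
have yx : `|y - xi| <= e / (`|K| + 1).
  rewrite distrC; near: y; apply: (@cvgr_dist_le _ _ _ _ _ id xi) => //.
  exact: divr_gt0.
rewrite distrC; have := key (y - xi); rewrite subrK => /le_trans; apply.
apply: (@le_trans _ _ ((`|K| + 1) * `|y - xi|)).
  by rewrite ler_wpM2r// (le_trans (ler_norm K))// lerDl.
by rewrite mulrC -ler_pdivlMr.
Unshelve. all: by end_near. Qed.

(** The function [trig q (- p)] has a j-th derivative of integral 0, and this derivative is the
    difference of the two integrands. *)
Lemma ftr_coordM p q xi (j : 'I_d) : rapid p -> rapid q ->
  2 * pi * xi ord0 j * ftr p q xi = ftr ('D_(e_ j) q) (fun x => - 'D_(e_ j) p x) xi.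
Proof.
move=> rp rq.
have rmp := rapidN rp.
have := Ivec_derive_eq0 j (rapid_trig xi rq rmp).
rewrite (eq_derive_fun (fun x => rapid_is_derive_trig xi j x rq rmp)) => H0.
have rdp := rapidN (rapid_derive j rp); have rdq := rapid_derive j rq.
apply/eqP; rewrite -subr_eq0 /ftr -IvecZ; last exact: ivec_trig.
rewrite -IvecB; [|exact/ivecZ/ivec_trig|exact: ivec_trig].
rewrite -oppr_eq0 -IvecN; last by apply: ivecB; [exact/ivecZ/ivec_trig|exact: ivec_trig].
apply/eqP; rewrite -[RHS]H0; congr Ivec; apply/funext => x; rewrite /trig.
have -> : 'D_(e_ j) (fun x => - p x) x = - 'D_(e_ j) p x.
  have := rapid_is_derive j x rp => ?.
  by rewrite derive_val.
ring.
Qed.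

(** Each further factor 1 + |xi_1| + ... + |xi_d| is traded for a derivative of the pair, one
    coordinate at a time; the pair is therefore generalised in the induction. *)
Lemma ftr_bound N p q : rapid p -> rapid q ->
  exists C, forall xi, (1 + l1norm xi) ^+ N * `|ftr p q xi| <= C.
Proof.
elim: N p q => [|N IH] p q rp rq.
  by exists (Ivec (fun x => `|p x| + `|q x|)) => xi; rewrite mul1r ftr_le.
have [C hC] := IH _ _ rp rq.
have /choice[C' hC'] : forall j, exists C, forall xi, (1 + l1norm xi) ^+ N *
    (`|xi ord0 j| * `|ftr p q xi|) <= C.
  move=> j; have rdp := rapidN (rapid_derive j rp); have rdq := rapid_derive j rq.
  have [C' hC'] := IH _ _ rdq rdp; exists (C' / (2 * pi)) => xi.
  have pi0 : 0 < 2 * pi :> R by rewrite mulr_gt0// pi_gt0.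
  rewrite ler_pdivlMr// (le_trans _ (hC' xi))// -ftr_coordM// !normrM.
  rewrite (ger0_norm (ltW (pi_gt0 R))) ger0_norm//.
  by rewrite le_eqVlt; apply/orP; left; apply/eqP; ring.
exists (C + \sum_j C' j) => xi.
rewrite exprSr -mulrA mulrDl mul1r mulrDr lerD//.
rewrite {2}/l1norm mulr_suml mulr_sumr; exact: ler_sum.
Qed.

Lemma rapid_ftr p q : rapid p -> rapid q -> rapid (ftr p q).
Proof.
move=> rp rq; apply: (@rapid_coind _ _ (fun f => exists p q,
  [/\ rapid p, rapid q & f = ftr p q])); last by exists p, q.
move=> _ [{rp}p [{rq}q [rp rq ->]]].
have h i x := is_derive_ftr x (e_ i) rp rq.
split.
- exact: continuous_ftr.
- by move=> i x; exact: (@ex_derive _ _ _ _ _ _ _ (h i x)).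
- move=> i; rewrite (eq_derive_fun (h i)); eexists; eexists.
  by split; [| |reflexivity]; apply: rapid_dotM; exact: rapidZ.
- by move=> N; exact: ftr_bound.
Qed.

End fourier_pair.

(** * Transforms of Gaussians and of modes; the multiplication formula *)

Section gaussian_transform.
Variables (R : realType) (d : nat).
Local Notation leb := (lebesgue_Rd R d).
Local Notation V := 'rV[R]_d.
Local Notation e_ := (@basis_vec R d).
Implicit Types (f g p q u : V -> R) (x y v xi : V).

Lemma Ivec_sum (I : Type) (s : seq I) (F : I -> V -> R) :
  (forall i, ivec (F i)) ->
  ivec (fun x => \sum_(i <- s) F i x) /\
  Ivec (fun x => \sum_(i <- s) F i x) = \sum_(i <- s) Ivec (F i).
Proof.
move=> iF; elim: s => [|i s [IH1 IH2]].
  have E : (fun x : V => \sum_(i <- [::]) F i x) = fun=> 0.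
    by apply/funext => x; rewrite big_nil.
  rewrite E big_nil; split; first exact: integrable0.
  by rewrite /Ivec Rintegral_cst// mul0r.
have E : (fun x => \sum_(j <- i :: s) F j x) = fun x => F i x + \sum_(j <- s) F j x.
  by apply/funext => x; rewrite big_cons.
by rewrite E big_cons -IH2; split; [exact: ivecD|exact: IvecD].
Qed.

Lemma is_derive_zero_eq (g : R -> R) : (forall t : R, is_derive t 1 g 0) ->
  forall t, g t = g 0.
Proof.
move=> dg t; apply/eqP; rewrite -subr_eq0 -normr_le0.
have := @norm_increment_le _ g (fun=> 0) 0 t dg; rewrite mul0r; apply => s _.
by rewrite normr0.
Qed.

(** Since D_j g = - 2 a x_j g, the transform F satisfies D_v F = - (2 pi^2 / a) (xi.v) F. Along the
    ray s xi the product of F and exp(pi^2 |xi|^2 s^2 / a) is constant, and F(0) is the integral.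
    The coefficient c2 drops out because the transform of a Gaussian is real. *)
Lemma ftr_gauss_ray (a c1 c2 : R) xi : 0 < a ->
  ftr (fun x => c1 * gauss a x) (fun x => c2 * gauss a x) xi =
  c1 * Ivec (@gauss R d a) * expR (- (pi ^+ 2 / a * dotv xi xi)).
Proof.
move=> a0; have rg := @rapid_gauss R d a a0; have pi0 := pi_gt0 R.
pose p x := c1 * gauss a x; pose q x := c2 * gauss a x.
have rp : rapid p by exact: rapidZ.
have rq : rapid q by exact: rapidZ.
have Dp c j x : 'D_(e_ j) (fun x => c * gauss a x) x = - (2 * a) * (x ord0 j * (c * gauss a x)).
  have := is_derive_gauss a (e_ j) x; rewrite dotv_basis => ?.
  by rewrite derive_val /GRing.scale/=; ring.
have DA v eta : is_derive eta v (ftr p q) (- (2 * pi ^+ 2 / a) * dotv eta v * ftr p q eta).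
  have := is_derive_ftr eta v rp rq; congr is_derive.
  transitivity (\sum_(j < d) v ord0 j * (- (pi / a) * (2 * pi * eta ord0 j * ftr p q eta))).
    transitivity (\sum_(j < d) Ivec (fun x => - (pi / a) * v ord0 j *
        trig ('D_(e_ j) q) (fun x => - 'D_(e_ j) p x) eta x)).
      have [_ <-] := Ivec_sum (index_enum 'I_d) (fun j =>
         ivecZ (- (pi / a) * v ord0 j)
           (ivec_trig eta (rapid_derive j rq) (rapidN (rapid_derive j rp)))).
      congr Ivec; apply/funext => x; rewrite /trig {1 2}/dotv.
      rewrite !mulr_suml -big_split; apply: eq_bigr => j _.
      by rewrite /= !Dp /p /q; field; rewrite gt_eqF.
    apply: eq_bigr => j _; rewrite IvecZ; last first.
      exact: ivec_trig (rapid_derive j rq) (rapidN (rapid_derive j rp)).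
    by rewrite ftr_coordM// /ftr; ring.
  rewrite /dotv mulr_sumr mulr_suml; apply: eq_bigr => j _.
  by field; rewrite gt_eqF.
pose k (s : R) := pi ^+ 2 / a * dotv xi xi * s ^+ 2.
pose g (s : R) := ftr p q (s *: xi + 0) * expR (k s).
have dg (s : R) : is_derive s 1 g 0.
  have d1 := is_derive_line (DA xi (s *: xi + 0)).
  have d2 : is_derive s 1 k (pi ^+ 2 / a * dotv xi xi * (2 * s)).
    by apply: is_derive_eq; rewrite /GRing.scale/=; ring.
  have d3 := is_derive1_comp (is_derive_expR (k s)) d2.
  have := is_deriveM d1 d3; congr is_derive.
  rewrite addr0 dotvZl; set F := ftr p q _; rewrite /GRing.scale/=; field.
  by rewrite gt_eqF.
have := is_derive_zero_eq dg 1; rewrite /g /k scale0r scale1r !addr0 expr0n/= mulr0 expR0.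
rewrite expr1n !mulr1 => E.
have E0 : ftr p q 0 = c1 * Ivec (@gauss R d a).
  rewrite -IvecZ; last exact: rapid_ivec.
  by congr Ivec; apply/funext => x; rewrite /trig /phase dotvC dotv0l mulr0 cos0 sin0 mulr1 mulr0 addr0.
by rewrite -E0 -E -/p -/q expRN -mulrA divff ?mulr1// gt_eqF// expR_gt0.
Qed.

Lemma measurable_gauss1 (c m : R) :
  measurable_fun setT (fun t : R => expR (- (c * (t - m) ^+ 2))).
Proof.
apply: continuous_measurable_fun => t.
apply: (@continuous_comp _ _ _ (fun t => - (c * (t - m) ^+ 2)) expR); last exact: continuous_expR.
apply: continuousN; apply: continuousM; first exact: cst_continuous.
by apply: (@continuous_comp _ _ _ (fun t => t - m) (fun t => t ^+ 2));
  [apply: continuousB; [exact: id|exact: cst_continuous]|exact: exprn_continuous].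
Qed.

Lemma integral_gauss1 (m rho : R) : 0 < rho ->
  (\int[@lebesgue_measure R]_t (expR (- (pi * rho ^+ 2 * (t - m) ^+ 2)))%:E = (rho^-1)%:E)%E.
Proof.
move=> rho0; have pi0 := pi_gt0 R.
have pin : pi != 0 :> R by rewrite gt_eqF.
have rn : rho != 0 by rewrite gt_eqF.
(* The standard deviation for which 2 s^2 = 1 / (pi rho^2); the normal density then has peak value
   rho. *)
pose s := (Num.sqrt (2 * pi) * rho)^-1.
have s0 : 0 < s by rewrite invr_gt0 mulr_gt0// sqrtr_gt0 mulr_gt0.
have s2 : s ^+ 2 = (2 * pi * rho ^+ 2)^-1.
  by rewrite /s exprVn exprMn sqr_sqrtr// mulr_ge0// ltW.
have pk : normal_peak s = rho.
  rewrite /normal_peak s2; rewrite (_ : _ *+ 2 = (rho^-1) ^+ 2).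
    by rewrite sqrtr_sqr ger0_norm ?invrK// invr_ge0 ltW.
  have H (P : R) : P != 0 -> (2 * P * rho ^+ 2)^-1 * P *+ 2 = rho^-1 ^+ 2.
    by move=> Pn; field; rewrite rn Pn.
  exact: H.
have nE : normal_fun m s = fun t => expR (- (pi * rho ^+ 2 * (t - m) ^+ 2)).
  apply/funext => t; rewrite /normal_fun s2; congr expR.
  have H (P : R) : P != 0 ->
      - (t - m) ^+ 2 / ((2 * P * rho ^+ 2)^-1 *+ 2) = - (P * rho ^+ 2 * (t - m) ^+ 2).
    by move=> Pn; field; rewrite rn Pn.
  exact: H.
have := @integral_normal_pdf R m s; rewrite /normal_pdf gt_eqF//=.
rewrite nE pk; under eq_integral do rewrite EFinM.
rewrite ge0_integralZl//; last 2 first.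
- by apply/measurable_EFinP; exact: measurable_gauss1.
- by rewrite lee_fin ltW.
move=> H; move: (congr1 (fun z => (rho^-1)%:E * z)%E H).
by rewrite muleA -EFinM mulVf// mul1e mule1.
Qed.

Lemma gauss_prodE (a : R) x v :
  gauss a (x - v) = \prod_(i < d) expR (- (a * (x ord0 i - v ord0 i) ^+ 2)).
Proof.
rewrite /gauss -expR_sum; congr expR; rewrite mulr_sumr -sumrN.
by apply: eq_bigr => i _; rewrite !mxE expr2.
Qed.

Lemma ge0_Ivec_gauss (rho : R) v : 0 < rho ->
  (\int[leb]_t (gauss (pi * rho ^+ 2) (vec t - v))%:E = (rho ^- d)%:E)%E.
Proof.
move=> rho0; under eq_integral do rewrite gauss_prodE.
under eq_integral do under eq_bigr do rewrite vecE.
rewrite (@ge0_integral_prod R d (fun i t => expR (- (pi * rho ^+ 2 * (t - v ord0 i) ^+ 2)))).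
- under eq_bigr do rewrite integral_gauss1//.
  by rewrite prodEFin prodr_const card_ord exprVn.
- by move=> i; exact: measurable_gauss1.
- by move=> i x; exact: expR_ge0.
Qed.

Lemma Ivec_gauss (rho : R) : 0 < rho -> Ivec (@gauss R d (pi * rho ^+ 2)) = rho ^- d.
Proof.
move=> rho0; have := ge0_Ivec_gauss 0 rho0.
by under eq_integral do rewrite subr0; rewrite /Ivec /Rintegral => ->.
Qed.

Definition mode (rho : R) v x : R := gauss (pi * rho ^+ 2) x * cos (phase x v).

(** The normalisation gives mass 1 for every width, by [integral_mode_hat]. *)
Definition mode_hat (rho : R) v xi : R := rho ^- d / 2 *
  (gauss (pi / rho ^+ 2) (xi - v) + gauss (pi / rho ^+ 2) (xi + v)).

Lemma ftr_gaussE (rho c1 c2 : R) xi : 0 < rho ->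
  ftr (fun x => c1 * gauss (pi * rho ^+ 2) x) (fun x => c2 * gauss (pi * rho ^+ 2) x) xi =
  c1 * rho ^- d * gauss (pi / rho ^+ 2) xi.
Proof.
move=> rho0; have pi0 := pi_gt0 R.
have H (P : R) : P != 0 -> P ^+ 2 / (P * rho ^+ 2) = P / rho ^+ 2.
  by move=> Pn; field; rewrite Pn gt_eqF.
rewrite ftr_gauss_ray ?mulr_gt0 ?exprn_gt0//.
by rewrite (Ivec_gauss rho0) (H pi) ?gt_eqF.
Qed.

Lemma phase_addr x v xi : phase x (xi + v) = phase x xi + phase x v.
Proof. by rewrite /phase dotvDr mulrDr. Qed.

Lemma phase_subr x v xi : phase x (xi - v) = phase x xi - phase x v.
Proof. by rewrite /phase dotvDr -scaleN1r dotvZr; ring. Qed.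

Lemma rapid_mode rho v : 0 < rho -> rapid (mode rho v).
Proof.
move=> rho0; have rg : rapid (@gauss R d (pi * rho ^+ 2)).
  by apply: rapid_gauss; rewrite mulr_gt0 ?pi_gt0 ?exprn_gt0.
have := rapid_trig v rg (rapidZ 0 rg); congr rapid.
by apply/funext => x; rewrite /trig mul0r mul0r addr0.
Qed.

(** The cosine factor splits into two modulations, which translate the Gaussian transform by v and
    by - v. *)
Lemma ftr_mode rho v xi (c1 c2 : R) : 0 < rho ->
  ftr (fun x => c1 * mode rho v x) (fun x => c2 * mode rho v x) xi = c1 * mode_hat rho v xi.
Proof.
move=> rho0; have rg : rapid (@gauss R d (pi * rho ^+ 2)).
  by apply: rapid_gauss; rewrite mulr_gt0 ?pi_gt0 ?exprn_gt0.
pose G := @gauss R d (pi * rho ^+ 2).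
transitivity (2^-1 * ftr (fun x => c1 * G x) (fun x => c2 * G x) (xi - v) +
   2^-1 * ftr (fun x => c1 * G x) (fun x => c2 * G x) (xi + v)).
  have ri eta : ivec (trig (fun x => c1 * G x) (fun x => c2 * G x) eta).
    by apply: ivec_trig; exact: rapidZ.
  rewrite -!IvecZ// -IvecD; [|exact: ivecZ..].
  congr Ivec; apply/funext => x.
  rewrite /trig /mode -/G phase_subr phase_addr cosB sinB cosD sinD; field; done.
have -> := ftr_gaussE c1 c2 (xi - v) rho0; have -> := ftr_gaussE c1 c2 (xi + v) rho0.
by rewrite /mode_hat; set r := rho ^- d; field; done.
Qed.

Lemma measurable_pairing p q u :
  continuous p -> continuous q -> continuous u ->
  measurable_fun setT (fun z : d.-tuple (measurableTypeR R) * d.-tuple (measurableTypeR R) =>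
    u (vec z.1) * trig p q (vec z.1) (vec z.2)).
Proof.
move=> cp cq cu.
have mph : measurable_fun setT (fun z : d.-tuple (measurableTypeR R) * d.-tuple (measurableTypeR R) =>
    phase (vec z.2 : V) (vec z.1)).
  apply: measurable_funM => //; apply: measurable_sum => i.
  under eq_fun do rewrite !vecE.
  apply: measurable_funM.
    exact: (measurableT_comp (measurable_tnth i) measurable_snd).
  exact: (measurableT_comp (measurable_tnth i) measurable_fst).
have m1 f : continuous f -> measurable_fun setT (fun z :
    d.-tuple (measurableTypeR R) * d.-tuple (measurableTypeR R) => f (vec z.1)).
  by move=> cf; exact: (measurableT_comp (mvec_cont cf) measurable_fst).
have m2 f : continuous f -> measurable_fun setT (fun z :
    d.-tuple (measurableTypeR R) * d.-tuple (measurableTypeR R) => f (vec z.2)).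
  by move=> cf; exact: (measurableT_comp (mvec_cont cf) measurable_snd).
apply: measurable_funM; first exact: m1.
apply: measurable_funD; apply: measurable_funM; [exact: m2| |exact: m2|].
  exact: measurableT_comp (continuous_measurable_fun (@continuous_cos R)) mph.
exact: measurableT_comp (continuous_measurable_fun (@continuous_sin R)) mph.
Qed.

(** The multiplication formula: Fubini's theorem and the symmetry of the phase in its two arguments.
    The transforms on the right are the cosine and sine transforms of u, with 0 * u as the zero
    function. *)
Lemma Ivec_ftr_pairing p q u : rapid p -> rapid q -> rapid u ->
  Ivec (fun x => u x * ftr p q x) =
  Ivec (fun y => p y * ftr u (fun x => 0 * u x) y + q y * ftr (fun x => 0 * u x) u y).
Proof.
move=> rp rq ru; have ru0 := rapidZ 0 ru.
have ipq : ivec (fun y => `|p y| + `|q y|) by apply: ivecD; apply/ivec_norm/rapid_ivec.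
transitivity (Ivec (fun x => Ivec (fun y => u x * trig p q x y))).
  by congr Ivec; apply/funext => x; rewrite IvecZ//; exact: ivec_trig.
rewrite (Ivec_Fubini (measurable_pairing (rapid_cont rp) (rapid_cont rq) (rapid_cont ru))
   (ivec_norm (rapid_ivec ru)) ipq); last first.
  by move=> x y; rewrite normrM ler_wpM2l// trig_le.
congr Ivec; apply/funext => y.
rewrite /ftr -!IvecZ; [|exact: ivec_trig..].
rewrite -IvecD; [|by apply/ivecZ/ivec_trig..].
by congr Ivec; apply/funext => x; rewrite /trig /phase (dotvC x y); ring.
Qed.

(** A mode is even, so its sine transform vanishes and q disappears. *)
Lemma mode_pairing rho v p q : 0 < rho -> rapid p -> rapid q ->
  Ivec (fun x => mode rho v x * ftr p q x) = Ivec (fun y => mode_hat rho v y * p y).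
Proof.
move=> rho0 rp rq; rewrite Ivec_ftr_pairing//; last exact: rapid_mode.
congr Ivec; apply/funext => y.
have E1 := ftr_mode v y 1 0 rho0; have E0 := ftr_mode v y 0 1 rho0.
have mE : (fun x => 1 * mode rho v x) = mode rho v by apply/funext => x; rewrite mul1r.
by move: E1 E0; rewrite !mE => -> ->; ring.
Qed.

End gaussian_transform.

(** * Tempered distributions *)

Section distributions.
Variables (R : realType) (d : nat).
Local Notation V := 'rV[R]_d.
Local Notation e_ := (@basis_vec R d).
Implicit Types (f g p q u : V -> R) (x y v xi : V) (phi psi : V -> R[i]).
Local Open Scope complex_scope.

Lemma complex_eta (z : R[i]) : z = complex.Re z +i* complex.Im z.
Proof. by case: z. Qed.

Lemma normc_le (z : R[i]) : Normc.normc z <= `|complex.Re z| + `|complex.Im z|.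
Proof.
case: z => a b /=; rewrite -[leRHS]ger0_norm ?addr_ge0// -sqrtr_sqr ler_wsqrtr//.
rewrite sqrrD !real_normK ?num_real// -addrA lerD2l lerDr mulrn_wge0// mulr_ge0//.
Qed.

Lemma Re_le_normc (z : R[i]) : `|complex.Re z| <= Normc.normc z.
Proof. by case: z => a b /=; rewrite -sqrtr_sqr ler_wsqrtr// lerDl sqr_ge0. Qed.

Lemma Im_le_normc (z : R[i]) : `|complex.Im z| <= Normc.normc z.
Proof. by case: z => a b /=; rewrite -sqrtr_sqr ler_wsqrtr// lerDr sqr_ge0. Qed.

Lemma enorm_ge0 x : 0 <= enorm x. Proof. exact: sqrtr_ge0. Qed.

Lemma l1norm_le_enorm x : l1norm x <= d%:R * enorm x.
Proof.
rewrite -[d in d%:R]card_ord mulr_natl -sumr_const; apply: ler_sum => i _.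
exact: coord_le_enorm.
Qed.

Lemma schwartz_seminorm_le (N : nat) phi (C : R) :
  (schwartz_seminorm N phi <= C%:E)%E <->
  forall w x, (size w <= N)%N ->
    (1 + enorm x) ^+ N * Normc.normc (cpartials w phi x) <= C.
Proof.
split=> [h w x wN|h].
  rewrite -lee_fin; apply: le_trans h; apply: ereal_sup_ubound.
  by exists w, x.
by apply: ge_ereal_sup => _ [w [x [wN ->]]]; rewrite lee_fin h.
Qed.

Lemma schwartz_rapid phi : schwartz phi ->
  rapid (fun x => complex.Re (phi x)) /\ rapid (fun x => complex.Im (phi x)).
Proof.
move=> [[sr si] sf].
have H w N : exists C : R, forall x,
    (1 + l1norm x) ^+ N * Normc.normc (cpartials w phi x) <= C.
  (* One index bounds both the order of derivation and the power of the weight in a seminorm, so the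
     larger of the two is taken. *)
  pose M := maxn (size w) N.
  have [C hC] : exists C : R, (schwartz_seminorm M phi <= C%:E)%E.
    have := sf M; case: (schwartz_seminorm M phi) => [C _| |_]//; first by exists C.
    by exists 0; rewrite leNye.
  move/schwartz_seminorm_le : hC => hC.
  exists ((1 + d%:R) ^+ N * C) => x.
  have n0 : 0 <= Normc.normc (cpartials w phi x) by case: (cpartials w phi x) => a b; exact: sqrtr_ge0.
  apply: (@le_trans _ _ ((1 + d%:R) ^+ N * ((1 + enorm x) ^+ M * Normc.normc (cpartials w phi x)))).
    rewrite mulrA ler_wpM2r//.
    apply: (@le_trans _ _ (((1 + d%:R) * (1 + enorm x)) ^+ N)).
      rewrite lerXn2r ?nnegrE ?mulr_ge0 ?addr_ge0 ?l1norm_ge0 ?enorm_ge0//.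
      have := l1norm_le_enorm x; have := enorm_ge0 x.
      by rewrite mulrDl !mulrDr !mul1r !mulr1; have := ler0n R d; lra.
    rewrite exprMn ler_wpM2l ?exprn_ge0 ?addr_ge0//.
    by rewrite ler_weXn2l ?leq_maxr// lerDl enorm_ge0.
  by rewrite ler_wpM2l ?exprn_ge0 ?addr_ge0// hC// leq_maxl.
split; split=> // w N; have [C hC] := H w N; exists C => x; apply: le_trans (hC x);
  (rewrite ler_wpM2l ?exprn_ge0 ?addr_ge0 ?l1norm_ge0//).
  exact: (Re_le_normc (cpartials w phi x)).
exact: (Im_le_normc (cpartials w phi x)).
Qed.

(** Only finitely many words have length at most N. The induction on the length moves the innermost
    derivative into p, and the bounds for the d resulting functions are added. *)
Lemma rapid_words_bound p (N : nat) : rapid p ->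
  exists C, forall (w : seq 'I_d) x, (size w <= N)%N ->
    forall M, (M <= N)%N -> (1 + l1norm x) ^+ M * `|partials w p x| <= C.
Proof.
move=> rp.
suff H K : exists C, forall (w : seq 'I_d) x, (size w <= K)%N ->
    (1 + l1norm x) ^+ N * `|partials w p x| <= C.
  have [C hC] := H N; exists C => w x wN M MN; apply: le_trans (hC w x wN).
  by rewrite ler_wpM2r// ler_weXn2l// lerDl l1norm_ge0.
elim: K p rp => [|K IH] p rp.
  by have [C hC] := rapid_bound N rp; exists C => -[]//= x _.
have /choice[C hC] : forall i, exists C, forall (w : seq 'I_d) x, (size w <= K)%N ->
    (1 + l1norm x) ^+ N * `|partials w ('D_(e_ i) p) x| <= C.
  by move=> i; exact/IH/rapid_derive.
have [C0 hC0] := rapid_bound N rp.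
have C0_ge0 : 0 <= C0.
  by apply: le_trans (hC0 0); rewrite mulr_ge0 ?exprn_ge0 ?addr_ge0 ?l1norm_ge0.
have C_ge0 i : 0 <= C i.
  by apply: le_trans (hC i [::] 0 isT); rewrite mulr_ge0 ?exprn_ge0 ?addr_ge0 ?l1norm_ge0.
exists (C0 + \sum_i C i); case/lastP => [|w i] x; first by rewrite (le_trans (hC0 x))// lerDl sumr_ge0.
rewrite size_rcons ltnS partials_rcons => wK.
by rewrite (le_trans (hC i w x wK))// (bigD1 i)//= addrCA lerDl addr_ge0// sumr_ge0.
Qed.

Lemma rapid_schwartz p q : rapid p -> rapid q -> schwartz (fun x => p x +i* q x).
Proof.
move=> rp rq; split; first by split; [exact: rp.1|exact: rq.1].
move=> N; have [C hC] := rapid_words_bound N rp; have [C' hC'] := rapid_words_bound N rq.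
apply: (@le_lt_trans _ _ (C + C')%:E); last exact: ltry.
apply/schwartz_seminorm_le => w x wN; apply: le_trans (lerD (hC w x wN N (leqnn N)) (hC' w x wN N (leqnn N))).
rewrite -mulrDr ler_pM ?exprn_ge0 ?addr_ge0 ?enorm_ge0 ?sqrtr_ge0//.
  by rewrite lerXn2r ?nnegrE ?addr_ge0 ?enorm_ge0 ?l1norm_ge0// lerD2l enorm_le_l1norm.
exact: normc_le.
Qed.

Lemma schwartz_lin (a : R[i]) phi psi : schwartz phi -> schwartz psi ->
  schwartz (fun x => a * phi x + psi x).
Proof.
move=> /schwartz_rapid[r1 r2] /schwartz_rapid[r3 r4].
have -> : (fun x => a * phi x + psi x) = fun x =>
   (complex.Re a * complex.Re (phi x) + - complex.Im a * complex.Im (phi x) + complex.Re (psi x)) +i*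
   (complex.Re a * complex.Im (phi x) + complex.Im a * complex.Re (phi x) + complex.Im (psi x)).
  by apply/funext => x; case: a (phi x) (psi x) => [a b] [c e] [k l] /=; simpc; congr (_ +i* _); ring.
apply: rapid_schwartz; apply: rapidD => //; exact: rapid_lin.
Qed.

Lemma fourierE phi xi : fourier phi xi =
  ftr (fun x => complex.Re (phi x)) (fun x => complex.Im (phi x)) xi +i*
  ftr (fun x => complex.Im (phi x)) (fun x => - complex.Re (phi x)) xi.
Proof.
rewrite /fourier /cintegral /ftr /Ivec; congr (_ +i* _); apply: eq_Rintegral => t _;
  rewrite /trig /phase; case: (phi (vec t)) => a b /=; ring.
Qed.

Lemma schwartz_fourier phi : rapid (fun x => complex.Re (phi x)) ->
  rapid (fun x => complex.Im (phi x)) -> schwartz (fourier phi).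
Proof.
move=> r1 r2; rewrite (funext (fourierE phi)).
by apply: rapid_schwartz; apply: rapid_ftr => //; exact: rapidN.
Qed.

Lemma Ccinfty_rapid phi : Ccinfty phi ->
  rapid (fun x => complex.Re (phi x)) /\ rapid (fun x => complex.Im (phi x)).
Proof.
move=> [[s1 s2] [K cK phiK]]; split; apply: (@rapid_compact _ _ _ K) => // x Kx; by rewrite phiK.
Qed.

(** * Bounded measurable functions as tempered distributions *)

Section bounded_function.
Variables (f : V -> R) (mf : mvec f) (M : R) (fM : forall x, `|f x| <= M).

Lemma ivec_bounded_rapid p : rapid p -> ivec (fun x => f x * p x).
Proof.
move=> rp; have := ivecMb (rapid_ivec rp) mf fM.
by congr ivec; apply/funext => x; rewrite mulrC.
Qed.

Lemma of_functionE phi : schwartz phi -> of_function f phi =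
  Ivec (fun x => f x * complex.Re (phi x)) +i* Ivec (fun x => f x * complex.Im (phi x)).
Proof.
move=> sphi; rewrite /of_function ifT; last exact/asboolP.
rewrite /cintegral /Ivec; congr (_ +i* _); apply: eq_Rintegral => t _;
  by case: (phi (vec t)) => a b /=; simpc.
Qed.

Lemma of_function_tempered : tempered (of_function f).
Proof.
split.
- by move=> phi nphi; rewrite /of_function ifF//; apply/negbTE/asboolPn.
- move=> a phi psi sphi spsi.
  rewrite of_functionE ?of_functionE//; last exact: schwartz_lin.
  have [r1 r2] := schwartz_rapid sphi; have [r3 r4] := schwartz_rapid spsi.
  have [i1 i2] := (ivec_bounded_rapid r1, ivec_bounded_rapid r2).
  have [i3 i4] := (ivec_bounded_rapid r3, ivec_bounded_rapid r4).
  case: a => a b; simpc; congr (_ +i* _).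
    rewrite -!IvecZ// -IvecB ?ivecZ// -IvecD ?ivecB ?ivecZ//.
    congr Ivec; apply/funext => x.
    by case: (phi x) (psi x) => [c e] [k l] /=; ring.
  rewrite -!IvecZ// -IvecD ?ivecZ// -IvecD ?ivecD ?ivecZ//.
  congr Ivec; apply/funext => x.
  by case: (phi x) (psi x) => [c e] [k l] /=; ring.
- move=> phi sphi e e0.
  have [r1 r2] := schwartz_rapid sphi.
  (* The real and imaginary parts each contribute |M| times the integral of the majorant; the 1
     makes K positive and the final inequality strict. *)
  pose K := 2 * (`|M| * Ivec (@cauchy_weight R d)) + 1.
  have icw := ivec_cauchy_weight R d.
  have cw0 : 0 <= Ivec (@cauchy_weight R d).
    by apply: Ivec_ge0 => x; exact/ltW/cauchy_weight_gt0.
  have K0 : 0 < K by rewrite ltr_wpDl// mulr_ge0// mulr_ge0.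
  (* The power 2 d of the weight is the one that the integrable majorant [cauchy_weight]
     compensates. *)
  exists (2 * d)%N, (e / K); split; first exact: divr_gt0.
  move=> psi spsi /ltW/schwartz_seminorm_le h.
  have [r3 r4] := schwartz_rapid spsi.
  have bd x : Normc.normc (psi x - phi x) <= e / K * cauchy_weight x.
    have := h [::] x isT.
    have -> : cpartials [::] (fun x => psi x - phi x) x = psi x - phi x.
      by rewrite [RHS]complex_eta.
    have w1 := cauchy_weight_ge (coord_le_enorm x).
    set n := Normc.normc _ => hn.
    have n0 : 0 <= n by rewrite /n; case: (psi x - phi x) => a b; exact: sqrtr_ge0.
    have w2 : (1 + enorm x) ^+ (2 * d) <= 1 * (1 + enorm x) ^+ (2 * d) by rewrite mul1r.
    have := weighted_le w1 w2 hn n0 (ltW (cauchy_weight_gt0 x)) ler01.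
    by rewrite mul1r.
  have part P Q : rapid P -> rapid Q ->
      (forall x, `|P x - Q x| <= Normc.normc (psi x - phi x)) ->
      `|Ivec (fun x => f x * P x) - Ivec (fun x => f x * Q x)| <=
      `|M| * (e / K) * Ivec (@cauchy_weight R d).
    move=> rP rQ PQ; have [iP iQ] := (ivec_bounded_rapid rP, ivec_bounded_rapid rQ).
    rewrite -IvecB// -IvecZ//; apply: norm_Ivec_le; [exact: ivecB|exact: ivecZ|].
    move=> x; rewrite -mulrBr normrM -mulrA ler_pM//.
      by rewrite (le_trans (fM x))// ler_norm.
    by rewrite (le_trans (PQ x)).
  rewrite !of_functionE// (le_lt_trans (normc_le _))//=.
  have ReB x : `|complex.Re (psi x) - complex.Re (phi x)| <= Normc.normc (psi x - phi x).
    by apply: le_trans (Re_le_normc _); case: (psi x) (phi x) => [a b] [c l].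
  have ImB x : `|complex.Im (psi x) - complex.Im (phi x)| <= Normc.normc (psi x - phi x).
    by apply: le_trans (Im_le_normc _); case: (psi x) (phi x) => [a b] [c l].
  apply: le_lt_trans (lerD (part _ _ r3 r1 ReB) (part _ _ r4 r2 ImB)) _.
  rewrite (_ : _ + _ = (K - 1) / K * e); last by rewrite /K; ring.
  by rewrite gtr_pMl// ltr_pdivrMr// mul1r gtrBl.
Qed.

Lemma of_function_real_valued : real_valued (of_function f).
Proof.
move=> phi sphi phi0; rewrite of_functionE//=.
rewrite (_ : (fun x => _) = fun=> 0); last by apply/funext => x; rewrite phi0 mulr0.
by rewrite /Ivec Rintegral_cst// mul0r.
Qed.

(** An identity for real parts suffices because it is assumed for all pairs: applied to (Re phi, Im
    phi) and to (Im phi, - Re phi), it gives both components of the complex identity. *)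
Lemma of_function_has_fourier g : ivec g ->
  (forall p q, rapid p -> rapid q ->
    Ivec (fun x => f x * ftr p q x) = Ivec (fun x => g x * p x)) ->
  has_fourier (of_function f) (fun x => (g x)%:C).
Proof.
move=> ig H; split.
  have i0 : ivec (fun _ : V => 0) by have := ivecZ 0 ig; congr ivec; apply/funext => x; rewrite mul0r.
  split=> /=; [exact: ivec_mvec ig|exact: ivec_mvec i0|].
  move=> K cK; split=> /=.
    by apply: integrableS ig => //; exact: measurable_vec_compact.
  by apply: integrableS i0 => //; exact: measurable_vec_compact.
move=> phi /Ccinfty_rapid[r1 r2].
rewrite of_functionE; last exact: schwartz_fourier.
rewrite /cintegral; congr (_ +i* _).
  rewrite (_ : (fun x => _) = fun x => f x * ftr (fun x => complex.Re (phi x))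
     (fun x => complex.Im (phi x)) x); last by apply/funext => x; rewrite fourierE.
  rewrite H//; apply: eq_Rintegral => t _; case: (phi (vec t)) => a b /=; by rewrite mul0r subr0.
rewrite (_ : (fun x => _) = fun x => f x * ftr (fun x => complex.Im (phi x))
     (fun x => - complex.Re (phi x)) x); last by apply/funext => x; rewrite fourierE.
rewrite H//; last exact: rapidN.
apply: eq_Rintegral => t _; case: (phi (vec t)) => a b /=; by rewrite mul0r addr0.
Qed.

End bounded_function.

End distributions.

(** * Uniqueness of the Fourier transform *)

Section bump.
Variable R : realType.

(** The classical smooth function that vanishes to infinite order at 0. *)
Definition flat (t : R) : R := if 0 < t then expR (- t^-1) else 0.

(* The combinations of the [t^-n * flat t], which are flat at 0. *)
Inductive flat_poly : (R -> R) -> Prop :=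
| flat_poly1 : flat_poly flat
| flat_polyV f : flat_poly f -> flat_poly (fun t => t^-1 * f t)
| flat_polyD f g c : flat_poly f -> flat_poly g -> flat_poly (fun t => f t + c * g t).

Lemma flat_poly_neg f : flat_poly f -> forall t, t <= 0 -> f t = 0.
Proof.
elim=> [|{}f _ IH|{}f g c _ IHf _ IHg] t t0; first by rewrite /flat ltNge t0.
  by rewrite IH// mulr0.
by rewrite IHf// IHg// mulr0 addr0.
Qed.

Lemma flat_poly_bound f : flat_poly f ->
  forall N, exists C, forall t, 0 < t -> `|f t| <= C * t ^+ N.
Proof.
elim=> [N|{}f _ IH N|{}f g c _ IHf _ IHg N].
(* The exponential bound is used at y = 1 / t. *)
- have [C hC] := @expR_poly_bound R 0 1 N (lexx 0) ltr01.
  exists C => t t0; rewrite /flat t0 ger0_norm ?expR_ge0//.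
  rewrite -ler_pdivrMr ?exprn_gt0// mulrC -exprVn.
  have := hC t^-1; rewrite invr_ge0 (ltW t0) => /(_ isT); rewrite mul1r.
  by rewrite add0r mulrC.
- have [C hC] := IH N.+1; exists C => t t0.
  rewrite normrM normfV (ger0_norm (ltW t0)) mulrC ler_pdivrMr// -mulrA -exprSr.
  exact: hC.
- have [C hC] := IHf N; have [C' hC'] := IHg N; exists (C + `|c| * C') => t t0.
  apply: (le_trans (ler_normD _ _)); rewrite mulrDl lerD ?hC// normrM -mulrA.
  by rewrite ler_wpM2l// hC'.
Qed.

Lemma flat_poly_is_derive0 f : flat_poly f -> is_derive (0 : R) 1 f 0.
Proof.
move=> ff; have [C hC] := flat_poly_bound ff 2.
have f0 : f 0 = 0 by rewrite (flat_poly_neg ff).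
apply: (@is_derive_quadratic _ _ _ _ _ _ `|C|) => h _.
rewrite addr0 f0 subr0 mulr0 subr0 [h%:A]mulr1.
have [h0|h0] := leP h 0; first by rewrite (flat_poly_neg ff)// normr0 mulr_ge0// sqr_ge0.
by rewrite (le_trans (hC h h0))// ler_wpM2r ?sqr_ge0// ler_norm.
Qed.

Lemma flat_poly_derive f : flat_poly f ->
  exists2 g, flat_poly g & forall t : R, is_derive t 1 f (g t).
Proof.
elim=> [|{}f ff [g fg dfg]|{}f g c ff [f' ff' df] fg [g' fg' dg]].
- exists (fun t => t^-1 * (t^-1 * flat t)); first by do 2 apply: flat_polyV; exact: flat_poly1.
  move=> t; have [t0|t0|->] := ltgtP t 0; last first.
  (* The convention 0^-1 = 0 makes the formula for the derivative correct at 0 as well. *)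
  + by rewrite invr0 mul0r; exact: flat_poly_is_derive0 flat_poly1.
  + have d1 : is_derive t 1 (fun s : R => - s^-1) (t^-1 * t^-1).
      have := @is_deriveV R id t 1 1 (lt0r_neq0 t0) (is_derive_id _ _) => ?.
      apply: is_derive_eq; rewrite /GRing.scale/= mulr1 opprK expr2 invfM//.
    have D := @is_derive1_comp R expR (fun s => - s^-1) t _ _ (is_derive_expR (- t^-1)) d1.
    have -> : t^-1 * (t^-1 * flat t) = expR (- t^-1) * (t^-1 * t^-1).
      by rewrite /flat t0 mulrCA mulrA mulrC mulrA.
    apply: near_eq_is_derive D; near=> s; rewrite /flat ifT//; near: s; exact: lt_nbhsr.
  + rewrite (flat_poly_neg flat_poly1 (ltW t0)) !mulr0.
    have D := is_derive_cst (0 : R) t 1.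
    apply: near_eq_is_derive D; near=> s.
    rewrite (flat_poly_neg flat_poly1)//; apply/ltW; near: s; exact: lt_nbhsl.
- exists (fun t => t^-1 * g t + (-1) * (t^-1 * (t^-1 * f t))).
    by apply: flat_polyD; do ?apply: flat_polyV.
  move=> t; have [->|tn0] := eqVneq t 0.
    rewrite invr0 !mul0r mulr0 addr0; exact: flat_poly_is_derive0 (flat_polyV ff).
  have := @is_deriveV R id t 1 1 tn0 (is_derive_id _ _) => ?.
  have := dfg t => ?; apply: is_derive_eq.
  by rewrite /GRing.scale/=; field.
- exists (fun t => f' t + c * g' t); first exact: flat_polyD.
  by move=> t; have := df t => ?; have := dg t => ?; exact: is_deriveD _ (is_deriveZ _ _).
Unshelve. all: by end_near. Qed.

Lemma smooth1_coind (P : (R -> R) -> Prop) :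
  (forall f, P f -> exists2 g, P g & forall t : R, is_derive t 1 f (g t)) ->
  forall f, P f -> smooth1 f.
Proof.
move=> HP f Pf.
have /choice[D hD] : forall f, exists g, P f -> P g /\ forall t : R, is_derive t 1 f (g t).
  by move=> h; have [/HP[g Pg dg]|nP] := pselect (P h); [exists g|exists h => /nP].
exists (fun k => iter k D f); split=> // k t.
have PH n : P (iter n D f) by elim: n => //= n /hD[].
exact: (hD _ (PH k)).2.
Qed.

Lemma smooth1_flat : smooth1 flat.
Proof. exact: (smooth1_coind flat_poly_derive flat_poly1). Qed.

Lemma smooth1_affine (h : R -> R) (a b : R) : smooth1 h -> smooth1 (fun t => h (a * t + b)).
Proof.
move=> [H [<- dH]]; exists (fun k t => a ^+ k * H k (a * t + b)); split.
  by apply/funext => t; rewrite expr0 mul1r.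
move=> k t; have d1 : is_derive t 1 (fun s : R => a * s + b) a.
  by apply: is_derive_eq; rewrite /GRing.scale/= mulr1 addr0.
have := is_deriveZ (a ^+ k) (@is_derive1_comp R (H k) (fun s => a * s + b) t _ _ (dH k (a * t + b)) d1).
by congr is_derive; rewrite /GRing.scale/= exprSr; ring.
Qed.

Lemma flat_ge0 t : 0 <= flat t.
Proof. by rewrite /flat; case: ifP => // _; exact: expR_ge0. Qed.

Lemma flat_le1 t : flat t <= 1.
Proof.
rewrite /flat; case: ifP => // t0.
by rewrite -expR0 ler_expR oppr_le0 invr_ge0 ltW.
Qed.

Lemma flat_ge t : 0 < t -> 1 - t^-1 <= flat t.
Proof. by move=> t0; rewrite /flat t0 expR_ge1Dx. Qed.

(* Converges to the indicator function of ]a, b]; the extra n in the second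
   factor makes the limit equal to 1 at b. *)
Definition step (a b : R) (n : nat) (t : R) : R :=
  flat (n%:R * t + - (n%:R * a)) * flat (- (n%:R ^+ 2) * t + (n%:R ^+ 2 * b + n%:R)).

Lemma step_ge0 a b n t : 0 <= step a b n t.
Proof. by rewrite mulr_ge0// flat_ge0. Qed.

Lemma step_le1 a b n t : step a b n t <= 1.
Proof. by rewrite mulr_ile1// ?flat_ge0// flat_le1. Qed.

(** The second factor vanishes from b + 1/(n+1) on, so the supports for all n lie in one compact
    interval. *)
Lemma step_out a b n t : ~~ (a <= t <= b + 1) -> step a b n.+1 t = 0.
Proof.
rewrite negb_and -!ltNge => /orP[ta|tb]; rewrite /step /flat.
  by rewrite ifF ?mul0r//; apply/negbTE; rewrite -leNgt -mulrBr pmulr_rle0// subr_le0 ltW.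
rewrite [X in _ * X]ifF ?mulr0//; apply/negbTE; rewrite -leNgt.
have n0 : 0 < n.+1%:R :> R by rewrite ltr0n.
have n1 : 1 <= n.+1%:R :> R by rewrite ler1n.
rewrite mulNr addrA [- _ + _]addrC -mulrBr expr2 -mulrA -[X in _ + X]mulr1 -mulrDr.
rewrite pmulr_rle0//; nra.
Qed.

Lemma step_cvg a b t : step a b n t @[n --> \oo] --> ((a < t <= b)%R%:R : R).
Proof.
have [ta|ta] := leP t a.
  rewrite (_ : (fun n => _) = cst 0); first exact: cvg_cst.
  apply/funext => n; rewrite /step /flat ifF ?mul0r//; apply/negbTE.
  by rewrite -leNgt -mulrBr mulr_ge0_le0// subr_le0.
have ta0 : 0 < t - a by rewrite subr_gt0.
have [tb|tb] := leP t b; rewrite ?andbT ?andbF/=; last first.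
  apply: cvg_near_cst; near=> n.
  have n0 : 0 < n%:R :> R by rewrite ltr0n; near: n; exists 1%N.
  rewrite /step [X in _ * X]/flat ifF ?mulr0//; apply/negbTE; rewrite -leNgt.
  rewrite mulNr addrA [- _ + _]addrC -mulrBr expr2 -mulrA -[X in _ + X]mulr1 -mulrDr.
  rewrite pmulr_rle0// -(opprB t b) mulrN addrC subr_le0 -ler_pdivrMr ?subr_gt0// div1r.
  near: n; exact: nbhs_infty_ger.
apply/cvgrPdist_le => e e0.
near=> n.
have n0 : 0 < n%:R :> R by rewrite ltr0n; near: n; exists 1%N.
set u := n%:R * t + - (n%:R * a); set v := - (n%:R ^+ 2) * t + (n%:R ^+ 2 * b + n%:R).
have u0 : 0 < u by rewrite /u -mulrBr mulr_gt0.
have vn : n%:R <= v.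
  by rewrite /v mulNr addrA [- _ + _]addrC -mulrBr lerDr mulr_ge0 ?sqr_ge0// subr_ge0.
have v0 := lt_le_trans n0 vn.
(* Since 1 - [flat t] <= 1 / t, the product of the two factors differs from 1 by at most 1 / u + 1 /
   v. *)
have uE : u^-1 <= e / 2.
  rewrite /u -mulrBr invfM -ler_pdivlMr ?invr_gt0//= invrK.
  rewrite invf_ple ?posrE ?mulr_gt0 ?divr_gt0//.
  near: n; exact: nbhs_infty_ger.
have vE : v^-1 <= e / 2.
  rewrite invf_ple ?posrE ?divr_gt0// (le_trans _ vn)//.
  near: n; exact: nbhs_infty_ger.
rewrite ger0_norm ?subr_ge0 ?step_le1// /step -/u -/v.
have := flat_ge u0; have := flat_ge v0; have := flat_le1 u; have := flat_le1 v.
have := flat_ge0 u; have := flat_ge0 v; set p := flat u; set q := flat v.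
move=> q0 p0 q1 p1 hq hp; nra.
Unshelve. all: by end_near. Qed.

Variable d : nat.
Local Notation leb := (lebesgue_Rd R d).
Local Notation T := (d.-tuple (measurableTypeR R)).
Local Notation V := 'rV[R]_d.

Definition bump (a b : 'I_d -> R) (n : nat) (x : V) : R :=
  \prod_(i < d) step (a i) (b i) n (x ord0 i).

Lemma smooth_bump a b n : smooth (bump a b n).
Proof.
apply: smooth_prod => i; apply: (smoothM (f := fun x => flat (n%:R * x ord0 i + - (n%:R * a i)))).
  exact: (smooth_coord i (smooth1_affine _ _ smooth1_flat)).
exact: (smooth_coord i (smooth1_affine _ _ smooth1_flat)).
Qed.

Definition closed_box (a b : 'I_d -> R) : set V :=
  [set x | forall i, `[a i, b i]%classic (x ord0 i)].

Lemma compact_closed_box a b : compact (closed_box a b).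
Proof. exact: (@rV_compact R d (fun i => `[a i, b i]%classic) (fun i => @segment_compact R _ _)). Qed.

Lemma bump_out a b n x : ~ closed_box a (fun i => b i + 1) x -> bump a b n.+1 x = 0.
Proof.
move=> /existsNP[i xi]; rewrite /bump (bigD1 i)//= step_out ?mul0r//.
by apply/negP => h; apply: xi; rewrite /= in_itv.
Qed.

Lemma bump_ge0 a b n x : 0 <= bump a b n x.
Proof. by apply: prodr_ge0 => i _; exact: step_ge0. Qed.

Lemma bump_le1 a b n x : bump a b n x <= 1.
Proof. by apply: prodr_ile1 => i _; rewrite step_ge0 step_le1. Qed.

Lemma bump_cvg a b (t : T) : bump a b n (vec t) @[n --> \oo] --> (\1_(box a b) t : R).
Proof.
rewrite (_ : \1_(box a b) t = \prod_(i < d) (a i < tnth t i <= b i)%R%:R); last first.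
  rewrite indicE; have [tb|tb] := boolP (t \in box a b).
    by rewrite big1// => i _; move: tb; rewrite inE => /(_ i) ->.
  move: tb; rewrite notin_setE => /existsNP[i /negP/negbTE ti].
  by rewrite (bigD1 i)//= ti mul0r.
rewrite /bump; elim: (index_enum _) => [|i s IH].
  rewrite big_nil; under eq_fun do rewrite big_nil; exact: cvg_cst.
rewrite big_cons; under eq_fun do rewrite big_cons vecE.
apply: cvgM => //; exact: step_cvg.
Qed.

Lemma Ccinfty_bump a b n : Ccinfty (fun x : V => (bump a b n.+1 x)%:C%C).
Proof.
split; first by split=> /=; [exact: smooth_bump|exact: smooth_cst].
exists (closed_box a (fun i => b i + 1)); first exact: compact_closed_box.
by move=> x /bump_out ->.
Qed.

Definition locally_ivec (h : V -> R) := mvec h /\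
  forall K : set V, compact K -> leb.-integrable (@vec R d @^-1` K) (EFin \o (h \o @vec R d)).

Lemma box_sub a b : box a b `<=` @vec R d @^-1` closed_box a (fun i => b i + 1).
Proof.
move=> t tb i /=; rewrite vecE in_itv/=; have /andP[/ltW -> /= h] := tb i.
by rewrite (le_trans h)// lerDl.
Qed.

Lemma integrable_box a b (h : V -> R) : locally_ivec h ->
  leb.-integrable (box a b) (EFin \o (h \o @vec R d)).
Proof.
move=> [mh hK]; have cK := @compact_closed_box a (fun i => b i + 1).
apply: integrableS (hK _ cK); [exact: measurable_vec_compact|exact: measurable_box|].
exact: box_sub.
Qed.

(** Dominated convergence on the compact box that contains the supports of all the bumps, where |h|
    is an integrable majorant. *)
Lemma integral_bump_cvg a b (h : V -> R) : locally_ivec h ->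
  (\int[leb]_t (h (vec t) * bump a b n.+1 (vec t))%:E)%E @[n --> \oo] -->
  (\int[leb]_(t in box a b) (h (vec t))%:E)%E.
Proof.
move=> [mh hK]; pose K := closed_box a (fun i => b i + 1).
have cK : compact K by exact: compact_closed_box.
have mK : measurable (@vec R d @^-1` K) by exact: measurable_vec_compact.
have mb := @measurable_box R d a b.
have E n : (\int[leb]_t (h (vec t) * bump a b n.+1 (vec t))%:E =
    \int[leb]_(t in @vec R d @^-1` K) (h (vec t) * bump a b n.+1 (vec t))%:E)%E.
  rewrite [RHS]integral_mkcond; apply: eq_integral => t _; rewrite patchE.
  case: ifPn => //; rewrite notin_setE => /bump_out -> ; by rewrite mulr0.
under eq_fun do rewrite E.
have -> : (\int[leb]_(t in box a b) (h (vec t))%:E =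
    \int[leb]_(t in @vec R d @^-1` K) (h (vec t) * \1_(box a b) t)%:E)%E.
  rewrite integral_mkcond [RHS]integral_mkcond; apply: eq_integral => t _; rewrite !patchE.
  rewrite indicE; case: ifPn => tb; last by rewrite mulr0; case: ifP.
  by rewrite mulr1 ifT// inE; apply: box_sub; rewrite inE in tb.
pose f n (t : T) := (h (vec t) * bump a b n.+1 (vec t))%:E.
pose f0 (t : T) := (h (vec t) * \1_(box a b) t)%:E.
have m1 n : measurable_fun (@vec R d @^-1` K) (f n).
  apply/measurable_EFinP; apply: measurable_funS (measurableT) _ _ => //.
  apply: measurable_funM => //; apply: mvec_cont; apply: smooth_continuous.
  exact: smooth_bump.
have m2 : measurable_fun (@vec R d @^-1` K) f0.
  apply/measurable_EFinP; apply: measurable_funS (measurableT) _ _ => //.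
  by apply: measurable_funM.
have lim : {ae leb, forall t, (@vec R d @^-1` K) t -> f n t @[n --> \oo] --> f0 t}.
  apply: aeW => t _; apply: cvg_EFin; first exact: nearW.
  apply: cvgM; first exact: cvg_cst.
  have := @bump_cvg a b t; by rewrite -(cvg_shiftn 1); under eq_fun do rewrite addn1.
have dom : {ae leb, forall t n, (@vec R d @^-1` K) t -> (`|f n t| <= `|(h (vec t))%:E|)%E}.
  apply: aeW => t n _; rewrite /= lee_fin normrM ler_piMr//.
  by rewrite ger0_norm ?bump_ge0// bump_le1.
have [_ _] := dominated_convergence mK m1 m2 lim (integrable_abse (hK _ cK)) dom.
exact.
Qed.

(** The bumps tend to indicators of boxes, so g and h have equal integrals over every box; the boxes
    form a generating pi-system. *)
Lemma ae_eq_of_tests (g h : V -> R) : locally_ivec g -> locally_ivec h ->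
  (forall a b n, Ivec (fun x => g x * bump a b n.+1 x) =
                 Ivec (fun x => h x * bump a b n.+1 x)) ->
  {ae leb, forall t, g (vec t) = h (vec t)}.
Proof.
move=> lg lh gh.
have fin k a b n : locally_ivec k ->
    (\int[leb]_t (k (vec t) * bump a b n.+1 (vec t))%:E =
     (Ivec (fun x => k x * bump a b n.+1 x))%:E)%E.
  move=> [mk kK]; rewrite IvecE//.
  pose K := closed_box a (fun i => b i + 1).
  have cK : compact K by exact: compact_closed_box.
  have iK : ivec (fun x => k x * \1_K x).
    have := kK _ cK; rewrite integrable_mkcond; last exact: measurable_vec_compact.
    congr (_.-integrable); apply/funext => t; rewrite patchE /= indicE.
    have -> : (t \in @vec R d @^-1` K) = (vec t \in K) by apply/idP/idP; rewrite !inE.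
    by case: ifP; rewrite ?mulr1 ?mulr0.
  have mb : mvec (bump a b n.+1) by apply: mvec_cont; apply: smooth_continuous; exact: smooth_bump.
  apply: ivec_le iK _; first exact: mvecM.
  move=> x; rewrite !normrM ler_wpM2l// indicE ger0_norm ?bump_ge0//.
  have [_|xK] := boolP (x \in K); first by rewrite normr1 bump_le1.
  by rewrite bump_out ?normr0//; move: xK; rewrite notin_setE.
have boxE a b : (\int[leb]_(t in box a b) (g (vec t))%:E =
    \int[leb]_(t in box a b) (h (vec t))%:E)%E.
  have c1 := integral_bump_cvg (a := a) (b := b) lg.
  have c2 := integral_bump_cvg (a := a) (b := b) lh.
  rewrite -(cvg_lim _ c1)// -(cvg_lim _ c2)//; congr (lim (_ @ \oo)).
  by apply/funext => n; rewrite !fin// gh.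
(* Local integrability forces a restriction to a bounded box B. Intersections with B are again
   boxes, and countably many such B cover the space. *)
have H N : {ae leb, forall t, box (fun=> - N%:R) (fun=> N%:R) t -> g (vec t) = h (vec t)}.
  set B := box _ _; pose f (t : T) := (g (vec t) - h (vec t))%:E.
  have mB : measurable B by exact: measurable_box.
  have fbox a b : (\int[leb]_(t in box a b) f t = 0)%E.
    rewrite integralB_EFin//; [|exact: measurable_box|exact: integrable_box|exact: integrable_box].
    rewrite boxE subee// integrable_fin_num//; [exact: measurable_box|exact: integrable_box].
  have fB : leb.-integrable setT (f \_ B).
    rewrite -integrable_mkcond//.
    have ig : leb.-integrable B (EFin \o (g \o @vec R d)) by exact: integrable_box.
    have ih : leb.-integrable B (EFin \o (h \o @vec R d)) by exact: integrable_box.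
    exact: (integrableB mB ig ih).
  have := @integrable_pi_system_ae0 _ _ _ leb (@boxes R d) (f \_ B)
    (@measurable_tupleE R d) (@boxesI R d) fB.
  rewrite -integral_mkcond fbox => /(_ erefl) H.
  have /H : forall A, boxes A -> (\int[leb]_(x in A) (f \_ B) x)%E = 0%E.
    move=> A bA; rewrite -integral_mkcondr.
    have bB : boxes B by exists (fun=> - N%:R), (fun=> N%:R).
    by have [a [b ->]] := boxesI bA bB; exact: fbox.
  rewrite /ae_eq; apply: filterS => t /(_ I); rewrite patchE => + tB.
  by rewrite ifT ?inE// => -[/eqP]; rewrite subr_eq0 => /eqP.
have := ae_foralln H; apply: filterS => t Ht.
have [M tM] : exists M : nat, forall j, `|tnth t j| < M%:R.
  exists (Num.truncn (\sum_(j < d) `|tnth t j|)).+1 => j.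
  apply: le_lt_trans (truncnS_gt _).
  by rewrite (bigD1 j)//= lerDl sumr_ge0.
apply: (Ht M) => i; have := tM i; rewrite ltr_norml => /andP[-> /ltW //].
Qed.

Lemma L1loc_Re (g : V -> R[i]) : L1loc g -> locally_ivec (fun x => complex.Re (g x)).
Proof. by move=> [mr _ K]; split=> // A /K[]. Qed.

Lemma L1loc_Im (g : V -> R[i]) : L1loc g -> locally_ivec (fun x => complex.Im (g x)).
Proof. by move=> [_ mi K]; split=> // A /K[]. Qed.

(** Pairing with real bumps separates the real and imaginary parts, to each of which the real
    statement applies. *)
Lemma has_fourier_unique (F : functional R d) (g h : V -> R[i]) :
  has_fourier F g -> has_fourier F h -> {ae leb, forall t, g (vec t) = h (vec t)}.
Proof.
move=> [lg Fg] [lh Fh].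
have E a b n : cintegral (fun x => g x * (bump a b n.+1 x)%:C%C) =
    cintegral (fun x => h x * (bump a b n.+1 x)%:C%C).
  by rewrite -Fg ?Fh//; exact: Ccinfty_bump.
have hRe (z : R[i]) (r : R) : complex.Re (z * r%:C%C) = complex.Re z * r.
  by case: z => u v /=; rewrite mulr0 subr0.
have hIm (z : R[i]) (r : R) : complex.Im (z * r%:C%C) = complex.Im z * r.
  by case: z => u v /=; rewrite mulr0 add0r.
have eqRe : {ae leb, forall t, complex.Re (g (vec t)) = complex.Re (h (vec t))}.
  apply: (ae_eq_of_tests (L1loc_Re lg) (L1loc_Re lh)) => a b n.
  have := congr1 (@complex.Re R) (E a b n); rewrite /cintegral /=.
  by under eq_Rintegral do rewrite hRe; under [RHS]eq_Rintegral do rewrite hRe.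
have eqIm : {ae leb, forall t, complex.Im (g (vec t)) = complex.Im (h (vec t))}.
  apply: (ae_eq_of_tests (L1loc_Im lg) (L1loc_Im lh)) => a b n.
  have := congr1 (@complex.Im R) (E a b n); rewrite /cintegral /=.
  by under eq_Rintegral do rewrite hIm; under [RHS]eq_Rintegral do rewrite hIm.
by apply: filterS2 eqRe eqIm => t; case: (g _) (h _) => [? ?] [? ?] /= -> ->.
Qed.

Lemma sqr_normc (z : R[i]) : Normc.normc z ^+ 2 = complex.Re z ^+ 2 + complex.Im z ^+ 2.
Proof. by case: z => u v /=; rewrite sqr_sqrtr// addr_ge0// sqr_ge0. Qed.

Lemma mvec_sqr_normc (g : V -> R[i]) : L1loc g -> mvec (fun x => Normc.normc (g x) ^+ 2).
Proof.
move=> [mr mi _]; rewrite (_ : (fun x => _) = fun x =>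
    complex.Re (g x) ^+ 2 + complex.Im (g x) ^+ 2); last first.
  by apply/funext => x; rewrite sqr_normc.
by apply: measurable_funD; apply: measurable_funX.
Qed.

Lemma fhatP (F : functional R d) g : has_fourier F g -> has_fourier F (fhat F).
Proof. by move=> Fg; exact: (xgetPex _ (ex_intro _ _ Fg)). Qed.

(** Allows norms to be computed from an explicit transform in place of the chosen representative. *)
Lemma weighted_normsqE (w : V -> R) (F : functional R d) g : mvec w ->
  has_fourier F g -> weighted_normsq w F =
  (\int[leb]_t (w (vec t) * Normc.normc (g (vec t)) ^+ 2)%:E)%E.
Proof.
move=> mw Fg; have Fh := fhatP Fg; apply: ae_eq_integral => //.
- by apply/measurable_EFinP; exact: (mvecM mw (mvec_sqr_normc (proj1 Fh))).
- by apply/measurable_EFinP; exact: (mvecM mw (mvec_sqr_normc (proj1 Fg))).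
- by apply: filterS (has_fourier_unique Fh Fg) => t -> _.
Qed.

End bump.

(** * Superposition of modes *)

Section mode_series.
Variables (R : realType) (d : nat).
Local Notation leb := (lebesgue_Rd R d).
Local Notation T := (d.-tuple (measurableTypeR R)).
Local Notation V := 'rV[R]_d.

Lemma mvecX f n : mvec f -> mvec (fun x : V => f x ^+ n).
Proof. by move=> mf; exact: measurable_funX. Qed.

Lemma mvecZ (a : R) f : mvec f -> mvec (fun x : V => a * f x).
Proof. by move=> mf; exact: (mvecM (f := fun=> a) (measurable_cst _) mf). Qed.

Lemma continuous_addr (u : V) : continuous (fun x : V => x + u).
Proof. by move=> x; apply: continuousD; [exact: cvg_id|exact: cst_continuous]. Qed.

Lemma continuous_gauss_shift (a : R) u : continuous (fun x : V => gauss a (x + u)).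
Proof. by move=> x; apply: continuous_comp; [exact: continuous_addr|exact: continuous_gauss]. Qed.

Lemma Ivec_cvg (f : nat -> V -> R) (f0 g : V -> R) :
  (forall n, mvec (f n)) -> mvec f0 -> ivec g ->
  {ae leb, forall t, f n (vec t) @[n --> \oo] --> f0 (vec t)} ->
  (forall n, {ae leb, forall t, `|f n (vec t)| <= g (vec t)}) ->
  Ivec (f n) @[n --> \oo] --> Ivec f0.
Proof.
move=> mf mf0 ig cf fg.
have m1 n : measurable_fun setT (fun t : T => (f n (vec t))%:E).
  by apply/measurable_EFinP; exact: mf.
have m2 : measurable_fun setT (fun t : T => (f0 (vec t))%:E).
  by apply/measurable_EFinP; exact: mf0.
have c : {ae leb, forall t, setT t -> (f n (vec t))%:E @[n --> \oo] --> (f0 (vec t))%:E}.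
  by apply: filterS cf => t ct _; apply: cvg_EFin => //; exact: nearW.
have dm : {ae leb, forall t n, setT t -> (`|(f n (vec t))%:E| <= (g (vec t))%:E)%E}.
  by apply: filterS (ae_foralln fg) => t ct n _; rewrite /= lee_fin; exact: ct.
have [i0 _ C] := dominated_convergence measurableT m1 m2 c ig dm.
have E0 : (\int[leb]_t (f0 (vec t))%:E = (Ivec f0)%:E)%E by rewrite IvecE.
rewrite E0 in C; exact: (fine_cvg C).
Qed.

(** The weights 2^(-n) with n = k + 1, so that the total is 1. *)
Definition half (k : nat) : R := 2^-1 ^+ k.+1.

Lemma half_gt0 k : 0 < half k.
Proof. by rewrite exprn_gt0. Qed.

Lemma half_sum_le1 n : \sum_(0 <= k < n) half k <= 1.
Proof.
rewrite (_ : \sum_(_ <= _ < _) _ = 1 - 2^-1 ^+ n) ?gerBl ?exprn_ge0//.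
elim: n => [|n IH]; first by rewrite big_geq// subrr.
by rewrite big_nat_recr//= IH /half exprS; field.
Qed.

(* Jensen, from [\sum w (a - S)^2 >= 0] with [S = \sum w a] *)
Lemma sqr_sum_le (I : Type) (r : seq I) (w a : I -> R) : (forall i, 0 <= w i) ->
  \sum_(i <- r) w i <= 1 -> (\sum_(i <- r) w i * a i) ^+ 2 <= \sum_(i <- r) w i * a i ^+ 2.
Proof.
move=> w0 w1; set S := \sum_(i <- r) w i * a i.
have : 0 <= \sum_(i <- r) w i * (a i - S) ^+ 2.
  by apply: sumr_ge0 => i _; rewrite mulr_ge0// sqr_ge0.
have -> m : \sum_(i <- r) w i * (a i - m) ^+ 2 =
    \sum_(i <- r) w i * a i ^+ 2 - 2 * m * S + m ^+ 2 * \sum_(i <- r) w i.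
  by rewrite /S !mulr_sumr -sumrB -big_split/=; apply: eq_bigr => i _; ring.
set P := \sum_(i <- r) w i * a i ^+ 2; set W := \sum_(i <- r) w i => h.
have : S ^+ 2 * W <= S ^+ 2 by rewrite ler_piMr// sqr_ge0.
by move: h; rewrite !expr2; lra.
Qed.

Variables (A rho : nat -> R) (v : nat -> V).
Hypotheses (A0 : forall n, 0 <= A n) (A1 : forall n, A n <= 1) (rho0 : forall n, 0 < rho n).

Definition mode_term k x : R := half k * A k * mode (rho k) (v k) x.
Definition mode_series x : R := limn (series (mode_term ^~ x)).

Definition hat_term k xi : R := half k * A k * mode_hat (rho k) (v k) xi.
(* [fine] sends the points of divergence, which form a null set, to 0. *)
Definition hat_series xi : R := fine (\sum_(k <oo) (hat_term k xi)%:E)%E.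

Lemma coef_ge0 k : 0 <= half k * A k.
Proof. by rewrite mulr_ge0// ltW// half_gt0. Qed.

Lemma coef_le k : half k * A k <= half k.
Proof. by rewrite ler_piMr// ltW// half_gt0. Qed.

Lemma norm_mode_le1 k x : `|mode (rho k) (v k) x| <= 1.
Proof.
rewrite normrM mulr_ile1//; last exact: normr_cos_le1.
rewrite ger0_norm ?expR_ge0// /gauss -expR0 ler_expR oppr_le0.
by rewrite mulr_ge0 ?dotvv_ge0// mulr_ge0 ?sqr_ge0// pi_ge0.
Qed.

Lemma norm_mode_term k x : `|mode_term k x| <= half k.
Proof.
rewrite normrM (ger0_norm (coef_ge0 _)) -[leRHS]mulr1.
by rewrite ler_pM ?coef_ge0 ?coef_le ?norm_mode_le1.
Qed.

Lemma cvg_half : cvgn (series half).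
Proof.
apply: nondecreasing_is_cvgn.
  by apply/nondecreasing_seqP => n; rewrite seriesSr lerDl ltW ?half_gt0.
by exists 1 => _ [n _ <-]; exact: half_sum_le1.
Qed.

Lemma cvg_mode_series x : series (mode_term ^~ x) n @[n --> \oo] --> mode_series x.
Proof.
apply: normed_cvg; apply: (series_le_cvg _ _ _ cvg_half) => n //=.
  exact/ltW/half_gt0.
exact: norm_mode_term.
Qed.

Lemma norm_mode_partial n x : `|series (mode_term ^~ x) n| <= 1.
Proof.
apply: (le_trans (ler_norm_sum _ _ _)); apply: le_trans (half_sum_le1 n).
by apply: ler_sum => i _; exact: norm_mode_term.
Qed.

Lemma norm_mode_series x : `|mode_series x| <= 1.
Proof.
have c : `|series (mode_term ^~ x) n| @[n --> \oo] --> `|mode_series x|.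
  by apply: cvg_norm; exact: cvg_mode_series.
rewrite -(cvg_lim _ c)//; apply: limr_le; first by apply/cvg_ex; eexists; exact: c.
by apply: nearW => n; exact: norm_mode_partial.
Qed.

Lemma rapid_partial n : rapid (fun x => series (mode_term ^~ x) n).
Proof.
have r k : rapid (mode_term k) by apply: rapidZ; exact: rapid_mode.
exact: (rapid_sum _ (r 0%N)).
Qed.

Lemma mvec_mode_series : mvec mode_series.
Proof.
apply: (@measurable_fun_cvg _ _ _ _ (fun n t => series (mode_term ^~ (vec t)) n)).
  by move=> n; apply: (mvec_cont (f := fun x => series (mode_term ^~ x) n)); exact: rapid_cont (rapid_partial n).
by move=> t _; exact: cvg_mode_series.
Qed.

Lemma mode_hat_ge0 k xi : 0 <= mode_hat (rho k) (v k) xi.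
Proof.
by rewrite mulr_ge0 ?divr_ge0 ?invr_ge0 ?exprn_ge0 ?(ltW (rho0 k))// addr_ge0 ?expR_ge0.
Qed.

Lemma hat_term_ge0 k xi : 0 <= hat_term k xi.
Proof. by rewrite mulr_ge0 ?coef_ge0 ?mode_hat_ge0. Qed.

Lemma continuous_mode_hat r (u : V) : continuous (mode_hat r u).
Proof.
apply: contM; first exact: cst_continuous.
by apply: contD; exact: continuous_gauss_shift.
Qed.

Lemma mvec_mode_hat r (u : V) : mvec (mode_hat r u).
Proof. by apply: mvec_cont; exact: continuous_mode_hat. Qed.

Lemma mvec_hat_term k : mvec (hat_term k).
Proof. by apply: mvecZ; exact: mvec_mode_hat. Qed.

Lemma integral_mode_hat k : (\int[leb]_t (mode_hat (rho k) (v k) (vec t))%:E = 1)%E.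
Proof.
have r0 : 0 < (rho k)^-1 by rewrite invr_gt0.
have mg (u : V) : measurable_fun setT (fun t : T => (gauss (pi / rho k ^+ 2) (vec t - u))%:E).
  have mg0 : mvec (fun x : V => gauss (pi / rho k ^+ 2) (x - u)).
    by apply: mvec_cont; exact: continuous_gauss_shift.
  by apply/measurable_EFinP; exact: mg0.
have E (u : V) : (\int[leb]_t (gauss (pi / rho k ^+ 2) (vec t - u))%:E = (rho k ^+ d)%:E)%E.
  by have := ge0_Ivec_gauss u r0; rewrite !exprVn invrK.
rewrite /mode_hat; under eq_integral do rewrite EFinM EFinD -[v k in X in (_ + X)%E]opprK.
rewrite ge0_integralZl//; last 3 first.
- exact: emeasurable_funD.
- by move=> t _; rewrite -EFinD lee_fin addr_ge0 ?expR_ge0.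
- by rewrite lee_fin divr_ge0 ?invr_ge0 ?exprn_ge0 ?(ltW (rho0 k)).
rewrite ge0_integralD//; last 2 first.
- by move=> t _; rewrite lee_fin expR_ge0.
- by move=> t _; rewrite lee_fin expR_ge0.
rewrite !E -EFinD -EFinM; congr EFin; field.
by rewrite expf_neq0// gt_eqF.
Qed.

Lemma integral_hat_term k : (\int[leb]_t (hat_term k (vec t))%:E = (half k * A k)%:E)%E.
Proof.
rewrite /hat_term; under eq_integral do rewrite EFinM.
rewrite ge0_integralZl//; last 3 first.
- by apply/measurable_EFinP; exact: mvec_mode_hat.
- by move=> t _; rewrite lee_fin mode_hat_ge0.
- by rewrite lee_fin coef_ge0.
by rewrite integral_mode_hat mule1.
Qed.

Let S (t : T) : \bar R := (\sum_(k <oo) (hat_term k (vec t))%:E)%E.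

Lemma hat_sum_ge0 t : (0 <= S t)%E.
Proof. by apply: nneseries_ge0 => k _ _; rewrite lee_fin hat_term_ge0. Qed.

Lemma measurable_hat_sum : measurable_fun setT S.
Proof.
apply: (@ge0_emeasurable_sum _ _ _ _ (fun k t => (hat_term k (vec t))%:E) predT).
  by move=> k t _ _; rewrite lee_fin hat_term_ge0.
by move=> k _; apply/measurable_EFinP; exact: mvec_hat_term.
Qed.

Lemma nneseries_half_le (a : nat -> \bar R) (C : R) : 0 <= C -> (forall k, 0 <= a k)%E ->
  (forall k, a k <= (half k * C)%:E)%E -> (\sum_(k <oo) a k <= C%:E)%E.
Proof.
move=> C0 a0 aC; apply: lime_le; first exact: is_cvg_nneseries.
apply: nearW => n; apply: (@le_trans _ _ (\sum_(0 <= k < n) (half k * C)%:E)%E).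
  by apply: lee_sum => k _; exact: aC.
by rewrite sumEFin lee_fin -mulr_suml ler_piMl// half_sum_le1.
Qed.

(** The k-th term has mass [half k * A k], at most [half k], so the total mass is at most 1. *)
Lemma integrable_hat_sum : leb.-integrable setT S.
Proof.
apply/integrableP; split; first exact: measurable_hat_sum.
under eq_integral do rewrite gee0_abs ?hat_sum_ge0//.
rewrite integral_nneseries//; last 2 first.
- by move=> k; apply/measurable_EFinP; exact: mvec_hat_term.
- by move=> k t _; rewrite lee_fin hat_term_ge0.
apply: (@le_lt_trans _ _ 1%:E); last exact: ltry.
apply: nneseries_half_le => // k; rewrite integral_hat_term lee_fin ?coef_ge0//.
by rewrite mulr1 coef_le.
Qed.

Lemma hat_sum_fin : {ae leb, forall t, S t \is a fin_num}.
Proof. by apply: filterS (integrable_ae measurableT integrable_hat_sum) => t; exact. Qed.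

Lemma mvec_hat_series : mvec hat_series.
Proof. by apply: (measurableT_comp (f := fine)) measurable_hat_sum; exact: fine_measurable. Qed.

Lemma hat_series_ge0 xi : 0 <= hat_series xi.
Proof. by apply: fine_ge0; apply: nneseries_ge0 => k _ _; rewrite lee_fin hat_term_ge0. Qed.

Lemma ivec_hat_series : ivec hat_series.
Proof.
apply: le_integrable integrable_hat_sum => //.
  by apply/measurable_EFinP; exact: mvec_hat_series.
move=> t _; rewrite /= ger0_norm ?hat_series_ge0// gee0_abs ?hat_sum_ge0//.
by rewrite /hat_series -/(S t); case: (S t) (hat_sum_ge0 t) => //= ?; rewrite leey.
Qed.

Lemma hat_partial_le t n : S t \is a fin_num ->
  series (hat_term ^~ (vec t)) n <= hat_series (vec t).
Proof.
move=> fS; rewrite -lee_fin fineK// -sumEFin.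
by apply: nneseries_lim_ge => k _ _; rewrite lee_fin hat_term_ge0.
Qed.

Lemma cvg_hat_series t : S t \is a fin_num ->
  series (hat_term ^~ (vec t)) n @[n --> \oo] --> hat_series (vec t).
Proof.
move=> fS; have c : (\sum_(0 <= k < n) (hat_term k (vec t))%:E)%E @[n --> \oo] --> S t.
  by apply: is_cvg_nneseries => k _ _; rewrite lee_fin hat_term_ge0.
have SE : S t = (hat_series (vec t))%:E by rewrite fineK.
rewrite SE in c; rewrite (_ : series _ = fine \o (fun n => \sum_(0 <= k < n) (hat_term k (vec t))%:E)%E).
  exact: fine_cvg c.
by apply/funext => n; rewrite /= sumEFin.
Qed.

(** The identity holds for partial sums by [mode_pairing]. Both sides pass to the limit by dominated
    convergence: the partial sums of the modes are bounded by 1, and those of the transforms by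
    their integrable limit. *)
Lemma mode_series_pairing p q : rapid p -> rapid q ->
  Ivec (fun x => mode_series x * ftr p q x) = Ivec (fun x => hat_series x * p x).
Proof.
move=> rp rq; have rA := rapid_ftr rp rq.
have mA := mvec_cont (rapid_cont rA); have mp := mvec_cont (rapid_cont rp).
have c1 : Ivec (fun x => series (mode_term ^~ x) n * ftr p q x) @[n --> \oo] -->
    Ivec (fun x => mode_series x * ftr p q x).
  apply: (Ivec_cvg (g := fun x => `|ftr p q x|)).
  - by move=> n; exact: (mvecM (mvec_cont (rapid_cont (rapid_partial n))) mA).
  - exact: mvecM mvec_mode_series mA.
  - exact: ivec_norm (rapid_ivec rA).
  - by apply: aeW => t; apply: cvgM; [exact: cvg_mode_series|exact: cvg_cst].
  - by move=> n; apply: aeW => t; rewrite normrM ler_piMl// norm_mode_partial.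
have [M pM] : exists M, forall x, `|p x| <= M.
  have [C hC] := rapid_bound 0 rp; exists C => x.
  by have := hC x; rewrite expr0 mul1r.
have c2 : Ivec (fun x => series (hat_term ^~ x) n * p x) @[n --> \oo] -->
    Ivec (fun x => hat_series x * p x).
  apply: (Ivec_cvg (g := fun x => M * hat_series x)).
  - move=> n; apply: (mvecM (f := fun x => series (hat_term ^~ x) n) _ mp).
    by apply: measurable_sum => k; exact: mvec_hat_term.
  - exact: mvecM mvec_hat_series mp.
  - exact: ivecZ ivec_hat_series.
  - by apply: filterS hat_sum_fin => t fS; apply: cvgM; [exact: cvg_hat_series|exact: cvg_cst].
  - move=> n; apply: filterS hat_sum_fin => t fS; rewrite normrM mulrC.
    rewrite ler_pM// ger0_norm ?hat_partial_le// sumr_ge0// => k _; exact: hat_term_ge0.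
have E n : Ivec (fun x => series (mode_term ^~ x) n * ftr p q x) =
    Ivec (fun x => series (hat_term ^~ x) n * p x).
  rewrite (_ : (fun x => _) = fun x => \sum_(0 <= k < n) mode_term k x * ftr p q x); last first.
    by apply/funext => x; rewrite mulr_suml.
  rewrite (_ : (fun x => _ * p x) = fun x => \sum_(0 <= k < n) hat_term k x * p x); last first.
    by apply/funext => x; rewrite mulr_suml.
  have i1 k : ivec (fun x => mode (rho k) (v k) x * ftr p q x).
    apply: (ivec_le _ (rapid_ivec rA)).
      exact: (mvecM (mvec_cont (rapid_cont (rapid_mode _ (rho0 k)))) mA).
    by move=> x; rewrite normrM ler_piMl// norm_mode_le1.
  have i2 k : ivec (fun x => mode_hat (rho k) (v k) x * p x).
    apply: (ivecMb (M := M)) => //.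
    apply: ivec_ge0P; [exact: mvec_mode_hat|exact: mode_hat_ge0|].
    by rewrite integral_mode_hat ltry.
  have -> : (fun x => \sum_(0 <= k < n) mode_term k x * ftr p q x) =
     (fun x => \sum_(0 <= k < n) half k * A k * (mode (rho k) (v k) x * ftr p q x)).
    by apply/funext => x; apply: eq_bigr => k _; rewrite mulrA.
  have -> : (fun x => \sum_(0 <= k < n) hat_term k x * p x) =
     (fun x => \sum_(0 <= k < n) half k * A k * (mode_hat (rho k) (v k) x * p x)).
    by apply/funext => x; apply: eq_bigr => k _; rewrite mulrA.
  have [_ ->] := Ivec_sum (index_iota 0 n) (fun k => ivecZ (half k * A k) (i1 k)).
  have [_ ->] := Ivec_sum (index_iota 0 n) (fun k => ivecZ (half k * A k) (i2 k)).
  by apply: eq_bigr => k _; rewrite !IvecZ// mode_pairing.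
rewrite -(cvg_lim _ c1)// -(cvg_lim _ c2)//; congr (lim (_ @ \oo)).
exact/funext.
Qed.

Lemma mode_series_has_fourier :
  has_fourier (of_function mode_series) (fun x => (hat_series x)%:C%C).
Proof.
exact: (of_function_has_fourier ivec_hat_series mode_series_pairing).
Qed.

Section weight.
Variables (w : V -> R) (w0 : forall x, 0 <= w x) (mw : mvec w).

Lemma mode_series_weighted : weighted_normsq w (of_function mode_series) =
  (\int[leb]_t (w (vec t) * hat_series (vec t) ^+ 2)%:E)%E.
Proof.
rewrite (weighted_normsqE mw mode_series_has_fourier).
by apply: eq_integral => t _; rewrite sqr_normc /= expr0n addr0.
Qed.

(** Jensen's inequality for the weights [half k], used pointwise, bounds the squared series by the
    weighted sum of the squares; overlaps between different bumps need no estimate. *)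
Lemma mode_series_normsq_le (C : R) : 0 <= C ->
  (forall n, (\int[leb]_t (w (vec t) * (A n * mode_hat (rho n) (v n) (vec t)) ^+ 2)%:E <= C%:E)%E) ->
  (weighted_normsq w (of_function mode_series) <= C%:E)%E.
Proof.
move=> C0 wC; rewrite mode_series_weighted.
pose h k (t : T) := (w (vec t) * (A k * mode_hat (rho k) (v k) (vec t)) ^+ 2).
have mh k : measurable_fun setT (fun t => (h k t)%:E).
  by apply/measurable_EFinP; exact: (mvecM mw (mvecX 2 (mvecZ _ (mvec_mode_hat _ _)))).
have h0 k t : 0 <= h k t by rewrite mulr_ge0 ?sqr_ge0.
have mh' k : measurable_fun setT (fun t => (half k * h k t)%:E).
  under eq_fun do rewrite EFinM; exact: measurable_funeM.
have h0' k t : (0 <= (half k * h k t)%:E)%E by rewrite lee_fin mulr_ge0// ltW// half_gt0.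
apply: (@le_trans _ _ (\int[leb]_t \sum_(k <oo) (half k * h k t)%:E)%E).
  apply: ge0_le_integral => //.
  - by move=> t _; rewrite lee_fin mulr_ge0 ?sqr_ge0.
  - by apply/measurable_EFinP; exact: (mvecM mw (mvecX 2 mvec_hat_series)).
  - by apply: (@ge0_emeasurable_sum _ _ _ _ (fun k t => (half k * h k t)%:E) predT).
  (* Where the series diverges, [hat_series] is 0 and the inequality is trivial. *)
  move=> t _; have [fS|nfS] := boolP (S t \is a fin_num); last first.
    rewrite /hat_series -/(S t); move: nfS; rewrite ge0_fin_numE ?hat_sum_ge0// -leNgt leye_eq => /eqP ->.
    by rewrite expr0n mulr0 nneseries_ge0.
  have c : (w (vec t) * series (hat_term ^~ (vec t)) n ^+ 2)%:E @[n --> \oo] -->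
      (w (vec t) * hat_series (vec t) ^+ 2)%:E.
    apply: cvg_EFin; first exact: nearW.
    apply: cvgM; first exact: cvg_cst.
    have cS := cvg_hat_series fS; rewrite expr2.
    rewrite (_ : (fun n => _) = series (hat_term ^~ (vec t)) \* series (hat_term ^~ (vec t))).
      by apply: cvgM; exact: cS.
    by apply/funext => n; rewrite expr2.
  rewrite -(cvg_lim _ c)//; apply: lime_le; first by apply/cvg_ex; eexists; exact: c.
  apply: nearW => n; apply: le_trans (nneseries_lim_ge n _); last by move=> k _ _.
  rewrite sumEFin lee_fin.
  rewrite (eq_bigr (fun k => w (vec t) * (half k * (A k * mode_hat (rho k) (v k) (vec t)) ^+ 2))); last first.
    by move=> k _; rewrite /h mulrCA.
  rewrite -mulr_sumr ler_wpM2l// /series /= /hat_term.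
  under eq_bigr do rewrite -mulrA.
  by apply: sqr_sum_le; [move=> k; exact/ltW/half_gt0|exact: half_sum_le1].
rewrite integral_nneseries//.
apply: nneseries_half_le => // k; first exact: integral_ge0.
under eq_integral do rewrite EFinM.
rewrite ge0_integralZl//; last 2 first.
- by move=> t _; rewrite lee_fin.
- by rewrite lee_fin ltW// half_gt0.
by rewrite EFinM; apply: lee_wpmul2l; [rewrite lee_fin ltW// half_gt0|exact: wC].
Qed.

(** All terms of the transformed series are nonnegative, so its sum dominates each of them. *)
Lemma mode_series_normsq_ge k :
  (\int[leb]_t (w (vec t) * (half k * A k * mode_hat (rho k) (v k) (vec t)) ^+ 2)%:E <=
   weighted_normsq w (of_function mode_series))%E.
Proof.
rewrite mode_series_weighted; apply: ae_ge0_le_integral => //.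
- by move=> t _; rewrite lee_fin mulr_ge0 ?sqr_ge0.
- by apply/measurable_EFinP; exact: (mvecM mw (mvecX 2 (mvec_hat_term k))).
- by move=> t _; rewrite lee_fin mulr_ge0 ?sqr_ge0.
- by apply/measurable_EFinP; exact: (mvecM mw (mvecX 2 mvec_hat_series)).
apply: filterS hat_sum_fin => t fS _; rewrite lee_fin ler_wpM2l// lerXn2r ?nnegrE ?hat_series_ge0//.
  exact: hat_term_ge0.
apply: le_trans (hat_partial_le k.+1 fS); rewrite seriesSr lerDr.
by apply: sumr_ge0 => i _; exact: hat_term_ge0.
Qed.

End weight.

End mode_series.

(** * Continuity and differentiation of series with geometric weights *)

Section half_series.
Variables (R : realType) (d : nat).
Local Notation V := 'rV[R]_d.
Local Notation half := (@half R).

Definition half_series (m : nat -> V -> R) x : R :=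
  limn (series (fun k => half k * m k x)).

Lemma norm_lim_le (u : nat -> R) (l C : R) : u n @[n --> \oo] --> l ->
  (forall n, `|u n| <= C) -> `|l| <= C.
Proof.
move=> ul uC; have c : `|u n| @[n --> \oo] --> `|l| by exact: cvg_norm ul.
rewrite -(cvg_lim _ c)//; apply: limr_le; first by apply/cvg_ex; eexists; exact: c.
exact: nearW.
Qed.

Lemma half_partial_le (a : nat -> R) (C : R) n : 0 <= C -> (forall k, `|a k| <= C) ->
  `|series (fun k => half k * a k) n| <= C.
Proof.
move=> C0 aC; apply: (le_trans (ler_norm_sum _ _ _)).
apply: (@le_trans _ _ (\sum_(0 <= k < n) half k * C)).
  by apply: ler_sum => k _; rewrite normrM ger0_norm ?ler_wpM2l// ltW// half_gt0.
by rewrite -mulr_suml ler_piMl// half_sum_le1.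
Qed.

Lemma cvg_half_series (m : nat -> V -> R) (C : R) x : (forall k, `|m k x| <= C) ->
  series (fun k => half k * m k x) n @[n --> \oo] --> half_series m x.
Proof.
move=> mC; have C0 : 0 <= C by exact: le_trans (mC 0%N).
apply: normed_cvg; apply: (@series_le_cvg _ _ (fun k => C * half k)) => [n|n|n|].
- exact: normr_ge0.
- by rewrite mulr_ge0// ltW// half_gt0.
- by rewrite /= normrM ger0_norm ?(ltW (half_gt0 _ _))// mulrC ler_wpM2r// ltW// half_gt0.
- rewrite (_ : series _ = (fun n => C * series half n)).
    by apply: is_cvgMr; exact: cvg_half.
  by apply/funext => n; rewrite /series /= mulr_sumr.
Qed.

Lemma half_series_tail (m : nat -> V -> R) (C : R) x N : (forall k, `|m k x| <= C) ->
  `|half_series m x - series (fun k => half k * m k x) N| <= C * 2^-1 ^+ N.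
Proof.
move=> mC; have C0 : 0 <= C by exact: le_trans (mC 0%N).
have c : series (fun k => half k * m k x) (n + N)%N - series (fun k => half k * m k x) N
    @[n --> \oo] --> half_series m x - series (fun k => half k * m k x) N.
  apply: cvgB; last exact: cvg_cst.
  by have := cvg_half_series mC; rewrite -(cvg_shiftn N).
apply: norm_lim_le c _ => n.
rewrite sub_series_geq ?leq_addl//.
rewrite -{1}(add0n N) big_addn addnK.
(* As half(k + N) = half(k) 2^(-N), the tail is again a series with these weights, whose terms are
   smaller by the factor 2^(-N). *)
rewrite (eq_bigr (fun k => half k * (2^-1 ^+ N * m (k + N)%N x))); last first.
  by move=> k _; rewrite /half -addSn exprD mulrA.
apply: half_partial_le => [|k]; first by rewrite mulr_ge0// exprn_ge0.
by rewrite normrM mulrC [`|2^-1 ^+ N|]ger0_norm ?exprn_ge0// ler_wpM2r ?exprn_ge0.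
Qed.

Lemma half_pow_small (C e : R) : 0 <= C -> 0 < e -> exists N, C * 2^-1 ^+ N < e.
Proof.
move=> C0 e0; exists (Num.truncn (C / e)).+1.
rewrite exprVn ltr_pdivrMr ?exprn_gt0// mulrC -ltr_pdivrMr//.
apply: (lt_le_trans (truncnS_gt _)); rewrite -natrX ler_nat.
exact/ltnW/ltn_expl.
Qed.

Lemma continuous_half_series (m : nat -> V -> R) (C : R) : (forall k, continuous (m k)) ->
  (forall k x, `|m k x| <= C) -> continuous (half_series m).
Proof.
move=> cm mC x; have C0 : 0 <= C by exact: le_trans (mC 0%N 0).
have FF : Filter (nbhs (x : V)) := nbhs_filter (x : V).
apply: (proj2 (@cvgrPdist_le _ _ _ (nbhs (x : V)) FF (half_series m) (half_series m x))).
move=> e e0; have e3 : 0 < e / 3 by rewrite divr_gt0.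
have [N hN] := half_pow_small C0 e3.
have cS : continuous (fun y => series (fun k => half k * m k y) N).
  apply: continuous_sum => k; apply: (contM (f := fun=> half k)) => //.
  exact: cst_continuous.
have := cS x => /(proj1 (@cvgrPdist_le _ _ _ (nbhs (x : V)) FF _ _)) /(_ _ e3).
apply: filterS => y; set Sx := series _ N; set Sy := series _ N => Sxy.
have hx := @half_series_tail m C x N (fun k => mC k x).
have hy := @half_series_tail m C y N (fun k => mC k y).
rewrite -/Sx in hx; rewrite -/Sy in hy.
have -> : half_series m x - half_series m y =
  (half_series m x - Sx) + (Sx - Sy) + (Sy - half_series m y) by ring.
apply: (le_trans (ler_normD _ _)); apply: (le_trans (lerD (ler_normD _ _) (lexx _))).
rewrite [X in _ + X]distrC; move: hx hy Sxy hN; lra.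
Qed.

(** A bound on the second derivatives uniform in k gives each term the remainder C2 h^2. The weights
    sum to at most 1, so the series inherits it. *)
Lemma is_derive_half_series (m m1 m2 : nat -> V -> R) (v x : V) (C C1 C2 : R) :
  (forall k x, is_derive x v (m k) (m1 k x)) ->
  (forall k x, is_derive x v (m1 k) (m2 k x)) ->
  (forall k x, `|m k x| <= C) -> (forall k x, `|m1 k x| <= C1) ->
  (forall k x, `|m2 k x| <= C2) ->
  is_derive x v (half_series m) (half_series m1 x).
Proof.
move=> dm dm1 mC mC1 mC2; apply: (@is_derive_quadratic _ _ _ _ _ _ C2) => h _.
pose S n y := series (fun k => half k * m k y) n.
have c : S n (h *: v + x) - S n x - h * series (fun k => half k * m1 k x) n @[n --> \oo] -->
    half_series m (h *: v + x) - half_series m x - h * half_series m1 x.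
  apply: cvgB; first by apply: cvgB; apply: cvg_half_series => k; exact: mC.
  by apply: cvgM; [exact: cvg_cst|apply: cvg_half_series => k; exact: mC1].
apply: norm_lim_le c _ => n.
rewrite /S /series /= mulr_sumr -!sumrB.
rewrite (eq_bigr (fun k => half k * (m k (h *: v + x) - m k x - h * m1 k x))); last first.
  by move=> k _; ring.
have C20 : 0 <= C2 by exact: le_trans (mC2 0%N x).
apply: half_partial_le => [|k]; first by rewrite mulr_ge0// sqr_ge0.
have := @taylor2_le _ (fun s => m k (s *: v + x)) (fun s => m1 k (s *: v + x))
  (fun s => m2 k (s *: v + x)) C2 h.
rewrite scale0r add0r; apply.
- by move=> s; exact: is_derive_line.
- by move=> s; exact: is_derive_line.
- by move=> s _; exact: mC2.
Qed.

End half_series.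

(** * Smoothness of the superposition and decay of its derivatives *)

Section mode_series_smooth.
Variables (R : realType) (d : nat).
Local Notation V := 'rV[R]_d.
Local Notation e_ := (@basis_vec R d).
Variables (rho : nat -> R) (v : nat -> V).
Hypotheses (rho0 : forall k, 0 < rho k) (rho1 : forall k, rho k <= 1).
Hypothesis v1 : forall k i, `|v k ord0 i| <= 1.

(* Closed under derivation, with bounds uniform in k: each derivative brings
   out a bounded factor or a factor [rho k * x_j], and the Gaussian is a
   function of [rho k *: x]. *)
Inductive mode_poly : (nat -> V -> R) -> Prop :=
| mode_poly_cos : mode_poly (fun k => mode (rho k) (v k))
| mode_poly_sin : mode_poly (fun k x => gauss (pi * rho k ^+ 2) x * sin (phase x (v k)))
| mode_polyM j m : mode_poly m -> mode_poly (fun k x => rho k * x ord0 j * m k x)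
| mode_polyZ a (C : R) m : (forall k, `|a k| <= C) -> mode_poly m ->
    mode_poly (fun k x => a k * m k x)
| mode_polyD m1 m2 : mode_poly m1 -> mode_poly m2 -> mode_poly (fun k x => m1 k x + m2 k x).

Lemma rho_l1_ge1 k (x : V) : 1 <= 1 + rho k * l1norm x.
Proof. by rewrite lerDl mulr_ge0 ?l1norm_ge0// ltW. Qed.

(** The left side depends on rho_k x alone, hence a constant uniform in k. *)
Lemma gauss_weight_bound N : exists C : R, forall k (x : V),
  (1 + rho k * l1norm x) ^+ N * gauss (pi * rho k ^+ 2) x <= C.
Proof.
have [C hC] := @expR_poly_bound R (1 + d%:R) pi N (addr_ge0 ler01 (ler0n _ _)) (pi_gt0 _).
exists C => k x; have := hC (rho k ^+ 2 * dotv x x).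
rewrite mulr_ge0 ?sqr_ge0 ?dotvv_ge0// => /(_ isT); apply: le_trans.
rewrite /gauss mulrA ler_wpM2r ?expR_ge0//.
have h := l1norm_le_dotvv (rho k *: x).
rewrite l1normZ dotvZl dotvZr mulrA -expr2 ger0_norm ?(ltW (rho0 k))// in h.
rewrite lerXn2r ?nnegrE ?(le_trans _ (rho_l1_ge1 _ _))//.
  by apply: addr_ge0; [apply: addr_ge0|apply: mulr_ge0; [exact: sqr_ge0|exact: dotvv_ge0]].
by rewrite -addrA lerD2l.
Qed.

Lemma mode_poly_bound m : mode_poly m -> forall N, exists C, forall k x,
  (1 + rho k * l1norm x) ^+ N * `|m k x| <= C.
Proof.
have pw k (x : V) N : 0 <= (1 + rho k * l1norm x) ^+ N.
  by rewrite exprn_ge0// (le_trans ler01)// rho_l1_ge1.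
elim=> {m} [N|N|j m _ IH N|a A m aA _ IH N|m1 m2 _ IH1 _ IH2 N].
- have [C hC] := gauss_weight_bound N; exists C => k x; apply: le_trans (hC k x).
  rewrite normrM ler_wpM2l// [`|gauss _ _|]ger0_norm ?expR_ge0//.
  by rewrite ler_piMr ?expR_ge0// normr_cos_le1.
- have [C hC] := gauss_weight_bound N; exists C => k x; apply: le_trans (hC k x).
  rewrite normrM ler_wpM2l// [`|gauss _ _|]ger0_norm ?expR_ge0//.
  by rewrite ler_piMr ?expR_ge0// normr_sin_le1.
- have [C hC] := IH N.+1; exists C => k x; apply: le_trans (hC k x).
  rewrite exprSr -[leRHS]mulrA ler_wpM2l// normrM ler_wpM2r// normrM ger0_norm ?(ltW (rho0 k))//.
  apply: (@le_trans _ _ (rho k * l1norm x)); last by rewrite lerDr.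
  by rewrite ler_wpM2l ?coord_le_l1norm// ltW.
- have [C hC] := IH N; exists (A * C) => k x.
  by rewrite normrM mulrCA ler_pM// mulr_ge0.
- have [C hC] := IH1 N; have [C' hC'] := IH2 N; exists (C + C') => k x.
  apply: le_trans (lerD (hC k x) (hC' k x)).
  by rewrite -mulrDr ler_wpM2l// ler_normD.
Qed.

Lemma mode_poly_le m : mode_poly m -> exists C, forall k x, `|m k x| <= C.
Proof.
move=> /mode_poly_bound /(_ 0%N)[C hC]; exists C => k x.
by have := hC k x; rewrite expr0 mul1r.
Qed.

Lemma mode_poly_cont m : mode_poly m -> forall k, continuous (m k).
Proof.
elim=> {m} [k|k|j m _ IH k|a A m aA _ IH k|m1 m2 _ IH1 _ IH2 k].
- apply: contM; first exact: continuous_gauss.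
  by move=> x; apply: continuous_comp; [exact: continuous_phase|exact: continuous_cos].
- apply: contM; first exact: continuous_gauss.
  by move=> x; apply: continuous_comp; [exact: continuous_phase|exact: continuous_sin].
- apply: (contM (f := fun x => rho k * x ord0 j)); last exact: IH.
  apply: (contM (f := fun=> rho k)); first exact: cst_continuous.
  exact: coord_continuous.
- by apply: (contM (f := fun=> a k)); [exact: cst_continuous|exact: IH].
- exact: contD (IH1 k) (IH2 k).
Qed.

Lemma mode_poly_derive m i : mode_poly m -> exists2 m', mode_poly m' &
  forall k x, is_derive x (e_ i) (m k) (m' k x).
Proof.
have dv u : dotv (e_ i) u = u ord0 i by rewrite dotvC dotv_basis.
have pi0 := pi_ge0 R.
have bnd1 k : `|- (2 * pi * rho k)| <= 2 * pi.
  rewrite normrN ger0_norm ?mulr_ge0 ?(ltW (rho0 k))// ler_piMr// mulr_ge0//.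
have bnd2 k : `|2 * pi * v k ord0 i| <= 2 * pi.
  by rewrite normrM ger0_norm ?mulr_ge0// ler_piMr// mulr_ge0.
have bnd3 k : `|- (2 * pi * v k ord0 i)| <= 2 * pi by rewrite normrN.
elim=> {m} [||j m pm [m' pm' dm]|a A m aA pm [m' pm' dm]|m1 m2 _ [m1' p1 d1] _ [m2' p2 d2]].
- eexists.
    exact: (mode_polyD (mode_polyZ bnd1 (mode_polyM i mode_poly_cos)) (mode_polyZ bnd3 mode_poly_sin)).
  move=> k x /=.
  have := is_derive_gauss (pi * rho k ^+ 2) (e_ i) x => ?.
  have := is_derive_cos_phase (v k) x (e_ i) => ?.
  apply: is_derive_eq; rewrite /mode /GRing.scale/= dotv_basis dv.
  by move: pi (cos _) (sin _) (gauss _ _) => P c s g; ring.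
- eexists.
    exact: (mode_polyD (mode_polyZ bnd1 (mode_polyM i mode_poly_sin)) (mode_polyZ bnd2 mode_poly_cos)).
  move=> k x /=.
  have := is_derive_gauss (pi * rho k ^+ 2) (e_ i) x => ?.
  have := is_derive_sin_phase (v k) x (e_ i) => ?.
  apply: is_derive_eq; rewrite /mode /GRing.scale/= dotv_basis dv.
  by move: pi (cos _) (sin _) (gauss _ _) => P c s g; ring.
- have bnd k : `|if i == j then rho k else 0| <= 1.
    by case: eqP => _; rewrite ?normr0// ger0_norm// ltW.
  exists (fun k (x : V) => rho k * x ord0 j * m' k x + (if i == j then rho k else 0) * m k x).
    exact: mode_polyD (mode_polyM j pm') (mode_polyZ bnd pm).
  move=> k x; have := dm k x => ?.
  have dj : is_derive x (e_ i) (fun y : V => rho k * y ord0 j) (if i == j then rho k else 0).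
    apply: (@is_derive_coord _ _ (fun t => rho k * t) (fun=> rho k)).
    by apply: is_derive_eq; rewrite /GRing.scale/= mulr1.
  by apply: is_derive_eq; rewrite /GRing.scale/= [m k x * _]mulrC.
- exists (fun k x => a k * m' k x); first exact: mode_polyZ aA pm'.
  by move=> k x; have := dm k x => ?; exact: is_deriveZ.
- exists (fun k x => m1' k x + m2' k x); first exact: mode_polyD.
  by move=> k x; have := d1 k x => ?; have := d2 k x => ?; exact: is_deriveD.
Qed.

Definition mode_poly_series f := exists2 m, mode_poly m & f = half_series m.

Lemma mode_poly_series_closed f : mode_poly_series f -> continuous f /\ forall i,
  (forall x, derivable f x (e_ i)) /\ mode_poly_series ('D_(e_ i) f).
Proof.
move=> [m pm ->]; have [C mC] := mode_poly_le pm.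
split=> [|i]; first exact: continuous_half_series (mode_poly_cont pm) mC.
have [m1 pm1 d1] := mode_poly_derive i pm; have [C1 mC1] := mode_poly_le pm1.
have [m2 pm2 d2] := mode_poly_derive i pm1; have [C2 mC2] := mode_poly_le pm2.
have D x := @is_derive_half_series _ _ m m1 m2 (e_ i) x C C1 C2 d1 d2 mC mC1 mC2.
split=> [x|]; first exact: (@ex_derive _ _ _ _ _ _ _ (D x)).
by exists m1 => //; exact: eq_derive_fun.
Qed.

(** The widths may tend to 0, so the modes need not decay uniformly in k. The tail is small by the
    weights, and the finitely many remaining modes decay at the rate given by the smallest of their
    widths. *)
Lemma mode_poly_series_decay f (e : R) : mode_poly_series f -> 0 < e ->
  exists M : R, forall x, M < enorm x -> `|f x| < e.
Proof.
move=> [m pm ->] e0; have [C mC] := mode_poly_le pm.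
have C0 : 0 <= C by exact: le_trans (mC 0%N 0).
have e2 : 0 < e / 2 by rewrite divr_gt0.
have [N hN] := half_pow_small C0 e2.
have [C1 hC1] := mode_poly_bound pm 1.
have C10 : 0 <= C1 by apply: le_trans (hC1 0%N 0); rewrite mulr_ge0// expr1 (le_trans ler01)// rho_l1_ge1.
have [r r0 hr] : exists2 r : R, 0 < r & forall k, (k < N)%N -> r <= rho k.
  elim: N {hN} => [|N [r r0 hr]]; first by exists 1.
  exists (Num.min r (rho N)); first by rewrite lt_min r0 rho0.
  move=> k; rewrite ltnS leq_eqVlt => /orP[/eqP ->|/hr rk]; rewrite ge_min ?lexx ?orbT//.
  by rewrite rk.
(* Beyond this radius r |x| exceeds 2 C1 / e, and the first-order decay bound C1 puts each of the
   first N modes below e / 2. *)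
exists (2 * C1 / (r * e)) => x Mx.
rewrite -(subrK (series (fun k => half R k * m k x) N) (half_series m x)).
apply: (le_lt_trans (ler_normD _ _)).
have h1 := @half_series_tail _ _ m C x N (fun k => mC k x).
suff h2 : `|series (fun k => half R k * m k x) N| <= e / 2.
  by move: h1 h2 hN; lra.
apply: (le_trans (ler_norm_sum _ _ _)).
rewrite (@le_trans _ _ (\sum_(0 <= k < N) half R k * (e / 2)))//; last first.
  by rewrite -mulr_suml ler_piMl ?half_sum_le1// ltW.
apply: ler_sum_nat => k /andP[_ kN]; rewrite normrM ger0_norm ?(ltW (half_gt0 _ _))//.
rewrite ler_wpM2l ?(ltW (half_gt0 _ _))//.
have rx : 2 * C1 / e <= 1 + rho k * l1norm x.
  rewrite ltr_pdivrMr ?mulr_gt0// in Mx.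
  rewrite ler_pdivrMr//.
  have h3 := enorm_le_l1norm x; have h4 := hr k kN.
  have h5 : r * enorm x <= rho k * l1norm x by rewrite ler_pM ?enorm_ge0// ltW.
  have : enorm x * (r * e) <= (1 + rho k * l1norm x) * e.
    by rewrite mulrA ler_wpM2r ?(ltW e0)// mulrC (le_trans h5)// lerDr.
  by move=> /(lt_le_trans Mx)/ltW.
have := hC1 k x; rewrite expr1 => h; have l1 := rho_l1_ge1 k x.
have {}rx : C1 <= (1 + rho k * l1norm x) * (e / 2).
  by rewrite mulrA ler_pdivlMr// mulrC -ler_pdivrMr.
have := le_trans h rx; rewrite ler_pM2l//; exact: lt_le_trans l1.
Qed.

Variable A : nat -> R.
Hypothesis A1 : forall n, `|A n| <= 1.

Lemma C0infty_mode_series : C0infty (mode_series A rho v).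
Proof.
have P0 : mode_poly_series (mode_series A rho v).
  exists (fun k x => A k * mode (rho k) (v k) x); first exact: mode_polyZ A1 mode_poly_cos.
  apply/funext => x; rewrite /mode_series /half_series; congr (lim (series _ @ \oo)).
  by apply/funext => k; rewrite /mode_term mulrA.
split; first exact: smooth_coind mode_poly_series_closed _ P0.
move=> w e e0; apply: mode_poly_series_decay e0.
by elim: w => //= i w IH; exact: ((mode_poly_series_closed IH).2 i).2.
Qed.

End mode_series_smooth.

(** * Comparison of the weights *)

Section weights.
Variable R : realType.
Local Notation leb d := (lebesgue_Rd R d).

Lemma mvec_powR d (f : 'rV[R]_d -> R) p : mvec f -> mvec (fun x => f x `^ p).
Proof. by move=> mf; exact: (measurableT_comp (measurable_powR p) mf). Qed.

Lemma mvecD d (f g : 'rV[R]_d -> R) : mvec f -> mvec g -> mvec (fun x => f x + g x).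
Proof. by move=> mf mg; exact: measurable_funD. Qed.

Lemma mvec_cst d (c : R) : mvec (fun _ : 'rV[R]_d => c).
Proof. exact: measurable_cst. Qed.

Lemma mvec_sqr_enorm d : mvec (fun x : 'rV[R]_d => enorm x ^+ 2).
Proof.
rewrite (_ : (fun x => _) = fun x : 'rV[R]_d => dotv x x); last first.
  by apply/funext => x; exact: sqr_enorm.
by apply: mvec_cont; exact: continuous_dotvv.
Qed.

Lemma mvec_bessel d (s : R) : mvec (@bessel_weight R d s).
Proof.
exact: (mvec_powR s (mvecD (@mvec_cst d 1) (@mvec_sqr_enorm d))).
Qed.

Lemma enorm_lt1 d (x : 'rV[R]_d) : (enorm x < 1) = (enorm x ^+ 2 < 1).
Proof. by rewrite -[X in _ = (_ < X)](expr1n _ 2) ltr_pXn2r ?nnegrE ?enorm_ge0. Qed.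

Lemma mvec_omega d (s : R) : mvec (@omega R d s).
Proof.
have m2 := @mvec_sqr_enorm d.+1.
have E : @omega R d s = fun x => if enorm x ^+ 2 < 1
    then (x ord0 ord0 ^+ 2 + (enorm x ^+ 2) ^+ 2) * (enorm x ^+ 2) `^ (-1)
    else bessel_weight s x.
  apply/funext => x; rewrite /omega enorm_lt1 powR_inv1 ?sqr_ge0//.
  by rewrite -exprM.
rewrite E; apply: measurable_fun_ifT.
- by apply: measurable_fun_ltr; [exact: m2|exact: measurable_cst].
- have mc : mvec (fun x : 'rV[R]_d.+1 => x ord0 ord0) by apply: mvec_cont; exact: coord_continuous.
  exact: (mvecM (mvecD (mvecX 2 mc) (mvecX 2 m2)) (mvec_powR (-1) m2)).
- exact: mvec_bessel.
Qed.

Lemma omega_ge0 d (s : R) (x : 'rV[R]_d.+1) : 0 <= omega s x.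
Proof.
rewrite /omega; case: ifP => _; last exact: powR_ge0.
by rewrite divr_ge0 ?sqr_ge0// addr_ge0 ?sqr_ge0// exprn_ge0 ?enorm_ge0.
Qed.

Lemma bessel_ge0 d (s : R) (x : 'rV[R]_d) : 0 <= bessel_weight s x.
Proof. exact: powR_ge0. Qed.

Lemma bessel_ge1 d (s : R) (x : 'rV[R]_d) : 0 <= s -> 1 <= bessel_weight s x.
Proof.
move=> s0; rewrite /bessel_weight -[leLHS](powRr0 (1 + enorm x ^+ 2)).
by rewrite ler_powR// lerDl sqr_ge0.
Qed.

Lemma sqr_coord0_le d (x : 'rV[R]_d.+1) : x ord0 ord0 ^+ 2 <= enorm x ^+ 2.
Proof. by rewrite sqr_enorm sqr_coord_le. Qed.

Lemma omega_smallE d (s : R) (x : 'rV[R]_d.+1) : enorm x < 1 ->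
  omega s x = x ord0 ord0 ^+ 2 / enorm x ^+ 2 + enorm x ^+ 2.
Proof.
move=> x1; rewrite /omega x1 mulrDl; congr (_ + _).
(* At the origin the convention 0^-1 = 0 makes both sides 0. *)
have [->|x0] := eqVneq (enorm x) 0; first by rewrite !expr0n mul0r.
by rewrite (_ : 4 = 2 + 2)%N// exprD mulfK// expf_neq0.
Qed.

Lemma omega_le_bessel d (s : R) (x : 'rV[R]_d.+1) : 0 <= s ->
  omega s x <= 2 * bessel_weight s x.
Proof.
move=> s0; have b1 := bessel_ge1 x s0.
have [x1|x1] := ltP (enorm x) 1; last first.
  by rewrite /omega ltNge x1/= ler_peMl ?bessel_ge0// ler1n.
apply: (@le_trans _ _ 2); last by rewrite ler_peMr.
rewrite omega_smallE// (_ : 2 = 1 + 1 :> R)// lerD//.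
  have [->|xn] := eqVneq (enorm x ^+ 2) 0; first by rewrite invr0 mulr0 ler01.
  by rewrite ler_pdivrMr ?mul1r ?sqr_coord0_le// lt0r xn sqr_ge0.
by move: x1; rewrite enorm_lt1 => /ltW.
Qed.

(** In dimension 1 the quotient x_0^2 / |x|^2 is 1 off the origin, so for |x| < 1 the weight omega
    is at least 1, while the Bessel weight is at most 2^s. *)
Lemma bessel_le_omega1 (s : R) (x : 'rV[R]_1) : 0 <= s -> x != 0 ->
  bessel_weight s x <= 2 `^ s * omega s x.
Proof.
move=> s0 xn0.
have p1 : 1 <= 2 `^ s :> R by rewrite -[leLHS](powRr0 2) ler_powR// ler1n.
have [x1|x1] := ltP (enorm x) 1; last first.
  by rewrite /omega ltNge x1/= ler_peMl ?bessel_ge0.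
have eE : enorm x ^+ 2 = x ord0 ord0 ^+ 2 by rewrite sqr_enorm /dotv big_ord1 expr2.
have xn : x ord0 ord0 != 0.
  by apply: contra xn0 => /eqP h; apply/eqP/rowP => i; rewrite ord1 mxE.
rewrite omega_smallE// -eE divff ?eE ?expf_neq0// -eE.
apply: (@le_trans _ _ (2 `^ s)); last by rewrite ler_peMr ?powR_ge0// lerDl sqr_ge0.
rewrite /bessel_weight ge0_ler_powR ?nnegrE ?addr_ge0 ?sqr_ge0//.
by rewrite (_ : 2 = 1 + 1 :> R)// lerD2l; move: x1; rewrite enorm_lt1 => /ltW.
Qed.

Lemma vec_neq0_ae : {ae leb 1, forall t, vec t != 0}.
Proof.
have c0 : closed [set 0 : 'rV[R]_1].
  exact: (accessible_closed_set1 (hausdorff_accessible (@norm_hausdorff _ _))).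
exists (@vec R 1 @^-1` [set 0]); split.
- exact: measurable_vec_closed.
- pose A : set R := [set 0].
  (* Written as the integral of a product over one coordinate, the measure of the origin reduces to
     that of a point of the line. *)
  have -> : leb 1 (@vec R 1 @^-1` [set 0]) =
      (\int[leb 1]_t (\prod_(i < 1) (\1_A (tnth t i) : R))%:E)%E.
    rewrite -[LHS]mul1e -integral_cst; last first.
      exact: measurable_vec_closed.
    rewrite integral_mkcond; apply: eq_integral => t _; rewrite patchE big_ord1 indicE.
    have -> : (t \in @vec R 1 @^-1` [set 0]) = (tnth t ord0 \in A).
      apply/idP/idP; rewrite !inE /A /= => h; first by rewrite -(vecE t ord0) h mxE.
      by apply/rowP => i; rewrite ord1 vecE mxE.
    by case: ifP.
  rewrite (@ge0_integral_prod R 1 (fun=> \1_A)) ?big_ord1//.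
    rewrite integral_indic ?setIT//; first exact: lebesgue_measure_set1.
    exact: measurable_set1.
  by move=> _; apply: measurable_indic; exact: measurable_set1.
- by move=> t /= /negP; rewrite negbK => /eqP.
Qed.

Lemma weighted_norm_le d (w1 w2 : 'rV[R]_d -> R) (K : R) F :
  (forall x, 0 <= w1 x) -> (forall x, 0 <= w2 x) -> mvec w1 -> mvec w2 -> 0 <= K ->
  {ae leb d, forall t, w1 (vec t) <= K * w2 (vec t)} -> weighted_space w2 F ->
  weighted_space w1 F /\ weighted_norm w1 F <= Num.sqrt K * weighted_norm w2 F.
Proof.
move=> w10 w20 m1 m2 K0 w12 [tF rF [g Fg] lt2].
have mf := mvec_sqr_normc (proj1 (fhatP Fg)).
have le12 : (weighted_normsq w1 F <= K%:E * weighted_normsq w2 F)%E.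
  rewrite /weighted_normsq -ge0_integralZl//; last 2 first.
  - by apply/measurable_EFinP; exact: (mvecM m2 mf).
  - by move=> t _; rewrite lee_fin mulr_ge0 ?sqr_ge0.
  apply: ae_ge0_le_integral => //.
  - by move=> t _; rewrite lee_fin mulr_ge0 ?sqr_ge0.
  - by apply/measurable_EFinP; exact: (mvecM m1 mf).
  - by move=> t _; rewrite mule_ge0 ?lee_fin// mulr_ge0 ?sqr_ge0.
  - by apply: measurable_funeM; apply/measurable_EFinP; exact: (mvecM m2 mf).
  by apply: filterS w12 => t h _; rewrite -EFinM lee_fin [leRHS]mulrA ler_wpM2r ?sqr_ge0.
have ge0 (w : 'rV[R]_d -> R) : (forall x, 0 <= w x) -> (0 <= weighted_normsq w F)%E.
  by move=> w0; apply: integral_ge0 => t _; rewrite lee_fin mulr_ge0 ?sqr_ge0.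
have fin2 : weighted_normsq w2 F \is a fin_num by rewrite ge0_fin_numE// ge0.
have fin12 : (K%:E * weighted_normsq w2 F)%E \is a fin_num by rewrite fin_numM.
have lt1 : (weighted_normsq w1 F < +oo)%E.
  by apply: le_lt_trans le12 _; rewrite -ge0_fin_numE// mule_ge0 ?lee_fin ?ge0.
split; first by split=> //; exists g.
rewrite /weighted_norm -sqrtrM// ler_wsqrtr// -lee_fin EFinM !fineK//.
by rewrite ge0_fin_numE// ge0.
Qed.

End weights.

(** * Rotated functions *)

Section resonance.
Variables (R : realType) (d : nat).
Local Notation V := 'rV[R]_d.+1.
Local Notation leb := (lebesgue_Rd R d.+1).
Local Notation T := (d.+1.-tuple (measurableTypeR R)).
Implicit Types (u v x y : V) (r : R).

Lemma dotv_parallelogram x y : dotv (x + y) (x + y) <= 2 * dotv x x + 2 * dotv y y.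
Proof.
have := dotvv_ge0 (x + (-1) *: y).
by rewrite !dotvDl !dotvDr !dotvZl !dotvZr (dotvC y x); lra.
Qed.

Lemma dotv_le_sub x v : dotv x x <= 2 * dotv (x - v) (x - v) + 2 * dotv v v.
Proof. by have := dotv_parallelogram (x - v) v; rewrite subrK. Qed.

Lemma dotvNN x : dotv (- x) (- x) = dotv x x.
Proof. by rewrite -scaleN1r dotvZl dotvZr; ring. Qed.

(** The variable y = |x - v|^2 / r^4 is the squared distance to v in units of the width r^2. In
    these units omega is r^2 times a polynomial whose coefficients do not depend on r; the degree
    exceeds s in order to cover the region |x| >= 1. *)
Lemma omega_le_poly (s r : R) v x : 0 <= s -> 0 < r <= 4^-1 ->
  v ord0 ord0 = 0 -> dotv v v = r ^+ 2 ->
  omega s x <= r ^+ 2 * (2 * (2 + 6 * (dotv (x - v) (x - v) / r ^+ 4)) ^+ (Num.truncn s).+1).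
Proof.
move=> s0 /andP[r0 r4] v0 vr; set N := Num.truncn s.
set q := dotv (x - v) (x - v); set y := q / r ^+ 4.
have q0 : 0 <= q by exact: dotvv_ge0.
have rn : r ^+ 4 != 0 by rewrite expf_neq0// gt_eqF.
have y0 : 0 <= y by rewrite divr_ge0// exprn_ge0// ltW.
set rho := r ^+ 2; have rho0 : 0 < rho by rewrite exprn_gt0.
have rho16 : rho <= 16^-1 by rewrite /rho expr2; nra.
have qE : q = rho ^+ 2 * y.
  by rewrite /y /rho -exprM mulrC divfK.
set E := enorm x ^+ 2.
have E0 : 0 <= E by exact: sqr_ge0.
have Ele : E <= 2 * q + 2 * rho.
  by rewrite /E sqr_enorm; have := dotv_le_sub x v; rewrite vr.
have rle : rho <= 2 * E + 2 * q.
  have := dotv_parallelogram x (- (x - v)).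
  by rewrite dotvNN opprB addrC subrK vr /E sqr_enorm.
have x0q : x ord0 ord0 ^+ 2 <= q.
  by have := sqr_coord_le (x - v) ord0; rewrite !mxE v0 subr0.
have b1 : 1 <= 2 + 6 * y by lra.
clearbody y rho.
have [x1|x1] := ltP (enorm x) 1.
  rewrite omega_smallE// -/E.
  (* Either |x|^2 >= r^2 / 4 and x_0^2 <= q is used, or x is so close to the origin that q > r^2 / 4
     and x_0^2 <= |x|^2 is enough. *)
  have hE : x ord0 ord0 ^+ 2 / E <= 4 * rho * y.
    have [->|En] := eqVneq E 0; first by rewrite invr0 mulr0 mulr_ge0// mulr_ge0// ltW.
    have {}E0 : 0 < E by rewrite lt0r En.
    rewrite ler_pdivrMr// -(ler_pM2r rho0).
    have -> : 4 * rho * y * E * rho = 4 * q * E by rewrite qE; ring.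
    have x0E : x ord0 ord0 ^+ 2 <= E by exact: sqr_coord0_le.
    move: (x ord0 ord0 ^+ 2) (sqr_ge0 (x ord0 ord0)) x0q x0E => X X0 Xq XE.
    have [h|h] := leP rho (4 * E).
      by rewrite -mulrA [leRHS]mulrC -mulrA ler_pM// ?(ltW rho0) ?mulr_ge0// mulrC.
    have {}h : rho <= 4 * q by lra.
    by rewrite [leRHS]mulrC ler_pM// ltW.
  apply: (@le_trans _ _ (rho * (2 * (2 + 6 * y)))).
    apply: (le_trans (lerD hE Ele)); rewrite qE.
    have : rho ^+ 2 * y <= rho * y by rewrite ler_wpM2r// expr2 ler_piMr ?(ltW rho0)//; lra.
    have : 0 <= rho * y by rewrite mulr_ge0// ltW.
    by lra.
  rewrite ler_wpM2l ?(ltW rho0)// ler_wpM2l//.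
  by rewrite exprS ler_peMr ?exprn_ege1// (le_trans ler01).
rewrite /omega ltNge x1/= -/E.
have E1 : 1 <= E by rewrite exprn_ege1.
(* Since r^2 <= 1/16, a point with |x| >= 1 is far from v: q >= 7/16. *)
have E6 : 1 + E <= 6 * q by lra.
have sN : s <= N.+1%:R by exact/ltW/truncnS_gt.
apply: (@le_trans _ _ ((6 * q) ^+ N.+1)).
  apply: (@le_trans _ _ ((1 + E) `^ N.+1%:R)); first by rewrite ler_powR// lerDl.
  have p1 : 0 <= 1 + E by lra.
  have p2 : 0 <= 6 * q by lra.
  by rewrite powR_mulrn// lerXn2r ?nnegrE.
rewrite (_ : 6 * q = rho * (rho * (6 * y))); last by rewrite qE; ring.
rewrite exprMn; apply: ler_pM; rewrite ?exprn_ge0 ?mulr_ge0 ?(ltW rho0)//.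
  by rewrite exprS ler_piMr ?(ltW rho0)// exprn_ile1 ?(ltW rho0)//; lra.
apply: (@le_trans _ _ ((2 + 6 * y) ^+ N.+1)).
  rewrite lerXn2r ?nnegrE ?mulr_ge0 ?(ltW rho0)//; first lra.
  have : rho * (6 * y) <= 1 * (6 * y) by rewrite ler_wpM2r ?mulr_ge0//; lra.
  by lra.
by rewrite ler_peMl ?ler1n// exprn_ge0; lra.
Qed.

(** One of the two Gaussian factors absorbs the polynomial in y, with a constant independent of r;
    the other is kept for integration. *)
Lemma omega_gauss_le (s : R) : 0 <= s -> exists2 C : R, 0 <= C & forall r v x,
  0 < r <= 4^-1 -> v ord0 ord0 = 0 -> dotv v v = r ^+ 2 ->
  omega s x * gauss (pi / (r ^+ 2) ^+ 2) (x - v) ^+ 2 <=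
  r ^+ 2 * C * gauss (pi / (r ^+ 2) ^+ 2) (x - v).
Proof.
move=> s0; set N := (Num.truncn s).+1.
have [C hC] := @expR_poly_bound R 1 pi N ler01 (pi_gt0 R).
have C0 : 0 <= C.
  by apply: le_trans (hC 0 (lexx _)); rewrite mulr_ge0 ?expR_ge0// exprn_ge0// addr0.
exists (2 * 6 ^+ N * C); first by rewrite !mulr_ge0// exprn_ge0.
move=> r v x r14 v0 vr; have r0 : 0 < r by case/andP: r14.
have om := omega_le_poly x s0 r14 v0 vr; rewrite -/N in om.
set q := dotv (x - v) (x - v) in om *; set y := q / r ^+ 4 in om *.
have y0 : 0 <= y by rewrite divr_ge0 ?dotvv_ge0// exprn_ge0// ltW.
have -> : gauss (pi / (r ^+ 2) ^+ 2) (x - v) = expR (- (pi * y)).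
  by rewrite /gauss -exprM -/q /y mulrAC mulrA.
rewrite expr2 mulrA ler_wpM2r ?expR_ge0//.
apply: (le_trans (ler_wpM2r (expR_ge0 _) om)).
rewrite -[leLHS]mulrA ler_wpM2l ?exprn_ge0 ?(ltW r0)//.
rewrite -!mulrA ler_wpM2l//.
apply: (@le_trans _ _ (6 ^+ N * (1 + y) ^+ N * expR (- (pi * y)))).
  have p1 : 0 <= 2 + 6 * y by lra.
  have p2 : 0 <= 6 * (1 + y) by lra.
  rewrite ler_wpM2r ?expR_ge0// -exprMn lerXn2r ?nnegrE//; lra.
by rewrite -mulrA ler_wpM2l ?exprn_ge0// hC.
Qed.

(** The frequencies 4^(-n) with n = k + 1, which gives the bound 1/4 assumed in [omega_le_poly]. *)
Definition scale (n : nat) : R := 4^-1 ^+ n.+1.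

Lemma scale_gt0 n : 0 < scale n.
Proof. by rewrite exprn_gt0. Qed.

Lemma scale_le n : scale n <= 4^-1.
Proof. by rewrite /scale exprS ler_piMr// exprn_ile1//; lra. Qed.

Lemma scale_le1 n : scale n <= 1.
Proof. by apply: le_trans (scale_le n) _; lra. Qed.

Lemma scale_small (e : R) : 0 < e -> exists n0, forall n, (n0 <= n)%N -> scale n <= e.
Proof.
move=> e0; have [N hN] := half_pow_small ler01 e0; rewrite mul1r in hN.
exists N => n Nn; apply: le_trans (ltW hN).
apply: (@le_trans _ _ (2^-1 ^+ n.+1)).
  by rewrite lerXn2r ?nnegrE//; lra.
apply: ler_wiXn2l; [lra|lra|exact: (leq_trans Nn)].
Qed.

Definition amp n : R := scale n ^+ d.
Definition width n : R := scale n ^+ 2.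
Definition resonance u : V -> R := mode_series amp width (fun n => scale n *: u).

Lemma amp_ge0 n : 0 <= amp n.
Proof. by rewrite exprn_ge0// ltW// scale_gt0. Qed.

Lemma amp_le1 n : amp n <= 1.
Proof. by rewrite exprn_ile1 ?scale_le1// ltW// scale_gt0. Qed.

Lemma width_gt0 n : 0 < width n.
Proof. by rewrite exprn_gt0// scale_gt0. Qed.

(* The amplitude is tuned to this balance: it bounds the contribution of each
   mode when the weight is of the order of its width. *)
Lemma amp_widthE n : amp n ^+ 2 * width n ^- d.+1 * width n = 1.
Proof.
have : scale n != 0 by rewrite gt_eqF// scale_gt0.
rewrite /amp /width; move: (scale n) => x x0.
have -> : (x ^+ 2) ^+ d.+1 = (x ^+ d) ^+ 2 * x ^+ 2.
  by rewrite -!exprM -exprD; congr (_ ^+ _); rewrite -mulSnr mulnC.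
have : x ^+ d != 0 by rewrite expf_neq0.
by move: (x ^+ d) => a a0; field; rewrite a0 x0.
Qed.

Lemma resonance_normsq (s : R) u : 0 <= s -> u ord0 ord0 = 0 -> dotv u u = 1 ->
  (weighted_normsq (omega s) (of_function (resonance u)) < +oo)%E.
Proof.
move=> s0 u0 u1; have [C C0 hC] := omega_gauss_le s0.
apply: (@le_lt_trans _ _ C%:E); last exact: ltry.
apply: (@mode_series_normsq_le R d.+1 amp width (fun n => scale n *: u) amp_ge0 amp_le1
  width_gt0 (omega s) (omega_ge0 s) (mvec_omega s) C C0).
move=> n; set r := scale n; pose v : V := r *: u; rewrite -/v.
have r0 : 0 < r := scale_gt0 n.
have r14 : 0 < r <= 4^-1 by rewrite r0 scale_le.
have v0 : v ord0 ord0 = 0 by rewrite mxE u0 mulr0.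
have vr : dotv v v = r ^+ 2 by rewrite dotvZl dotvZr u1 mulr1 expr2.
have nv0 : (- v) ord0 ord0 = 0 by rewrite mxE v0 oppr0.
have nvr : dotv (- v) (- v) = r ^+ 2 by rewrite dotvNN.
have I := @integral_mode_hat R d.+1 width (fun=> v) width_gt0 n.
(* As the transformed mode has mass 1, C is the integral of C times it, and a pointwise comparison
   suffices. *)
rewrite -[leRHS]mule1 -I -ge0_integralZl//; last 2 first.
- by apply/measurable_EFinP; exact: mvec_mode_hat.
- by move=> t _; rewrite lee_fin (@mode_hat_ge0 _ _ width (fun=> v)); last exact: width_gt0.
apply: ge0_le_integral => //.
- by move=> t _; rewrite lee_fin mulr_ge0 ?sqr_ge0 ?omega_ge0.
- by apply/measurable_EFinP; exact: (mvecM (mvec_omega _) (mvecX 2 (mvecZ _ (mvec_mode_hat _ _)))).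
- by apply: measurable_funeM; apply/measurable_EFinP; exact: mvec_mode_hat.
move=> t _; rewrite -EFinM lee_fin /mode_hat.
have h1 := hC r v (vec t) r14 v0 vr; have h2 := hC r (- v) (vec t) r14 nv0 nvr.
rewrite opprK -/(width n) in h1 h2.
move: h1 h2; set g1 := gauss _ _; set g2 := gauss _ _; set w := omega s _ => h1 h2.
have B := amp_widthE n; set P := width n ^- d.+1 in B *.
have P0 : 0 <= P by rewrite invr_ge0 exprn_ge0// ltW// width_gt0.
have w0 : 0 <= w := omega_ge0 _ _.
(* The square of the sum is at most twice the sum of the squares, which treats the two bumps
   separately; the bump at - v is covered because - v satisfies the same hypotheses. *)
apply: (@le_trans _ _ (amp n ^+ 2 * P ^+ 2 / 2 * (w * g1 ^+ 2 + w * g2 ^+ 2))).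
  have -> : w * (amp n * (P / 2 * (g1 + g2))) ^+ 2 =
     amp n ^+ 2 * P ^+ 2 / 2 * (w * ((g1 + g2) ^+ 2 / 2)) by field.
  rewrite ler_wpM2l//; first by rewrite divr_ge0// mulr_ge0// sqr_ge0.
  rewrite -mulrDr ler_wpM2l//.
  by have := sqr_ge0 (g1 - g2); rewrite !expr2; lra.
apply: (le_trans (ler_wpM2l _ (lerD h1 h2))); first by rewrite divr_ge0// mulr_ge0// sqr_ge0.
have -> : amp n ^+ 2 * P ^+ 2 / 2 * (width n * C * g1 + width n * C * g2) =
   (amp n ^+ 2 * P * width n) * (C * (P / 2 * (g1 + g2))) by field.
by rewrite B mul1r.
Qed.

Lemma integral_box_indic (a b : 'I_d.+1 -> R) : (forall i, a i <= b i) ->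
  (\int[leb]_t (\1_(box a b) t)%:E = (\prod_(i < d.+1) (b i - a i))%:E)%E.
Proof.
move=> ab.
have mI i : measurable (`]a i, b i]%classic : set R) by exact: measurable_itv.
transitivity (\int[leb]_t (\prod_(i < d.+1) (\1_(`]a i, b i]%classic : set R) (tnth t i) : R))%:E)%E.
  apply: eq_integral => t _; congr EFin.
  rewrite indicE; have [tb|tb] := boolP (t \in box a b).
    rewrite big1// => i _; rewrite indicE mem_set//=.
    by move: tb; rewrite inE => /(_ i); rewrite in_itv.
  move: tb; rewrite notin_setE => /existsNP[i ti].
  rewrite (bigD1 i)//= indicE memNset ?mul0r//= in_itv/=; exact: ti.
rewrite (@ge0_integral_prod R d.+1 (fun i => \1_(`]a i, b i]%classic : set R))).
- rewrite -prodEFin; apply: eq_bigr => i _.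
  rewrite integral_indic//.
  rewrite setIT; apply: (etrans (lebesgue_measure_itv `]a i, b i])); rewrite /= lte_fin.
  case: ifPn => h; first by rewrite EFinB.
  by rewrite -leNgt in h; have -> : b i = a i by [apply/eqP; rewrite eq_le h ab]; rewrite subrr.
- by move=> i; exact: measurable_indic.
- by move=> i x; rewrite indicE; case: (_ \in _).
Qed.

(** On the cube of half-side [width n] around [scale n *: u] the bump is at least a fixed fraction
    of its peak, so the n-th mode alone contributes K 4^(n+1). The weight is kept general in order
    to treat omega and the Bessel weight together. *)
Lemma resonance_normsq_infty (w : V -> R) u (delta : R) (n0 : nat) :
  (forall x, 0 <= w x) -> mvec w -> 0 < delta ->
  (forall n x, (n0 <= n)%N ->
     (forall i, `|x ord0 i - scale n * u ord0 i| <= width n) -> delta <= w x) ->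
  ~ (weighted_normsq w (of_function (resonance u)) < +oo)%E.
Proof.
move=> w0 mw delta0 hw lty.
have ge n := @mode_series_normsq_ge R d.+1 amp width (fun n => scale n *: u)
  amp_ge0 amp_le1 width_gt0 w w0 mw n.
have ge0 : (0 <= weighted_normsq w (of_function (resonance u)))%E.
  by apply: integral_ge0 => t _; rewrite lee_fin mulr_ge0 ?sqr_ge0.
have fin : weighted_normsq w (of_function (resonance u)) \is a fin_num by rewrite ge0_fin_numE.
(* On the cube |x - v|^2 <= D [width n] ^ 2, hence the factor exp(- pi D); the power of 2 comes from
   the volume of the cube and the 4 from the factor 1/2 in [mode_hat]. *)
pose D : R := d.+1%:R; pose K := delta * expR (- (pi * D)) ^+ 2 * 2 ^+ d.+1 / 4.
have K0 : 0 < K by rewrite divr_gt0// !mulr_gt0 ?exprn_gt0 ?expR_gt0.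
set M := fine (weighted_normsq w (of_function (resonance u))).
have KM n : (n0 <= n)%N -> K * 4 ^+ n.+1 <= M.
  move=> n0n; pose v := scale n *: u; pose rho := width n.
  have rho0 : 0 < rho := width_gt0 n.
  pose a i := v ord0 i - rho; pose b i := v ord0 i + rho.
  pose c := delta * (half R n * amp n * (rho ^- d.+1 / 2 * expR (- (pi * D)))) ^+ 2.
  have c0 : 0 <= c by rewrite mulr_ge0 ?sqr_ge0// ltW.
  have lower t : c * \1_(box a b) t <=
      w (vec t) * (half R n * amp n * mode_hat rho v (vec t)) ^+ 2.
    rewrite indicE; have [tb|_] := boolP (t \in box a b); last first.
      by rewrite mulr0 mulr_ge0 ?sqr_ge0.
    have tv i : `|vec t ord0 i - v ord0 i| <= rho.
      move: tb; rewrite inE => /(_ i) /andP[h1 h2]; rewrite vecE ler_distl h2 andbT.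
      exact: ltW.
    have hP : 0 <= half R n * amp n by rewrite mulr_ge0 ?amp_ge0// ltW// half_gt0.
    have P0 : 0 <= rho ^- d.+1 / 2 by rewrite divr_ge0// invr_ge0 exprn_ge0// ltW.
    have gE : expR (- (pi * D)) <= gauss (pi / rho ^+ 2) (vec t - v).
      rewrite /gauss ler_expR lerN2 -mulrA ler_wpM2l ?pi_ge0//.
      rewrite mulrC ler_pdivrMr ?exprn_gt0//.
      rewrite (_ : D * rho ^+ 2 = \sum_(i < d.+1) rho ^+ 2); last first.
        by rewrite sumr_const card_ord mulr_natl.
      apply: ler_sum => i _; rewrite -expr2 -[_ ^+ 2]real_normK ?num_real// lerXn2r ?nnegrE ?(ltW rho0)//.
      by have := tv i; rewrite !mxE.
    rewrite mulr1 /c; apply: ler_pM; rewrite ?sqr_ge0 ?(ltW delta0)//.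
      by apply: (hw n) => // i; have := tv i; rewrite !mxE.
    have gP : 0 <= expR (- (pi * D)) by exact: expR_ge0.
    have gle : rho ^- d.+1 / 2 * expR (- (pi * D)) <= mode_hat rho v (vec t).
      by rewrite /mode_hat ler_wpM2l// (le_trans gE)// lerDl expR_ge0.
    have p1 : 0 <= half R n * amp n * (rho ^- d.+1 / 2 * expR (- (pi * D))).
      by rewrite mulr_ge0// mulr_ge0.
    have p2 : half R n * amp n * (rho ^- d.+1 / 2 * expR (- (pi * D))) <=
        half R n * amp n * mode_hat rho v (vec t) by rewrite ler_wpM2l.
    by rewrite lerXn2r ?nnegrE// (le_trans p1 p2).
  have := ge n; rewrite -/v -/rho => /(le_trans _) H.
  have {}H : (c%:E * (\prod_(i < d.+1) (b i - a i))%:E <=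
      weighted_normsq w (of_function (resonance u)))%E.
    apply: H; rewrite -integral_box_indic; last first.
      by move=> i; rewrite /a /b; lra.
    have mb : measurable_fun setT (fun t : T => (\1_(box a b) t : R)%:E).
      by apply/measurable_EFinP; apply: measurable_indic; exact: measurable_box.
    rewrite -ge0_integralZl//.
    apply: ge0_le_integral => //.
    - by move=> t _; rewrite -EFinM lee_fin mulr_ge0.
    - exact: measurable_funeM.
    - apply/measurable_EFinP.
      exact: (mvecM mw (mvecX 2 (mvecZ _ (mvec_mode_hat _ _)))).
    - by move=> t _; rewrite -EFinM lee_fin lower.
  move: H; rewrite -EFinM -(fineK fin) lee_fin -/M; apply: le_trans.
  have -> : \prod_(i < d.+1) (b i - a i) = (2 * rho) ^+ d.+1.
    rewrite (eq_bigr (fun=> 2 * rho)) ?prodr_const ?card_ord// => i _.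
    by rewrite /a /b; ring.
  have rn : rho != 0 by rewrite gt_eqF.
  have B := amp_widthE n; rewrite -/rho in B.
  have rD : rho ^+ d.+1 != 0 by rewrite expf_neq0.
  (* The source of the divergence: 4^(-m) = 4^m 16^(-m) with m = n + 1. The factor [rho] is consumed
     by [amp_widthE], and 4^m remains. *)
  have h4 : half R n ^+ 2 = 4 ^+ n.+1 * rho.
    rewrite /half /rho /width /scale -!exprM -[4 ^+ n.+1]invrK -exprVn.
    rewrite [(_ * 2)%N]mulnC [LHS]exprM [X in _ * X]exprM.
    by rewrite -[X in X * _]exprVn -exprMn; congr (_ ^+ _); field.
  rewrite /c /K [(2 * rho) ^+ _]exprMn.
  have -> : delta * (half R n * amp n * (rho ^- d.+1 / 2 * expR (- (pi * D)))) ^+ 2 *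
     (2 ^+ d.+1 * rho ^+ d.+1) =
     delta * expR (- (pi * D)) ^+ 2 * 2 ^+ d.+1 / 4 * half R n ^+ 2 * (amp n ^+ 2 * rho ^- d.+1).
    move: (expR _) (rho ^+ d.+1) rD (2 ^+ d.+1) (half R n) (amp n) => X Z Z0 W h A.
    by field.
  rewrite h4 (_ : _ * _ * (amp n ^+ 2 * _) = delta * expR (- (pi * D)) ^+ 2 * 2 ^+ d.+1 / 4 *
     4 ^+ n.+1 * (amp n ^+ 2 * rho ^- d.+1 * rho)); last by ring.
  by rewrite B mulr1.
have M0 : 0 <= M by exact: fine_ge0.
pose n := maxn n0 (Num.truncn (M / K)).
have := KM n (leq_maxl _ _); rewrite leNgt => /negP; apply.
rewrite mulrC -ltr_pdivrMr//; apply: (lt_le_trans (truncnS_gt _)).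
rewrite -natrX ler_nat; apply: (@leq_trans n.+1); last exact/ltnW/ltn_expl.
by rewrite ltnS leq_maxr.
Qed.

Lemma omega_normsq_infty (s : R) u : dotv u u = 1 -> u ord0 ord0 != 0 ->
  ~ (weighted_normsq (omega s) (of_function (resonance u)) < +oo)%E.
Proof.
move=> u1 u0; pose U := u ord0 ord0.
have U0 : 0 < `|U| by rewrite normr_gt0.
have U2 : 0 < U ^+ 2 by rewrite -real_normK ?num_real// exprn_gt0.
have D0 : 0 < d.+1%:R :> R by rewrite ltr0n.
(* With r at most |U| / 2, the error r^2 in the coordinate 0 leaves |x_0| >= r |U| / 2; with r at
   most 1 / (d+1), the cube stays within distance r of r u. *)
have e0 : 0 < Num.min (`|U| / 2) (d.+1%:R^-1) by rewrite lt_min divr_gt0//= invr_gt0.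
have [n0 hn0] := scale_small e0.
(* The quotient of x_0^2 >= r^2 U^2 / 4 by |x|^2 <= 4 r^2. *)
apply: (@resonance_normsq_infty _ _ (U ^+ 2 / 16) n0).
- exact: omega_ge0.
- exact: mvec_omega.
- by rewrite divr_gt0.
move=> n x n0n hx; set r := scale n in hx.
have r0 : 0 < r := scale_gt0 n; have r4 : r <= 4^-1 := scale_le n.
have := hn0 n n0n; rewrite -/r le_min => /andP[rU rD].
have Dr : d.+1%:R * r <= 1 by rewrite -ler_pdivlMl// mulr1.
have X0 : r * `|U| / 2 <= `|x ord0 ord0|.
  have h := hx ord0; rewrite -/U /width -/r in h.
  have h2 : r * `|U| - r ^+ 2 <= `|x ord0 ord0|.
    rewrite -{1}(ger0_norm (ltW r0)) -normrM lerBlDr.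
    rewrite -(subrK (x ord0 ord0) (r * U)) addrC (le_trans (ler_normD _ _))// lerD2l.
    by rewrite distrC.
  by apply: le_trans h2; rewrite expr2; nra.
have XU : r ^+ 2 * U ^+ 2 / 4 <= x ord0 ord0 ^+ 2.
  rewrite -[U ^+ 2]real_normK ?num_real// -[x _ _ ^+ 2]real_normK ?num_real//.
  have -> : r ^+ 2 * `|U| ^+ 2 / 4 = (r * `|U| / 2) ^+ 2 by field.
  by rewrite lerXn2r ?nnegrE ?divr_ge0 ?mulr_ge0 ?(ltW r0).
have E4 : enorm x ^+ 2 <= 4 * r ^+ 2.
  rewrite sqr_enorm; apply: (le_trans (dotv_le_sub x (r *: u))).
  rewrite dotvZl dotvZr u1 mulr1 -expr2.
  have : dotv (x - r *: u) (x - r *: u) <= r ^+ 2.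
    apply: (@le_trans _ _ (\sum_(i < d.+1) (r ^+ 2) ^+ 2)).
      apply: ler_sum => i _; rewrite -expr2 -[_ ^+ 2]real_normK ?num_real//.
      rewrite lerXn2r ?nnegrE ?sqr_ge0//.
      by have := hx i; rewrite !mxE.
    rewrite sumr_const card_ord -mulr_natl expr2 mulrA ler_piMl ?sqr_ge0//.
    by rewrite expr2 mulrA mulr_ile1// ?mulr_ge0 ?(ltW r0)// (le_trans r4)//; lra.
  by lra.
have E1 : enorm x < 1 by rewrite enorm_lt1; apply: (le_lt_trans E4); rewrite expr2; nra.
have E0 : 0 < enorm x ^+ 2.
  apply: lt_le_trans (sqr_coord0_le x); apply: lt_le_trans XU.
  by rewrite divr_gt0// mulr_gt0// exprn_gt0.
rewrite omega_smallE//; apply: (@le_trans _ _ (x ord0 ord0 ^+ 2 / enorm x ^+ 2)); last first.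
  by rewrite lerDl sqr_ge0.
rewrite ler_pdivlMr//; apply: le_trans XU.
apply: (@le_trans _ _ (U ^+ 2 / 16 * (4 * r ^+ 2))).
  by rewrite ler_wpM2l// divr_ge0// sqr_ge0.
by rewrite (_ : _ * _ = r ^+ 2 * U ^+ 2 / 4)//; field.
Qed.

Lemma bessel_normsq_infty (s : R) u : 0 <= s ->
  ~ (weighted_normsq (bessel_weight s) (of_function (resonance u)) < +oo)%E.
Proof.
move=> s0; apply: (@resonance_normsq_infty _ _ 1 0%N) => //.
- exact: bessel_ge0.
- exact: mvec_bessel.
- by move=> n x _ _; exact: bessel_ge1.
Qed.

Lemma resonance_space (w : V -> R) u :
  (weighted_normsq w (of_function (resonance u)) < +oo)%E ->
  weighted_space w (of_function (resonance u)).
Proof.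
have m : mvec (resonance u) := mvec_mode_series (fun n => scale n *: u) amp_ge0 amp_le1 width_gt0.
have b : forall x, `|resonance u x| <= 1.
  exact: (norm_mode_series _ _ amp_ge0 amp_le1).
have tF : tempered (of_function (resonance u)) := of_function_tempered m b.
have rF : real_valued (of_function (resonance u)) := @of_function_real_valued _ _ _.
move=> lty; split=> //; eexists.
 exact: (mode_series_has_fourier (fun n => scale n *: u) amp_ge0 amp_le1 width_gt0).
Qed.

Lemma C0infty_resonance u : dotv u u = 1 -> C0infty (resonance u).
Proof.
move=> u1; apply: C0infty_mode_series; first exact: width_gt0.
- by move=> n; rewrite exprn_ile1 ?scale_le1// ltW// scale_gt0.
- move=> n i; rewrite mxE normrM ger0_norm ?(ltW (scale_gt0 n))//.
  rewrite mulr_ile1 ?scale_le1 ?(ltW (scale_gt0 n))//.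
  by rewrite (le_trans (coord_le_enorm _ _))// /enorm u1 sqrtr1.
- by move=> n; rewrite ger0_norm ?amp_ge0 ?amp_le1.
Qed.

Lemma dotv_mulmx x y (Q : 'M[R]_d.+1) : dotv (x *m Q^T) y = dotv x (y *m Q).
Proof.
have dE (a b : V) : dotv a b = (a *m b^T) ord0 ord0.
  by rewrite mxE; apply: eq_bigr => i _; rewrite mxE.
by rewrite !dE trmx_mul mulmxA.
Qed.

(** For row vectors, Q^T u is [u *m Q]. The Gaussian factor is invariant under Q, and in the phase Q
    is moved onto u by adjunction. *)
Lemma resonance_mxact (Q : 'M[R]_d.+1) u x : orthogonal_mx Q ->
  resonance u (mxact Q x) = resonance (u *m Q) x.
Proof.
move=> oQ; rewrite /resonance /mode_series; congr (lim (series _ @ \oo)).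
apply/funext => k; rewrite /mode_term /mode /gauss /phase /mxact.
by rewrite !dotv_mulmx -mulmxA oQ mulmx1 -scalemxAl.
Qed.

End resonance.

Theorem proposition5p3 (R : realType) (s : R) (hs : 0 <= s) :
  [/\ @Xspace R 0 s = @Hspace R 1 s /\
      equivalent_norms (@Hspace R 1 s) (@Xnorm R 0 s) (@Hnorm R 1 s),
      forall d : nat, (2 <= d.+1)%N ->
        @Hspace R d.+1 s `<` @Xspace R d s /\
        forall f : functional R d.+1, @Hspace R d.+1 s f ->
          Xnorm s f <= 2 * Hnorm s f &
      forall d : nat, (2 <= d.+1)%N ->
        forall Q : 'M[R]_d.+1, orthogonal_mx Q ->
          `|dotv (mxact Q (basis_vec R ord0)) (basis_vec R ord0)| < 1 ->
          exists f : 'rV[R]_d.+1 -> R,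
            [/\ @Xspace R d s (of_function f), C0infty f &
                ~ @Xspace R d s (of_function (fun x => f (mxact Q x)))]].
Proof.
have basis1 d (i : 'I_d.+1) : dotv (basis_vec R i) (basis_vec R i) = 1.
  by rewrite dotv_basis basis_vecE eqxx.
have sqrt2 : Num.sqrt 2 <= 2 :> R.
  by rewrite -[leRHS]ger0_norm// -sqrtr_sqr ler_wsqrtr// expr2; lra.
have omega_bessel d : {ae lebesgue_Rd R d.+1, forall t,
    omega s (vec t) <= 2 * bessel_weight s (vec t)}.
  by apply: aeW => t; exact: omega_le_bessel.
have HX d F (HF : @Hspace R d.+1 s F) : @Xspace R d s F /\ Xnorm s F <= Num.sqrt 2 * Hnorm s F.
  exact: (weighted_norm_le (omega_ge0 s) (bessel_ge0 s) (mvec_omega s) (mvec_bessel s)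
    (ler0n _ 2) (omega_bessel d) HF).
split.
- have p0 : 0 < 2 `^ s :> R by exact: powR_gt0.
  have bessel_omega : {ae lebesgue_Rd R 1, forall t,
      bessel_weight s (vec t) <= 2 `^ s * omega s (vec t)}.
    by apply: filterS (vec_neq0_ae R) => t; exact: bessel_le_omega1.
  have XH F (XF : @Xspace R 0 s F) : @Hspace R 1 s F /\
      Hnorm s F <= Num.sqrt (2 `^ s) * Xnorm s F.
    exact: (weighted_norm_le (bessel_ge0 s) (omega_ge0 s) (mvec_bessel s) (mvec_omega s)
      (ltW p0) bessel_omega XF).
  split; first by apply/seteqP; split=> F; [move=> /XH[]|move=> /HX[]].
  (* Square roots of the constants in the two comparisons of weights. *)
  exists (Num.sqrt (2 `^ s))^-1, (Num.sqrt 2); split.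
  + by rewrite invr_gt0 sqrtr_gt0.
  + by rewrite sqrtr_gt0.
  + move=> F HF; have [XF h] := HX _ F HF; split=> //.
    by rewrite mulrC ler_pdivrMr ?sqrtr_gt0// mulrC; have [] := XH F XF.
- move=> d d2; split; last first.
    move=> F HF; have [_ h] := HX d F HF; apply: (le_trans h).
    by rewrite ler_wpM2r// /Hnorm /weighted_norm sqrtr_ge0.
  split; first by move=> F /HX[].
  (* The coordinate of index 1, available because the dimension is at least 2. *)
  pose i : 'I_d.+1 := Ordinal d2.
  have i0 : basis_vec R i ord0 ord0 = 0 by rewrite basis_vecE.
  move=> /(_ (of_function (resonance (basis_vec R i)))) HH.
  have [_ _ _] := HH (resonance_space (resonance_normsq hs i0 (basis1 d i))).
  exact: bessel_normsq_infty.
- move=> d d2 Q oQ Q00.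
  have oQ' : Q *m Q^T = 1%:M by exact: mulmx1C.
  have col1 : \sum_j Q j ord0 ^+ 2 = 1.
    have := congr1 (fun M : 'M[R]_d.+1 => M ord0 ord0) oQ; rewrite !mxE eqxx mulr1n => <-.
    by apply: eq_bigr => j _; rewrite mxE expr2.
  have Q00E : dotv (mxact Q (basis_vec R ord0)) (basis_vec R ord0) = Q ord0 ord0.
    by rewrite dotv_mulmx dotvC dotv_basis -rowE mxE.
  have [j jn0 Qj] : exists2 j : 'I_d.+1, j != ord0 & Q j ord0 != 0.
    (* Otherwise the first column of Q, a unit vector, would have its only nonzero entry at index 0,
       and |Q_00| would be 1. *)
    apply: contrapT => hN; move: Q00; rewrite Q00E => Q00.
    have Q0 j : j != ord0 -> Q j ord0 = 0.
      by move=> jn; apply/eqP; apply: contrapT => /negP h; apply: hN; exists j.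
    move: col1; rewrite (bigD1 ord0)//= big1 ?addr0; last first.
      by move=> j jn; rewrite Q0// expr0n.
    by rewrite -real_normK ?num_real// => h; have := normr_ge0 (Q ord0 ord0); nra.
  have j0 : basis_vec R j ord0 ord0 = 0 by rewrite basis_vecE (negbTE jn0).
  have rowE0 : (basis_vec R j *m Q) ord0 ord0 = Q j ord0 by rewrite -rowE mxE.
  have row1 : dotv (basis_vec R j *m Q) (basis_vec R j *m Q) = 1.
    have := dotv_mulmx (basis_vec R j *m Q) (basis_vec R j) Q.
    by rewrite -mulmxA oQ' mulmx1 basis1.
  exists (resonance (basis_vec R j)); split.
  + exact: (resonance_space (resonance_normsq hs j0 (basis1 d j))).
  + exact: C0infty_resonance (basis1 d j).
  + have -> : (fun x => resonance (basis_vec R j) (mxact Q x)) = resonance (basis_vec R j *m Q).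
      by apply/funext => x; exact: resonance_mxact.
    move=> [_ _ _]; apply: omega_normsq_infty row1 _.
    by rewrite rowE0.
Qed.
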